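(* Let $0<m\le\alpha\le r<\infty$, $0<p\le\alpha<q<\infty$, and let $b\in\mathcal W(0,\infty)$ be non-increasing on $(0,\infty)$ and such that $B(t):=\int_0^t b(s)\,ds$ satisfies $0<B(t)<\infty$ for every $t\in(0,\infty)$, $B\in\Delta_2$, $B(\infty)=\infty$, and $B(t)/t^{\alpha/r}$ is quasi-increasing. Let $\phi:(0,\infty)\to(0,\infty)$, $\phi\in\mathcal W(0,\infty)\cap C(0,\infty)$, be a quasi-increasing function with $\phi\in Q_r(0,\infty)$. Assume that $v\in\mathcal W_{m,p}(0,\infty)$ and $w\in\mathcal W(0,\infty)$. Then $$\begin{aligned}\|M_{\phi,\Lambda^\alpha(b)}\|_{G\Gamma(p,m,v)\to\Lambda^q(w)}\approx{}&\sup_{t\in(0,\infty)}\frac1{v_1(t)^{1/m}}\Big(\int_0^t\Big(\sup_{\tau\in[x,t]}\frac{B(\tau)^{1/\alpha}}{\phi(\tau)}\Big)^q w(x)\,dx\Big)^{\frac1q}\\ &+\sup_{t\in(0,\infty)}\frac{B(t)^{1/\alpha}}{v_1(t)^{1/m}}\Big(\sup_{\tau\in[t,\infty)}\frac1{\phi(\tau)}\Big)\Big(\int_0^t w(x)\,dx\Big)^{\frac1q}\\ &+\sup_{t\in(0,\infty)}\frac{B(t)^{1/\alpha}}{v_1(t)^{1/m}}\Big(\int_t^\infty\Big(\sup_{\tau\in[x,\infty)}\frac1{\phi(\tau)}\Big)^q w(x)\,dx\Big)^{\frac1q}.\end{aligned}$$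
   Context: $\mathfrak M(\mathbb R^n)$ is the set of Lebesgue measurable functions on $\mathbb R^n$. The non-increasing rearrangement of $f$ is $f^*(t)=\inf\{\lambda\ge 0: |\{x\in\mathbb R^n:|f(x)|>\lambda\}|\le t\}$. $\mathcal W(0,\infty)$ is the set of weights, i.e. locally integrable non-negative functions on $(0,\infty)$; $C(0,\infty)$ is the set of continuous functions on $(0,\infty)$. $B(\infty):=\lim_{t\to\infty}B(t)$. For $0<a<\infty$ and a weight $\omega$, $\|f\|_{\Lambda^a(\omega)}:=\big(\int_0^\infty[f^*(s)]^a\omega(s)\,ds\big)^{1/a}$, and $\|f\|_{G\Gamma(p,m,v)}:=\big(\int_0^\infty(\int_0^x[f^*(\tau)]^p\,d\tau)^{m/p}v(x)\,dx\big)^{1/m}$. The generalized maximal function is $$M_{\phi,\Lambda^\alpha(b)}f(x):=\sup_{Q\ni x}\frac{\|f\chi_Q\|_{\Lambda^\alpha(b)}}{\phi(|Q|)},\qquad x\in\mathbb R^n,$$ the supremum being over all open cubes $Q\subset\mathbb R^n$ with sides parallel to the coordinate axes containing $x$. $\|M_{\phi,\Lambda^\alpha(b)}\|_{G\Gamma(p,m,v)\to\Lambda^q(w)}$ is the best (least) constant $C\in[0,\infty]$ in $\|M_{\phi,\Lambda^\alpha(b)}f\|_{\Lambda^q(w)}\le C\|f\|_{G\Gamma(p,m,v)}$, $f\in\mathfrak M(\mathbb R^n)$. $\mathcal W_{m,p}(0,\infty)$ is the set of weights $v$ on $(0,\infty)$ such that $\int_0^t v(s)s^{m/p}\,ds+\int_t^\infty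 v(s)\,ds<\infty$ for all $t\in(0,\infty)$ and $\int_0^1 v(s)\,ds=\int_1^\infty v(s)s^{m/p}\,ds=\infty$. For such $v$, $$v_1(t):=\int_0^t v(s)s^{m/p}\,ds+t^{m/p}\int_t^\infty v(s)\,ds.$$ A function $\psi:(0,\infty)\to(0,\infty)$ satisfies $\psi\in\Delta_2$ if $\psi(2t)\le C\psi(t)$ for all $t>0$ and some $C>0$; it is quasi-increasing if $\psi(t_1)\le C\psi(t_2)$ whenever $0<t_1\le t_2<\infty$, for some $C>0$; and $\psi\in Q_r(0,\infty)$ if, for some $C>0$, $\psi\big(\sum_{i=1}^N t_i\big)\le C\big(\sum_{i=1}^N\psi(t_i)^r\big)^{1/r}$ for every finite set of positive numbers $\{t_1,\dots,t_N\}$. $X\approx Y$ means $X\le\lambda Y$ and $Y\le\lambda X$ for some finite $\lambda>0$ depending only on inessential parameters (here $n$, the exponents, and the constants in the $\Delta_2$, $Q_r$ and quasi-increasing conditions), so that one side is finite if and only if the other is. Conventions: $0\cdot\infty=\infty/\infty=0/0=0$. *)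

(* Defs.v *)
From HB Require Import structures.
From mathcomp Require Import all_boot all_order all_algebra.
From mathcomp Require Import all_classical all_reals all_analysis.
From mathcomp Require Import measurable_realfun.

Set Implicit Arguments.
Unset Strict Implicit.
Unset Printing Implicit Defensive.
Import Order.TTheory GRing.Theory Num.Theory.
Import numFieldNormedType.Exports.

Local Open Scope classical_set_scope.
Local Open Scope ring_scope.
Local Open Scope ereal_scope.

Lemma sigma_finite_product d1 d2 (T1 : measurableType d1)
    (T2 : measurableType d2) (R : realType)
    (m1 : {sigma_finite_measure set T1 -> \bar R})
    (m2 : {sigma_finite_measure set T2 -> \bar R}) :
  sigma_finite setT (m1 \x m2).
Proof.
have /sigma_finiteP[F [TF ndF Foo]] := sigma_finiteT m1.
have /sigma_finiteP[G [TG ndG Goo]] := sigma_finiteT m2.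
exists (fun n => F n `*` G n).
  rewrite -setXTT TF TG predeqE => -[x y]; split.
    move=> [/= [n _ Fnx] [k _ Gky]]; exists (maxn n k) => //; split.
    - by move: x Fnx; exact/subsetPset/ndF/leq_maxl.
    - by move: y Gky; exact/subsetPset/ndG/leq_maxr.
  by move=> [n _ []/= ? ?]; split; exists n.
move=> k; have [? ?] := Foo k; have [? ?] := Goo k.
split; first exact: measurableX.
by rewrite product_measure1E// lte_mul_pinfty// ge0_fin_numE.
Qed.

Section iterated_product.
Context d (T : measurableType d) (R : realType).
Variable m : {sigma_finite_measure set T -> \bar R}.

Definition cons_pair n (x : T * n.-tuple T) : n.+1.-tuple T :=
  [the n.+1.-tuple T of x.1 :: x.2].

Lemma measurable_cons_pair n : measurable_fun setT (@cons_pair n).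
Proof. exact: measurable_cons. Qed.

Section step.
Variables (n : nat) (mn : {sigma_finite_measure set (n.-tuple T) -> \bar R}).

Definition tuple_step : set (n.+1.-tuple T) -> \bar R :=
  pushforward (m \x mn) (@cons_pair n).

Let tuple_step0 : tuple_step set0 = 0.
Proof. by rewrite /tuple_step /pushforward preimage_set0 measure0. Qed.

Let tuple_step_ge0 A : 0 <= tuple_step A.
Proof. by rewrite /tuple_step /pushforward measure_ge0. Qed.

Let tuple_step_sigma_additive : semi_sigma_additive tuple_step.
Proof.
move=> F mF tF mUF; rewrite /tuple_step /pushforward preimage_bigcup.
apply: measure_semi_sigma_additive.
- by move=> k; rewrite -[X in measurable X]setTI; exact: measurable_cons_pair.
- apply/trivIsetP => /= i j _ _ ij; rewrite -preimage_setI.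
  by move/trivIsetP : tF => /(_ _ _ _ _ ij) ->//; rewrite preimage_set0.
- rewrite -preimage_bigcup -[X in measurable X]setTI.
  exact: measurable_cons_pair.
Qed.

HB.instance Definition _ := isMeasure.Build _ _ _ tuple_step
  tuple_step0 tuple_step_ge0 tuple_step_sigma_additive.

Lemma sigma_finite_tuple_step : sigma_finite setT tuple_step.
Proof.
have [F FT Foo] := sigma_finite_product m mn.
pose u (t : n.+1.-tuple T) : T * n.-tuple T := (thead t, [tuple of behead t]).
have mu : measurable_fun setT u.
  by apply/measurable_fun_pair; [exact: measurable_tnth|exact: measurable_behead].
have uK x : u (@cons_pair n x) = x.
  by case: x => x t; rewrite /u /cons_pair /= theadE; congr pair; exact: val_inj.
exists (fun k => u @^-1` F k); first by rewrite -preimage_bigcup -FT preimage_setT.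
move=> k; have [mF Fy] := Foo k; split.
  by rewrite -[X in measurable X]setTI; exact: mu.
rewrite /tuple_step /pushforward -comp_preimage.
by rewrite (_ : u \o _ = id)//; apply/funext => x /=.
Qed.

HB.instance Definition _ := @Measure_isSigmaFinite.Build _ _ _ tuple_step
  sigma_finite_tuple_step.
End step.

Fixpoint tuple_measure n : {sigma_finite_measure set (n.-tuple T) -> \bar R} :=
  if n is k.+1 then tuple_step (tuple_measure k) else \d_ [tuple].

End iterated_product.

(* n-dimensional Lebesgue measure: the completion (Caratheodory extension) of
   the n-fold Borel product measure.  Measurability on [lebesgue_space R n] and
   on [lebesgue_line R] is Lebesgue (not just Borel) measurability. *)
Section lebesgue_spaces.
Variable R : realType.

Definition lebesgue_line : Type := caratheodory_type ((wlength (@idfun R))^*)%mu.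
HB.instance Definition _ := Measurable.on lebesgue_line.

Definition lebesgue_space n : Type :=
  caratheodory_type ((tuple_measure (@lebesgue_measure R) n)^*)%mu.
HB.instance Definition _ n := Measurable.on (lebesgue_space n).

Definition lebesgue_n n : set (lebesgue_space n) -> \bar R :=
  @completed_measure_extension _ _ R (tuple_measure (@lebesgue_measure R) n).

HB.instance Definition _ n := Measure.on (@lebesgue_n n).
End lebesgue_spaces.

Section weights.
Variable R : realType.
Local Notation mu := (@completed_lebesgue_measure R).

(* A function on (0, +oo) is a function on R of which only the values on
   (0, +oo) matter. *)
Definition weight (w : R -> R) : Prop :=
  [/\ measurable_fun (`]0%R, +oo[ : set (lebesgue_line R)) w,
      forall t, (0 < t)%R -> (0 <= w t)%R &
      forall K : set R, compact K -> K `<=` `]0%R, +oo[ ->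
        \int[mu]_(s in K) `|w s|%:E < +oo].

Definition primitive (b : R -> R) (t : R) : R :=
  (\int[mu]_(s in `]0%R, t[) b s)%R.

(* The constants of the following three conditions are explicit because the
   constants in the equivalence are allowed to depend on them. *)
Definition Delta2 (C : R) (psi : R -> R) : Prop :=
  forall t, (0 < t)%R -> (psi (2 * t) <= C * psi t)%R.

Definition quasi_increasing (C : R) (psi : R -> R) : Prop :=
  forall t1 t2, (0 < t1)%R -> (t1 <= t2)%R -> (psi t1 <= C * psi t2)%R.

Definition Q_class (r C : R) (psi : R -> R) : Prop :=
  forall (N : nat) (t : 'I_N.+1 -> R), (forall i, (0 < t i)%R) ->
    (psi (\sum_(i < N.+1) t i) <=
      C * (\sum_(i < N.+1) psi (t i) `^ r) `^ r^-1)%R.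

Definition W_class (m p : R) (v : R -> R) : Prop :=
  [/\ weight v,
      forall t, (0 < t)%R ->
        \int[mu]_(s in `]0%R, t[) (v s * s `^ (m / p))%:E +
        \int[mu]_(s in `]t, +oo[) (v s)%:E < +oo,
      \int[mu]_(s in `]0%R, 1%R[) (v s)%:E = +oo &
      \int[mu]_(s in `]1%R, +oo[) (v s * s `^ (m / p))%:E = +oo].

Definition v1 (m p : R) (v : R -> R) (t : R) : \bar R :=
  \int[mu]_(s in `]0%R, t[) (v s * s `^ (m / p))%:E +
  (t `^ (m / p))%:E * \int[mu]_(s in `]t, +oo[) (v s)%:E.

End weights.

Section function_spaces.
Variables (R : realType) (n : nat).
Local Notation mu := (@completed_lebesgue_measure R).
Local Notation Rn := (lebesgue_space R n).
Implicit Types f : Rn -> \bar R.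

Definition rearrangement f (t : R) : \bar R :=
  ereal_inf [set l%:E | l in
    [set l : R | (0 <= l)%R /\
                 lebesgue_n [set x | l%:E < `|f x|] <= t%:E]].

Definition Lambda_norm (a : R) (w : R -> R) f : \bar R :=
  (\int[mu]_(s in `]0%R, +oo[) (rearrangement f s `^ a * (w s)%:E)) `^ a^-1.

Definition GGamma_norm (p m : R) (v : R -> R) f : \bar R :=
  (\int[mu]_(x in `]0%R, +oo[)
     ((\int[mu]_(s in `]0%R, x[) (rearrangement f s `^ p)) `^ (m / p) *
      (v x)%:E)) `^ m^-1.

Definition cube (c : n.-tuple R) (l : R) : set Rn :=
  [set x : n.-tuple R | forall i, (tnth c i < tnth x i < tnth c i + l)%R].

Definition is_cube (Q : set Rn) : Prop :=
  exists (c : n.-tuple R) (l : R), (0 < l)%R /\ Q = cube c l.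

Definition maximal (phi : R -> R) (alpha : R) (b : R -> R) f : Rn -> \bar R :=
  fun x => ereal_sup [set Lambda_norm alpha b (f \_ Q) /
                            (phi (fine (lebesgue_n Q)))%:E
                     | Q in [set Q | is_cube Q /\ Q x]].

(* Least C in [0, +oo] such that M : GGamma(p, m, v) -> Lambda^q(w) is bounded
   with constant C; the product follows the convention 0 * +oo = 0. *)
Definition maximal_norm (phi : R -> R) (alpha : R) (b : R -> R)
    (p m : R) (v : R -> R) (q : R) (w : R -> R) : \bar R :=
  ereal_inf [set C : \bar R | 0 <= C /\
    forall f, measurable_fun setT f ->
      Lambda_norm q w (maximal phi alpha b f) <= C * GGamma_norm p m v f].

End function_spaces.

(* Main.v *)
Require Import Defs.
From mathcomp Require Import all_boot all_order all_algebra.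
From mathcomp Require Import all_classical all_reals all_analysis.
From mathcomp Require Import measurable_realfun.
From mathcomp Require Import lra ring.

Import Order.TTheory GRing.Theory Num.Theory.
Import numFieldNormedType.Exports.

Local Open Scope classical_set_scope.
Local Open Scope ring_scope.
Local Open Scope ereal_scope.
Set Implicit Arguments.
Unset Strict Implicit.
Unset Printing Implicit Defensive.

(** Write th = m / p, let g be the non-increasing rearrangement of f, and let
    F(tau) be the norm of g restricted to (0, tau) in the Lorentz space with
    exponent alpha and weight b ([head_norm]).

    The three suprema are dominated by the norm of the operator because of the
    indicator functions of cubes.  If Q has measure t, the GGamma norm of its
    indicator is v1(t)^(1/m), and the rearrangement of the maximal function of
    this indicator is at least B(min(tau, t))^(1/alpha) / phi(tau) at every
    x < max(tau, t) ([rearrangement_maximal_ind_ge]): for tau <= t use cubes of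
    measure tau inside Q, for tau > t use one such cube containing Q.  Choosing
    tau in [x, t], tau >= t and tau >= x > t gives the three terms.

    For the converse, the maximal operator is first replaced by an operator on
    the half-line: the rearrangement of M f at x is at most a constant times
    the supremum of F(tau) / phi(tau) over tau >= x
    ([rearrangement_maximal_le]).  Vitali's lemma extracts from the cubes that
    witness M f > l a disjoint finite family of total measure tau comparable to
    x or larger; the l^r-sum of the local norms is bounded by F(tau), because
    B(t) / t^(alpha/r) is quasi-increasing ([lower_r_estimate]), and the l^r-sum
    of the numbers phi(|Q|) is bounded from below by phi(tau), because phi is
    in Q_r.

    For the operator on the half-line, the three suprema control its action on
    the indicators of the intervals (0, t) ([head_ind_bound]).  To pass to a
    general g ([weighted_inequality_bounded]), choose points y_j at which
    G(x), the integral of g^p over (0, x), decreases by factors of 2.  These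
    give a step function h for which h^th is a sum of c_j times the indicator
    of (0, y_j), G is at most twice the primitive of h, and the sum of
    c_j min(x, y_j)^th is at most a constant times G(x)^th
    ([level_decomposition]).  By the Hardy-Littlewood-Polya principle the
    integrals of g^alpha b are bounded by those of h^(alpha/p) b
    ([majorisation_powR]), and Jensen's inequality with exponent alpha / m >= 1
    bounds F^m by a combination of its values on the indicators
    ([atomic_majorant]).  Jensen's inequality with exponent q / m >= 1 in the
    integral against w then reduces the claim to the indicators.  Truncation
    and monotone convergence remove the boundedness of g
    ([weighted_inequality_general]).

    One degenerate case is left: if the suprema are infinite, the inequality
    has content only for functions of GGamma norm zero, and these vanish
    almost everywhere since v s^(m/p) has infinite integral at infinity
    ([GGamma_integral_eq0]). *)

(** * Integrals on the line and Hardy's lemma *)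
Section line.
Context {R : realType}.
Local Notation mu := (@completed_lebesgue_measure R).
Local Notation line := (lebesgue_line R).

Lemma borel_measurable_line (A : set (measurableTypeR R)) :
  measurable A -> measurable (A : set line).
Proof. exact: sub_caratheodory. Qed.

Lemma measurable_itv_line (i : interval R) : measurable ([set` i] : set line).
Proof. by apply: borel_measurable_line; exact: measurable_itv. Qed.

Lemma measurable_line_id : measurable_fun setT (fun x : line => x : R).
Proof. by move=> _ A mA; rewrite setTI; exact: borel_measurable_line. Qed.

Lemma mu_borelE (A : set (measurableTypeR R)) : mu A = lebesgue_measure A.
Proof. by []. Qed.

Lemma mu_itv0 (t : R) : (0 <= t)%R -> mu (`]0%R, t[) = t%:E.
Proof.
move=> t0; rewrite mu_borelE lebesgue_measure_itv/= lte_fin.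
by case: ltgtP t0 => // [t0 _|<- //]; rewrite -EFinB subr0.
Qed.

(** The integral of a non-negative function is a supremum over the simple
    functions below it, so that it is monotone on arbitrary functions. *)
Lemma ge0_le_lower_integral d (T : measurableType d)
    (nu : {measure set T -> \bar R}) (D D' : set T) (f g : T -> \bar R) :
  (forall x, D' x -> 0 <= g x) -> D `<=` D' ->
  (forall x, D x -> 0 <= f x <= g x) ->
  \int[nu]_(x in D) f x <= \int[nu]_(x in D') g x.
Proof.
move=> g0 DD' fg.
have f0 x : D x -> 0 <= f x by move=> /fg/andP[].
rewrite integral_mkcond [leRHS]integral_mkcond !ge0_integralTE; last 2 first.
- by move=> x; apply: erestrict_ge0.
- by move=> x; apply: erestrict_ge0.
apply/ge_ereal_sup => _ [h /= hf <-]; apply: ereal_sup_ubound.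
exists h => // x /=; apply: (le_trans (hf x)); rewrite !patchE.
case: ifPn => [|xD]; rewrite ?inE.
  by move=> Dx; rewrite (mem_set (DD' _ Dx)); case/andP: (fg _ Dx).
by case: ifPn => //; rewrite inE => /g0.
Qed.

(** Superlevel sets are intervals. *)
Lemma nonincreasing_measurable_line (f : R -> \bar R) :
  (forall x y : R, (0 < x)%R -> (x <= y)%R -> f y <= f x) ->
  measurable_fun (`]0%R, +oo[ : set line) f.
Proof.
move=> fni mD; apply: (measurability _ (ErealGenCInfty.measurableE R)) => //.
move=> _ [_ [x ->] <-]; apply: borel_measurable_line.
apply: is_interval_measurable => a b/= [a0 fa] [b0 fb] c /andP[ac box_cube].
have c0 : `]0%R, +oo[%classic c.
  by move: a0; rewrite /= !in_itv/= !andbT => /lt_le_trans; apply.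
split => //; move: fb; rewrite /= !in_itv/= !andbT => /le_trans; apply.
by apply: fni => //; move: c0; rewrite /= in_itv/= andbT.
Qed.

End line.

Section layer_cake.
Context {R : realType} d (T : measurableType d)
  (nu : {sigma_finite_measure set T -> \bar R}).
Local Notation leb := (@completed_lebesgue_measure R).
Local Notation line := (lebesgue_line R).

Lemma lebesgue_measure_below (y : \bar R) : 0 <= y ->
  leb [set l | (0 < l)%R /\ l%:E < y] = y.
Proof.
case: y => [y|_|//].
- rewrite lee_fin => y0.
  rewrite (_ : [set l | _] = `]0%R, y[%classic); last first.
    by apply/seteqP; split => l /=; rewrite in_itv/= lte_fin; [case=> -> ->|case/andP].
  exact: mu_itv0.
- rewrite (_ : [set l | _] = `]0%R, +oo[%classic); last first.
    by apply/seteqP; split => l /=; rewrite in_itv/= andbT; [case=> ->|move=> ->; rewrite ltry].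
  by rewrite mu_borelE lebesgue_measure_itv/= ltry.
Qed.

(** Tonelli's theorem on the region below the graph of [k]. *)
Lemma layer_cake (D : set T) (u k : T -> \bar R) : measurable D ->
  measurable_fun D u -> measurable_fun D k ->
  (forall x, D x -> 0 <= u x) -> (forall x, D x -> 0 <= k x) ->
  \int[nu]_(x in D) (u x * k x) =
  \int[leb]_(l in `]0%R, +oo[) \int[nu]_(x in D `&` [set x | l%:E < k x]) u x.
Proof.
move=> mD mu mk u0 k0.
have mu' : measurable_fun setT (u \_ D) by exact/(measurable_restrictT _ _).1.
have mk' : measurable_fun setT (k \_ D) by exact/(measurable_restrictT _ _).1.
have u'0 x : 0 <= (u \_ D) x by apply: erestrict_ge0.
have k'0 x : 0 <= (k \_ D) x by apply: erestrict_ge0.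
pose S := [set z : T * line | (0 < z.2)%R /\ z.2%:E < (k \_ D) z.1].
have mS : measurable S.
  have m2 : measurable_fun setT (fun z : T * line => z.2 : R).
    exact: measurableT_comp measurable_line_id measurable_snd.
  apply: measurableI; rewrite -[X in measurable X]setTI.
    exact: (measurable_fun_ltr).
  apply: measurable_lte => //.
    exact/measurable_EFinP.
  by apply: measurableT_comp => //; exact: measurable_fst.
pose f z := (u \_ D) z.1 * (\1_S z)%:E.
have mf : measurable_fun setT f.
  apply: emeasurable_funM.
    by apply: measurableT_comp => //; exact: measurable_fst.
  by apply/measurable_EFinP; exact: measurable_indic.
have f0 z : 0 <= f z by rewrite mule_ge0// lee_fin.
have fub := fubini_tonelli (m1 := nu) (m2 := leb) f mf f0.
transitivity (\int[nu]_x \int[leb]_y f (x, y)).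
  rewrite integral_mkcond; apply: eq_integral => x _.
  pose Sx : set line := [set l | (0 < l)%R /\ l%:E < (k \_ D) x].
  have mSx : measurable Sx.
    apply: borel_measurable_line; apply: is_interval_measurable => a b/= [a0 ay] [b0 bk] c /andP[ac box_cube].
    split; first exact: lt_le_trans ac.
    by apply: le_lt_trans bk; rewrite lee_fin.
  transitivity (\int[leb]_y ((u \_ D) x * (\1_Sx y)%:E)); last exact: eq_integral.
  have m1 : measurable_fun [set: line] (EFin \o (\1_Sx : line -> R)).
    by apply/measurable_EFinP; exact: measurable_indic.
  have p1 (y : line) : [set: line] y -> 0 <= (EFin \o (\1_Sx : line -> R)) y by rewrite /= lee_fin.
  have -> := ge0_integralZl leb (@measurableT _ line) m1 p1 (u'0 x).
  have -> : \int[leb]_y (\1_Sx y)%:E = (k \_ D) x.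
    have := integral_indic leb measurableT mSx; rewrite setIT => ->.
    exact: lebesgue_measure_below.
  by rewrite !patchE; case: ifPn => //; rewrite mul0e.
rewrite fub [RHS]integral_mkcond; apply: eq_integral => y _.
rewrite [RHS]patchE; case: ifPn => y0; last first.
  apply: integral0_eq => x _; rewrite /f indicE memNset ?mule0// => -[/= y1 _].
  by move/negP: y0; apply; rewrite inE/= in_itv/= y1.
rewrite [RHS]integral_mkcond; apply: eq_integral => x _.
rewrite /f/= indicE !patchE; case: ifPn => xD.
  have y1 : (0 < y)%R by move: y0; rewrite inE/= in_itv/= andbT.
  case: ifPn => [xk|/negP xk].
    rewrite mem_set ?mule1// /S/= patchE xD; split => //.
    by move: xk; rewrite inE => -[].
  rewrite memNset ?mule0// /S/= patchE xD => -[_ yk]; apply: xk.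
  by rewrite inE; split => //; move: xD; rewrite inE.
rewrite mul0e ifF//; apply/negbTE; apply: contra xD.
by rewrite !inE => -[].
Qed.
End layer_cake.

Section hardy.
Context {R : realType}.
Local Notation mu := (@completed_lebesgue_measure R).
Local Notation line := (lebesgue_line R).

(** The possible superlevel sets of a non-increasing function on the half-line;
    the layer-cake formula turns an integral against such a function into
    integrals over these sets. *)
Lemma down_closed_itv (A : set R) : A `<=` `]0%R, +oo[ ->
  (forall x y : R, A y -> (0 < x)%R -> (x <= y)%R -> A x) ->
  [\/ A = `]0%R, +oo[%classic, A = set0 |
     exists2 s, (0 < s)%R & A = `]0%R, s[%classic \/ A = `]0%R, s]%classic].
Proof.
move=> A0 Ad.
have [->|/set0P[a Aa]] := eqVneq A set0; first by apply: Or32.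
have a0 : (0 < a)%R by have := A0 _ Aa; rewrite /= in_itv/= andbT.
have [ubA|nubA] := pselect (has_ubound A); last first.
  apply: Or31; apply/seteqP; split => // x; rewrite /= in_itv/= andbT => x0.
  have [y Ay xy] : exists2 y, A y & (x <= y)%R.
    apply: contrapT => H; apply: nubA; exists x => y Ay.
    by rewrite leNgt; apply/negP => /ltW xy; apply: H; exists y.
  exact: Ad Ay _ xy.
apply: Or33; exists (sup A).
  by apply: lt_le_trans a0 _; exact: ub_le_sup.
have [As|As] := pselect (A (sup A)).
  right; apply/seteqP; split => x /=; rewrite in_itv/=.
    move=> Ax; have := A0 _ Ax; rewrite /= in_itv/= andbT => -> /=.
    exact: ub_le_sup.
  by move=> /andP[x0 xs]; exact: Ad As _ xs.
left; apply/seteqP; split => x /=; rewrite in_itv/=.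
  move=> Ax; have := A0 _ Ax; rewrite /= in_itv/= andbT => -> /=.
  rewrite lt_neqAle ub_le_sup// andbT; apply: contra_notN As => /eqP <-//.
move=> /andP[x0 xs].
have [y Ay xy] := sup_gt (ex_intro A a Aa) xs.
by apply: Ad Ay _ (ltW xy).
Qed.

Lemma integral_itvoc_itvoo (s : R) (f : R -> \bar R) : (0 < s)%R ->
  measurable_fun (`]0%R, +oo[ : set line) f -> (forall x : R, (0 < x)%R -> 0 <= f x) ->
  \int[mu]_(x in `]0%R, s]) f x = \int[mu]_(x in `]0%R, s[) f x.
Proof.
move=> s0 mf f0.
have mS : measurable ([set s] : set line) by exact: borel_measurable_line.
have mI : measurable (`]0%R, s] : set line) by exact: measurable_itv_line.
have mfI : measurable_fun (`]0%R, s] : set line) f.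
  apply: measurable_funS mf; first exact: measurable_itv_line.
  by move=> x /=; rewrite !in_itv/= andbT => /andP[].
have f0I (x : line) : [set` `]0%R, s]] x -> 0 <= f x.
  by rewrite /= in_itv/= => /andP[x0 _]; exact: f0.
have s0' : mu [set s] = 0 by rewrite mu_borelE lebesgue_measure_set1.
have <- : `]0%R, s] `\` [set s] = `]0%R, s[%classic :> set R.
  apply/seteqP; split => x /=; rewrite !in_itv/=.
    by move=> [/andP[-> xs] /eqP]; rewrite lt_neqAle xs andbT.
  by move=> /andP[-> xs]; split; [exact: ltW|move=> xE; rewrite xE ltxx in xs].
exact: (ge0_negligible_integral mS mI mfI f0I s0').
Qed.

Lemma cvg_integral_itv0 (f : R -> \bar R) :
  measurable_fun (`]0%R, +oo[ : set line) f -> (forall x : R, (0 < x)%R -> 0 <= f x) ->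
  \int[mu]_(x in `]0%R, n%:R[) f x @[n --> \oo] --> \int[mu]_(x in `]0%R, +oo[) f x.
Proof.
move=> mf f0; have -> : `]0%R, +oo[%classic = \bigcup_n `]0%R, n%:R[%classic :> set R.
  apply/seteqP; split => x /=; rewrite in_itv/= ?andbT.
    move=> x0; exists (Num.truncn x).+1 => //=; rewrite in_itv/= x0/=.
    by have /andP[] := truncn_itv (ltW x0).
  by move=> [n _]; rewrite /= in_itv/= => /andP[].
apply: ge0_nondecreasing_set_cvg_integral.
- move=> a b ab; rewrite subsetEset; apply: subset_itvl.
  by rewrite bnd_simp ler_nat.
- by move=> n; exact: measurable_itv_line.
- move=> n; apply: measurable_funS mf; first exact: measurable_itv_line.
  by move=> x /=; rewrite !in_itv/= andbT => /andP[].
- by move=> n x /=; rewrite in_itv/= => /andP[x0 _]; exact: f0.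
Qed.

(** By the layer-cake formula [k] is a superposition of indicators of initial
    intervals, for which the inequality is the hypothesis. *)
Lemma hardy_lemma (C : R) (u h : R -> \bar R) (k : R -> \bar R) : (0 <= C)%R ->
  measurable_fun (`]0%R, +oo[ : set line) u ->
  measurable_fun (`]0%R, +oo[ : set line) h ->
  (forall x : R, (0 < x)%R -> 0 <= u x) -> (forall x : R, (0 < x)%R -> 0 <= h x) ->
  (forall x : R, (0 < x)%R -> 0 <= k x) ->
  (forall x y : R, (0 < x)%R -> (x <= y)%R -> k y <= k x) ->
  (forall x : R, (0 < x)%R ->
    \int[mu]_(s in `]0%R, x[) u s <= C%:E * \int[mu]_(s in `]0%R, x[) h s) ->
  \int[mu]_(s in `]0%R, +oo[) (u s * k s) <=
  C%:E * \int[mu]_(s in `]0%R, +oo[) (h s * k s).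
Proof.
move=> C0 mu' mh u0 h0 k0 kni uh.
have mk := nonincreasing_measurable_line kni.
have mD : measurable (`]0%R, +oo[%classic : set line) by exact: measurable_itv_line.
have D0 (x : R) : `]0%R, +oo[%classic x -> (0 < x)%R by rewrite /= in_itv/= andbT.
have uhy : \int[mu]_(s in `]0%R, +oo[) u s <= C%:E * \int[mu]_(s in `]0%R, +oo[) h s.
  apply: (cvge_to_le (cvg_integral_itv0 mu' u0)); exists 1%N => // n /= n1.
  apply: le_trans (uh n%:R _) _; first by rewrite ltr0n.
  apply: lee_wpmul2l; first by rewrite lee_fin.
  apply: ge0_le_lower_integral => [x /D0/h0//| x /= | x /=].
    by rewrite !in_itv/= andbT => /andP[].
  by rewrite in_itv/= => /andP[x0 _]; rewrite h0/=.
have u0D (x : R) : `]0%R, +oo[%classic x -> 0 <= u x by move=> /D0/u0.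
have k0D (x : R) : `]0%R, +oo[%classic x -> 0 <= k x by move=> /D0/k0.
have Ch0D (x : R) : `]0%R, +oo[%classic x -> 0 <= C%:E * h x.
  by move=> /D0 x0; rewrite mule_ge0// ?lee_fin ?h0.
have mCh : measurable_fun (`]0%R, +oo[ : set line) (fun x => C%:E * h x).
  exact: emeasurable_funM.
have -> : C%:E * \int[mu]_(s in `]0%R, +oo[) (h s * k s) =
    \int[mu]_(s in `]0%R, +oo[) (C%:E * h s * k s).
  transitivity (\int[mu]_(s in `]0%R, +oo[) (C%:E * (h s * k s))).
    have hk0 (x : R) : `]0%R, +oo[%classic x -> 0 <= h x * k x.
      by move=> /D0 x0; rewrite mule_ge0// ?h0 ?k0.
    by have /(_ C C0) -> := ge0_integralZl_EFin mu mD hk0 (emeasurable_funM mh mk).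
  by apply: eq_integral => x _; rewrite muleA.
rewrite (layer_cake mu mD mu' mk u0D k0D) (layer_cake mu mD mCh mk Ch0D k0D).
apply: ge0_le_lower_integral => //.
  by move=> l _; apply: integral_ge0 => x [/D0 x0 _]; rewrite mule_ge0// ?lee_fin ?h0.
move=> l _; rewrite integral_ge0/=; last by move=> x [/D0 x0 _]; exact: u0.
set A := _ `&` _.
have mA : measurable (A : set line).
  by have := emeasurable_fun_o_infty mD mk l%:E.
have mS (S : set line) : measurable S -> S `<=` `]0%R, +oo[ -> measurable_fun S h.
  by move=> _ SD; exact: measurable_funS mh.
rewrite ge0_integralZl_EFin//; last 2 first.
- by move=> x [/D0 x0 _]; exact: h0.
- by apply: mS => // x [].
have AD : (A : set R) `<=` `]0%R, +oo[ by move=> x [].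
have Ad (x y : R) : A y -> (0 < x)%R -> (x <= y)%R -> A x.
  move=> [/D0 y0 ly] x0 xy; split; first by rewrite /= in_itv/= x0.
  by apply: (lt_le_trans ly); apply: kni.
have [->|->|[s s0 sE]] := down_closed_itv AD Ad.
- exact: uhy.
- by rewrite !integral_set0 mule0.
- have H f : measurable_fun (`]0%R, +oo[ : set line) f ->
      (forall x : R, (0 < x)%R -> 0 <= f x) ->
      \int[mu]_(x in A) f x = \int[mu]_(x in `]0%R, s[) f x.
    by case: sE => -> // mf f0; exact: integral_itvoc_itvoo.
  by rewrite (H _ mu' u0) (H _ mh h0); exact: uh.
Qed.
End hardy.

(** * Convexity inequalities and the level decomposition *)
Section real_inequalities.
Context {R : realType}.
Local Open Scope ring_scope.

Lemma young_powR (a x y : R) : 1 <= a -> 0 <= x -> 0 <= y ->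
  x * y `^ (a - 1) <= x `^ a / a + (1 - a^-1) * y `^ a.
Proof.
move=> a1 x0 y0; have a0 : 0 < a by exact: lt_le_trans a1.
move: a1; rewrite le_eqVlt => /predU1P[<-|a1].
  by rewrite subrr powRr0 invr1 !mulr1 subrr mul0r addr0 powRr1.
have a10 : 0 < a - 1 by rewrite subr_gt0.
have e : a^-1 + (a / (a - 1))^-1 = 1.
  by rewrite invf_div mulrBl divff ?gt_eqF// mul1r addrC subrK.
have := conjugate_powR x0 (powR_ge0 y (a - 1)) a0 (divr_gt0 a0 a10) e.
rewrite -powRrM (_ : (a - 1) * (a / (a - 1)) = a); last first.
  by rewrite mulrCA divff ?mulr1// gt_eqF.
move=> /le_trans; apply; rewrite lerD2l mulrC.
have -> // : (a / (a - 1))^-1 = 1 - a^-1.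
by apply/eqP; rewrite eq_sym subr_eq addrC e.
Qed.

(** Jensen's inequality for the values [X i / V i] with weights [c i * V i]:
    sum Young's inequality between each value and their mean [Z]. *)
Lemma jensen_powR (a : R) (n : nat) (c V X : 'I_n -> R) : 1 <= a ->
  (forall i, 0 <= c i) -> (forall i, 0 < V i) -> (forall i, 0 <= X i) ->
  (\sum_i c i * X i) `^ a <=
  (\sum_i c i * V i) `^ (a - 1) * \sum_i c i * (V i `^ (1 - a) * X i `^ a).
Proof.
move=> a1 c0 V0 X0; have a0 : 0 < a by exact: lt_le_trans a1.
set M := \sum_i c i * V i; set S := \sum_i c i * X i; set Z := S / M.
have M0 : 0 <= M by apply: sumr_ge0 => i _; rewrite mulr_ge0// ltW.
have S0 : 0 <= S by apply: sumr_ge0 => i _; rewrite mulr_ge0.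
have Z0 : 0 <= Z by rewrite divr_ge0.
have [M_0|Mneq0] := eqVneq M 0.
  have c00 i : c i = 0.
    have /eqP := M_0; rewrite psumr_eq0; last first.
      by move=> j _; rewrite mulr_ge0// ltW.
    move=> /allP /(_ i); rewrite mem_index_enum => /(_ isT).
    by rewrite mulf_eq0 (gt_eqF (V0 i)) orbF => /eqP.
  have -> : S = 0 by rewrite /S big1// => i _; rewrite c00 mul0r.
  rewrite powR0 ?gt_eqF// mulr_ge0 ?powR_ge0// sumr_ge0// => i _.
  by rewrite !mulr_ge0 ?powR_ge0.
have Mgt0 : 0 < M by rewrite lt_neqAle eq_sym Mneq0.
have SE : S = M * Z by rewrite /Z mulrCA divff ?mulr1.
set T := \sum_i _.
have key : Z * Z `^ (a - 1) * M <= T / a + (1 - a^-1) * Z `^ a * M.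
  have -> : Z * Z `^ (a - 1) * M = \sum_i c i * V i * (X i / V i * Z `^ (a - 1)).
    rewrite mulrAC (mulrC Z) -SE /S mulr_suml; apply: eq_bigr => i _.
    by rewrite !mulrA; congr (_ * _); rewrite mulrAC mulfK// gt_eqF.
  have -> : T / a + (1 - a^-1) * Z `^ a * M =
     \sum_i c i * V i * ((X i / V i) `^ a / a + (1 - a^-1) * Z `^ a).
    rewrite /T mulr_suml /M mulr_sumr -big_split; apply: eq_bigr => i _ /=.
    rewrite mulrDr; congr (_ + _); last by rewrite mulrC.
    rewrite powRM ?invr_ge0 ?(ltW (V0 _))// powRB; last first.
      by rewrite (gt_eqF (V0 i)) implybT.
    rewrite powRr1 ?(ltW (V0 _))// -[(V i)^-1]powR_inv1 ?(ltW (V0 _))//.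
    by rewrite -powRrM mulN1r powRN; ring.
  apply: ler_sum => i _; apply: ler_wpM2l; first by rewrite mulr_ge0// ltW.
  by apply: young_powR => //; rewrite divr_ge0// ltW.
have {key} : Z `^ a * M <= T.
  rewrite mulr_powRB1// in key.
  have : Z `^ a * M / a <= T / a.
    have -> : Z `^ a * M / a = Z `^ a * M - (1 - a^-1) * Z `^ a * M by ring.
    by rewrite lerBlDr.
  by rewrite ler_pM2r ?invr_gt0.
rewrite SE powRM// => key.
have -> : M `^ a = M `^ (a - 1) * M by rewrite mulrC mulr_powRB1.
by rewrite -mulrA (mulrC M) ler_wpM2l ?powR_ge0.
Qed.

(** The levels are geometric, so that those below [G] add up to a multiple of
    the largest one. *)
Lemma geometric_level_sum (th L G : R) (J : nat) : 0 < th -> 0 < L -> 0 <= G ->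
  \sum_(j < J | L / 2 ^+ j <= G) (L / 2 ^+ j) `^ th <=
  (1 - 2 `^ (- th))^-1 * G `^ th.
Proof.
move=> th0 L0 G0; set rho := 2 `^ (- th); set e := fun j => L / 2 ^+ j.
have rho1 : rho < 1.
  have := @gt0_ltr_powR R th th0 1 2; rewrite !nnegrE ler01 ler0n powR1 ltr1n.
  by move=> /(_ isT isT isT) h; rewrite /rho powRN invf_lt1// powR_gt0.
have d0 : 0 < 1 - rho by rewrite subr_gt0.
have e0 j : 0 < e j by rewrite divr_gt0// exprn_gt0.
have eS j : e j.+1 = e j / 2 by rewrite /e exprSr invfM mulrA.
have ePS j : e j.+1 `^ th = rho * e j `^ th.
  rewrite eS powRM ?(ltW (e0 _))// mulrC; congr (_ * _).
  by rewrite -powR_inv1// -powRrM mulN1r.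
have emono j : e j <= G -> e j.+1 <= G.
  by apply: le_trans; rewrite eS ler_pdivrMr// ler_peMr ?(ltW (e0 _))// ler1n.
(* The induction keeps the part of the geometric series that is still to come. *)
have H : \sum_(j < J | e j <= G) e j `^ th <=
    if e J <= G then (1 - rho)^-1 * (G `^ th - e J `^ th) else 0.
  have pos j : e j <= G -> 0 <= (1 - rho)^-1 * (G `^ th - e j `^ th).
    move=> ejG; rewrite mulr_ge0 ?invr_ge0 ?(ltW d0)// subr_ge0.
    by rewrite ge0_ler_powR ?nnegrE ?(ltW th0) ?(ltW (e0 _)).
  elim: J => [|J IH].
    by rewrite big_ord0; case: ifPn => // /pos.
  rewrite big_mkcond big_ord_recr -big_mkcond/=.
  case: ifPn IH => eJ IH; last first.
    by rewrite addr0; apply: le_trans IH _; case: ifPn => // /pos.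
  rewrite emono// ePS; apply: le_trans (lerD IH (lexx _)) _.
  rewrite le_eqVlt; apply/orP; left; apply/eqP.
  by field; rewrite gt_eqF.
apply: le_trans H _; case: ifPn => _; last first.
  by rewrite mulr_ge0 ?powR_ge0// invr_ge0 ltW.
by rewrite ler_wpM2l ?invr_ge0 ?(ltW d0)// gerBl powR_ge0.
Qed.

Section levels.
Variables (G : R -> R).
Hypothesis G0 : forall x : R, 0 < x -> 0 <= G x.
Hypothesis Gmono : forall x y : R, 0 < x -> x <= y -> G x <= G y.
Hypothesis Gquasi : forall x y : R, 0 < x -> x <= y -> G y * x <= G x * y.

(** An intermediate value property: at the supremum [y] of the set where
    [G <= l], monotonicity of [G x / x] excludes that [G y] differs from [l]. *)
Lemma level_attained (l N x1 : R) : 0 < l -> 0 < x1 -> G x1 <= l -> 0 < N ->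
  l <= G N -> exists2 y, 0 < y & G y = l.
Proof.
move=> l0 x10 Gx1 N0; rewrite le_eqVlt => /predU1P[->|lN]; first by exists N.
pose A := [set x | 0 < x /\ G x <= l].
have A1 : A x1 by [].
have Aub : ubound A N.
  move=> x [x0 Gx]; rewrite leNgt; apply/negP => Nx.
  by have := lt_le_trans lN (Gmono N0 (ltW Nx)); rewrite ltNge Gx.
have hA : has_sup A by split; [exists x1|exists N].
set y := sup A.
have y0 : 0 < y by apply: lt_le_trans x10 _; apply: ub_le_sup => //; exists N.
exists y => //; apply/eqP; rewrite eq_le; apply/andP; split.
- rewrite leNgt; apply/negP => ly.
  have Gy0 : 0 < G y by exact: lt_trans ly.
  have below x : 0 < x -> x < y -> G y * x <= l * y.
    move=> x0 xy; apply: le_trans (Gquasi x0 (ltW xy)) _.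
    rewrite ler_pM2r//; have [z [z0 Gz] xz] := sup_gt (ex_intro A x1 A1) xy.
    exact: le_trans (Gmono x0 (ltW xz)) Gz.
  (* [G y * x / y] is the mean of [l] and [G y], hence exceeds [l]. *)
  pose x := y * ((l + G y) / 2 / G y).
  have x0 : 0 < x by rewrite !mulr_gt0 ?invr_gt0// addr_gt0.
  have xy : x < y.
    rewrite /x gtr_pMr// ltr_pdivrMr// mul1r ltr_pdivrMr//.
    by rewrite mulr_natr mulr2n ltrD2r.
  have := below _ x0 xy; rewrite /x leNgt => /negP; apply.
  have -> : G y * (y * ((l + G y) / 2 / G y)) = (l + G y) / 2 * y.
    by field; rewrite gt_eqF.
  rewrite ltr_pM2r// ltr_pdivlMr// mulr_natr mulr2n ltrD2l//.
- rewrite leNgt; apply/negP => yl.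
  have above x : y < x -> l * y < G y * x.
    move=> xy; apply: lt_le_trans (Gquasi y0 (ltW xy)).
    rewrite ltr_pM2r// ltNge; apply/negP => Gx.
    have : x <= y by apply: ub_le_sup; [exists N|split => //; exact: lt_trans xy].
    by rewrite leNgt xy.
  have [Gy0|Gyn0] := eqVneq (G y) 0.
    have := above (y + 1); rewrite ltrDl ltr01 => /(_ isT).
    by rewrite Gy0 mul0r ltNge mulr_ge0// ltW.
  have Gy0 : 0 < G y by rewrite lt_neqAle eq_sym Gyn0 G0.
  have := above (y * (l / G y)); rewrite ltr_pMr// ltr_pdivlMr// mul1r.
  by move=> /(_ yl); rewrite (_ : G y * _ = l * y) ?ltxx//; field; rewrite gt_eqF.
Qed.

(** With levels [G (y j) = G N / 2 ^ j], slopes [D j = G (y j) / y j] and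
    [c] the increments of [D j `^ th], the function
    [s |-> \sum_i c i * (s < y i)] is the [th]-th power of a step function that
    takes the value [D j] between [y (j + 1)] and [y j].  Up to a factor, the
    primitive of this step function dominates [G], while replacing each
    indicator by [min x (y i) `^ th] does not exceed [G x `^ th]: the terms with
    [x < y i] telescope to the power of a slope below [G x / x], and the other
    ones are at most [G (y i) `^ th], which sum geometrically. *)
Lemma level_decomposition (th K N : R) : 0 < th ->
  (forall x : R, 0 < x -> G x <= K * x) -> 0 < N -> 0 < G N ->
  (forall x : R, N <= x -> G x = G N) ->
  exists (J : nat) (c y : nat -> R), [/\ forall i, 0 <= c i, forall i, 0 < y i,
    forall x : R, 0 < x -> exists z D : R, [/\ 0 < z <= x, 0 <= D, G x <= 2 * (D * z) &
      forall s : R, s < z -> D `^ th <= \sum_(i < J) c i * (s < y i)%R%:R] &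
    forall x : R, 0 < x -> \sum_(i < J) c i * Num.min x (y i) `^ th <=
      (1 + (1 - 2 `^ (- th))^-1) * G x `^ th].
Proof.
move=> th0 GK N0 GN0 GN.
have GleN x : 0 < x -> G x <= G N.
  by move=> x0; have [xN|/ltW/GN->//] := leP x N; exact: Gmono.
pose e j : R := G N / 2 ^+ j.
have e0 j : 0 < e j by rewrite divr_gt0// exprn_gt0.
have eS j : e j = 2 * e j.+1.
  by rewrite /e exprSr; field; rewrite expf_neq0 ?pnatr_eq0.
have eN j : e j <= G N by rewrite /e ler_pdivrMr ?exprn_gt0// ler_peMr ?(ltW GN0)// exprn_ege1 ?ler1n.
have K0 : 0 < K.
  by have := lt_le_trans GN0 (GK _ N0); rewrite pmulr_lgt0.
have yP j : exists y, 0 < y /\ G y = e j.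
  have x10 : 0 < e j / K by rewrite divr_gt0.
  have [|y ? ?] := level_attained (e0 j) x10 _ N0 (eN j); last by exists y.
  by apply: le_trans (GK _ x10) _; rewrite mulrC divfK ?gt_eqF.
have {yP}[y /all_and2[y0 Gy]] := choice yP.
have yS j : y j.+1 < y j.
  rewrite ltNge; apply/negP => /(Gmono (y0 j)); rewrite !Gy eS leNgt => /negP; apply.
  by rewrite ltr_pMl// ltr1n.
have yle i j : (i <= j)%N -> y j <= y i.
  move=> /subnK <-; elim: (j - i)%N => // k IH.
  by rewrite addSn; apply: le_trans IH; exact: ltW.
pose D j := G (y j) / y j.
have D0 j : 0 < D j by rewrite /D Gy divr_gt0.
have Dz j : D j * y j = e j by rewrite /D divfK ?Gy ?gt_eqF.
have DleG j x : 0 < x -> x <= y j -> D j <= G x / x.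
  by move=> x0 xy; rewrite ler_pdivlMr// mulrAC ler_pdivrMr// Gquasi.
have GleD j x : y j <= x -> G x / x <= D j.
  move=> yx; have x0 := lt_le_trans (y0 j) yx.
  by rewrite ler_pdivrMr// mulrAC ler_pdivlMr// Gquasi.
pose d j := D j `^ th.
have dS j : d j <= d j.+1.
  by rewrite /d ge0_ler_powR ?nnegrE ?(ltW th0) ?(ltW (D0 _))// DleG// ltW.
pose c j := d j - (if j is k.+1 then d k else 0).
have c0 j : 0 <= c j by case: j => [|j]; rewrite /c ?subr0 ?powR_ge0// subr_ge0.
have cd j : c j <= d j by case: j => [|j]; rewrite /c ?subr0// gerBl powR_ge0.
have csum j : \sum_(i < j.+1) c i = d j.
  elim: j => [|j IH]; first by rewrite big_ord1 /c subr0.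
  by rewrite big_ord_recr/= IH /c addrC subrK.
(* The slopes [G x / x] are bounded; [x0] attains half of their supremum.  The
   levels stop at the first [J] below [G x0], where the slope is then within a
   factor 2 of all others. *)
have [x0 x00 Hx0] : exists2 x0, 0 < x0 & forall x : R, 0 < x -> G x / x <= 2 * (G x0 / x0).
  pose A := [set G x / x | x in [set x | 0 < x]].
  have AN : A (G N / N) by exists N.
  have Aub : has_ubound A by exists K => _ [x /= x0 <-]; rewrite ler_pdivrMr// GK.
  have s0 : 0 < sup A by apply: lt_le_trans (ub_le_sup Aub AN); rewrite divr_gt0.
  have : sup A / 2 < sup A by rewrite ltr_pdivrMr// ltr_pMr// ltr1n.
  move=> /(sup_gt (ex_intro A _ AN))[_ [x0 /= x00 <-] lt0].
  exists x0 => // x xp; rewrite -ler_pdivrMl//; apply: ltW.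
  apply: le_lt_trans lt0; rewrite mulrC ler_pM2r ?invr_gt0//.
  by apply: ub_le_sup => //; exists x.
have Gx00 : 0 < G x0.
  have := Hx0 N N0; move: (divr_gt0 GN0 N0) => /lt_le_trans /[apply].
  by rewrite pmulr_rgt0// pmulr_lgt0 ?invr_gt0.
have [J HJ] : exists J, e J < G x0.
  exists (Num.truncn (G N / G x0)).+1.
  rewrite /e ltr_pdivrMr ?exprn_gt0// mulrC -ltr_pdivrMr//.
  have /andP[_ /lt_le_trans] := truncn_itv (ltW (divr_gt0 GN0 Gx00)); apply.
  by rewrite -natrX ler_nat ltnW// ltn_expl.
have yJ : y J <= x0.
  rewrite leNgt; apply/negP => /ltW /(Gmono x00); rewrite Gy leNgt.
  by rewrite HJ.
have DJ x : 0 < x -> G x <= 2 * (D J * x).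
  move=> xp; rewrite mulrA -ler_pdivrMr//; apply: le_trans (Hx0 _ xp) _.
  by rewrite ler_pM2l// GleD.
exists J.+1, c, y; split => //.
- move=> x xp; have [xyJ|yJx] := ltP x (y J).
    exists x, (D J); split => //; rewrite ?xp ?lexx ?(ltW (D0 _)) ?DJ// => s sx.
    rewrite -/(d J) -csum; apply: ler_sum => i _.
    by rewrite (lt_le_trans (lt_trans sx xyJ)) ?mulr1// yle// -ltnS.
  have exJ : exists j, y j <= x by exists J.
  case: (ex_minnP exJ) => j yjx jmin.
  exists (y j), (D j); split; rewrite ?y0 ?yjx ?(ltW (D0 _)) ?Dz//.
    case: j jmin {yjx} => [_|j jmin].
      rewrite /e expr0 divr1; apply: le_trans (GleN _ xp) _.
      by rewrite ler_pMl// ler1n.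
    rewrite -eS -Gy; apply: Gmono => //; apply: ltW; rewrite ltNge; apply/negP.
    by move=> /jmin; rewrite ltnn.
  move=> s sy; rewrite -/(d j) -csum.
  have jJ : (j.+1 <= J.+1)%N by rewrite ltnS jmin.
  rewrite -(big_mkord xpredT c) -(big_mkord xpredT (fun i => c i * (s < y i)%R%:R)).
  rewrite [leRHS](big_cat_nat (n := j.+1))//= -[leLHS]addr0 lerD//; last first.
    by apply: sumr_ge0 => i _; rewrite mulr_ge0.
  rewrite !big_mkord; apply: ler_sum => i _.
  by rewrite (lt_le_trans sy) ?mulr1// yle// -ltnS.
- move=> x xp.
  have H1 : \sum_(i < J.+1) c i * (x < y i)%R%:R <= (G x / x) `^ th.
    elim: (J) => [|j IH].
      rewrite big_ord1; case: ltP => xy; last by rewrite mulr0 powR_ge0.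
      rewrite mulr1 /c subr0 ge0_ler_powR ?nnegrE ?(ltW th0) ?(ltW (D0 _))//.
        by rewrite divr_ge0 ?G0// ltW.
      by rewrite DleG// ltW.
    rewrite big_ord_recr/=; case: ltP => xy; last by rewrite mulr0 addr0.
    rewrite mulr1; apply: (@le_trans _ _ (d j.+1)).
      rewrite -csum [leRHS]big_ord_recr/= lerD2r; apply: ler_sum => i _.
      by rewrite ler_piMr//; case: ltP.
    rewrite ge0_ler_powR ?nnegrE ?(ltW th0) ?(ltW (D0 _))//.
      by rewrite divr_ge0 ?G0// ltW.
    by rewrite DleG// ltW.
  apply: (@le_trans _ _ (\sum_(i < J.+1) (c i * (x < y i)%R%:R * x `^ th +
     (if e i <= G x then e i `^ th else 0)))).
    apply: ler_sum => i _; case: (ltP x (y i)) => xy.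
      by rewrite mulr1 lerDl; case: ifP => // _; rewrite powR_ge0.
    rewrite mulr0 mul0r add0r -Gy Gmono//.
    apply: le_trans (ler_wpM2r (powR_ge0 _ _) (cd i)) _.
    by rewrite /d -powRM ?(ltW (y0 _)) ?(ltW (D0 _))// Dz Gy.
  rewrite big_split/= -mulr_suml -big_mkcond mulrDl mul1r lerD//.
    apply: le_trans (ler_wpM2r (powR_ge0 _ _) H1) _.
    by rewrite -powRM ?(ltW xp) ?divr_ge0 ?G0 ?(ltW xp)// divfK// gt_eqF.
  by apply: geometric_level_sum => //; exact: G0.
Qed.

End levels.
End real_inequalities.

(** * Functions on the half-line *)
Section halfline.
Context {R : realType}.
Local Notation mu := (@completed_lebesgue_measure R).
Local Notation line := (lebesgue_line R).
Local Notation D := (`]0%R, +oo[%classic : set line).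

Definition ipos (f : R -> \bar R) : \bar R := \int[mu]_(x in `]0%R, +oo[) f x.
Definition mpos (f : R -> \bar R) : Prop := measurable_fun D f.
Definition ge0pos (f : R -> \bar R) : Prop := forall x : R, (0 < x)%R -> 0 <= f x.

Lemma measurable_pos : measurable D.
Proof. exact: measurable_itv_line. Qed.

Lemma posP (x : R) : D x <-> (0 < x)%R.
Proof. by rewrite /= in_itv/= andbT. Qed.

Lemma ipos_ge0 f : ge0pos f -> 0 <= ipos f.
Proof. by move=> f0; apply: integral_ge0 => x /posP; exact: f0. Qed.

Lemma le_ipos f g : ge0pos f -> (forall x : R, (0 < x)%R -> f x <= g x) ->
  ipos f <= ipos g.
Proof.
move=> f0 fg; apply: ge0_le_lower_integral => // x /posP x0.
  by apply: le_trans (fg _ x0); exact: f0.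
by rewrite f0// fg.
Qed.

Lemma eq_ipos f g : (forall x : R, (0 < x)%R -> f x = g x) -> ipos f = ipos g.
Proof. by move=> fg; apply: eq_integral => x; rewrite inE => /posP/fg. Qed.

Lemma iposZl (C : R) f : (0 <= C)%R -> mpos f -> ge0pos f ->
  ipos (fun x => C%:E * f x) = C%:E * ipos f.
Proof.
move=> C0 mf f0.
have f0' (x : line) : D x -> 0 <= f x by move=> /posP/f0.
exact: (ge0_integralZl_EFin mu measurable_pos f0' mf C0).
Qed.

Lemma iposD f g : mpos f -> mpos g -> ge0pos f -> ge0pos g ->
  ipos (fun x => f x + g x) = ipos f + ipos g.
Proof.
move=> mf mg f0 g0.
have f0' (x : line) : D x -> 0 <= f x by move=> /posP/f0.
have g0' (x : line) : D x -> 0 <= g x by move=> /posP/g0.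
exact: (ge0_integralD mu measurable_pos f0' mf g0' mg).
Qed.

Lemma mposM f g : mpos f -> mpos g -> mpos (fun x => f x * g x).
Proof. exact: emeasurable_funM. Qed.

Lemma mposD f g : mpos f -> mpos g -> mpos (fun x => f x + g x).
Proof. exact: emeasurable_funD. Qed.

Lemma mpos_sum n (f : nat -> R -> \bar R) : (forall i, mpos (f i)) ->
  mpos (fun x => \sum_(i < n) f i x).
Proof.
move=> mf; elim: n => [|n IH].
  by under eq_fun do rewrite big_ord0; exact: measurable_cst.
under eq_fun do rewrite big_ord_recr/=.
exact: mposD.
Qed.

Lemma ipos_sum n (f : nat -> R -> \bar R) :
  (forall i, mpos (f i)) -> (forall i, ge0pos (f i)) ->
  ipos (fun x => \sum_(i < n) f i x) = \sum_(i < n) ipos (f i).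
Proof.
move=> mf f0; elim: n => [|n IH].
  by rewrite big_ord0 /ipos; apply: integral0_eq => x _; rewrite big_ord0.
rewrite big_ord_recr/= -IH -iposD//.
- by apply: eq_ipos => x _; rewrite big_ord_recr.
- exact: mpos_sum.
- by move=> x x0; apply: sume_ge0 => i _; exact: f0.
Qed.

Lemma mpos_cst (c : \bar R) : mpos (fun=> c).
Proof. exact: measurable_cst. Qed.

Lemma mpos_powR (r : R) (f : R -> R) : mpos (EFin \o f) ->
  mpos (fun x => (f x `^ r)%:E).
Proof.
move=> /measurable_EFinP mf; apply/measurable_EFinP.
exact: (measurableT_comp (measurable_powR r) mf).
Qed.

Lemma mpos_nonincreasing f :
  (forall x y : R, (0 < x)%R -> (x <= y)%R -> f y <= f x) -> mpos f.
Proof. exact: nonincreasing_measurable_line. Qed.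

Lemma mpos_weight (w : R -> R) : weight w -> mpos (fun x => (w x)%:E).
Proof. by case=> mw _ _; apply: measurableT_comp mw. Qed.

Definition below (t : R) (f : R -> \bar R) (x : R) := if (x < t)%R then f x else 0.

Lemma ipos_below t f : ipos (below t f) = \int[mu]_(x in `]0%R, t[) f x.
Proof.
rewrite /ipos integral_mkcond [RHS]integral_mkcond; congr integral.
apply/funext => x; rewrite !patchE /below.
have -> : (x \in `]0%R, t[%classic) = (x \in `]0%R, +oo[%classic) && (x < t)%R.
  apply/idP/andP; rewrite !inE/= !in_itv/= andbT; first by move/andP.
  by case=> -> ->.
by case: (x \in _) => //=; case: ifP.
Qed.

Lemma below_ge0 t f : ge0pos f -> ge0pos (below t f).
Proof. by move=> f0 x x0; rewrite /below; case: ifP => // _; exact: f0. Qed.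

Lemma belowM t f g x : below t (fun x => f x * g x) x = f x * below t g x.
Proof. by rewrite /below; case: ifP => // _; rewrite mule0. Qed.

Lemma mpos_below t f : mpos f -> mpos (below t f).
Proof.
move=> mf; rewrite (_ : below t f = fun x => f x * below t (cst 1) x).
  apply: mposM => //; apply: mpos_nonincreasing => x y x0 xy.
  rewrite /below; case: ifPn => [yt|_]; first by rewrite (le_lt_trans xy).
  by case: ifP.
by apply/funext => x; rewrite -belowM /below mule1.
Qed.

(** The constant [2^-1] in front of [u `^ s] allows this term to be absorbed
    into the left-hand side of an integrated inequality. *)
Lemma absorb_powR (s u h : R) : (1 <= s)%R -> (0 <= u)%R -> (0 <= h)%R ->
  (2 * (h * u `^ (s - 1)) <= 2^-1 * u `^ s + 2^-1 * 4 `^ s * h `^ s)%R.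
Proof.
move=> s1 u0 h0; have s0 : (0 < s)%R by exact: lt_le_trans s1.
(* Either [h] is small against [u], or [u] may be replaced by [4 * h]. *)
have [hu|uh] := leP (4 * h)%R u.
  apply: (@le_trans _ _ (2^-1 * u `^ s)%R); last first.
    by rewrite lerDl !mulr_ge0 ?powR_ge0.
  rewrite -(@mulr_powRB1 _ u s)// mulrA [leRHS]mulrA ler_wpM2r ?powR_ge0//.
  by lra.
rewrite -mulrA -powRM// -[X in (_ <= _ + X)%R]addr0 -(@mulr_powRB1 _ (4 * h) s)//; last exact: mulr_ge0.
have : (u `^ (s - 1) <= (4 * h) `^ (s - 1))%R.
  by rewrite ge0_ler_powR ?nnegrE ?subr_ge0 ?mulr_ge0// ltW.
have := powR_ge0 u s; move: (u `^ s)%R (u `^ (s - 1))%R ((4 * h) `^ (s - 1))%R => a b c a0 bc.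
nra.
Qed.

(** The Hardy-Littlewood-Polya principle for the convex function [t `^ s].
    Hardy's lemma with the non-increasing weight [u `^ (s - 1) * b] on
    [(0, tau)] bounds the integral of [u `^ s * b] by twice that of
    [h * u `^ (s - 1) * b], and [absorb_powR] applies.  Finiteness is what
    makes the absorption legitimate. *)
Lemma majorisation_powR (s tau : R) (u h b : R -> R) : (1 <= s)%R ->
  (forall x : R, (0 < x)%R -> (0 <= u x)%R) ->
  (forall x : R, (0 < x)%R -> (0 <= h x)%R) ->
  (forall x : R, (0 < x)%R -> (0 <= b x)%R) ->
  (forall x y : R, (0 < x)%R -> (x <= y)%R -> (u y <= u x)%R) ->
  (forall x y : R, (0 < x)%R -> (x <= y)%R -> (b y <= b x)%R) ->
  mpos (EFin \o h) ->
  (forall x : R, (0 < x)%R ->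
    \int[mu]_(t in `]0%R, x[) (u t)%:E <= 2%:E * \int[mu]_(t in `]0%R, x[) (h t)%:E) ->
  \int[mu]_(t in `]0%R, tau[) (u t `^ s * b t)%:E < +oo ->
  \int[mu]_(t in `]0%R, tau[) (u t `^ s * b t)%:E <=
  (4 `^ s)%:E * \int[mu]_(t in `]0%R, tau[) (h t `^ s * b t)%:E.
Proof.
move=> s1 u0 h0 b0 uni bni mh uh; rewrite -!ipos_below.
set I := ipos _; set J := ipos _ => Ioo.
have s0 : (0 < s)%R by exact: lt_le_trans s1.
have mu_ : mpos (EFin \o u).
  by apply: mpos_nonincreasing => x y x0 xy /=; rewrite lee_fin uni.
have mb : mpos (EFin \o b).
  by apply: mpos_nonincreasing => x y x0 xy /=; rewrite lee_fin bni.
pose k := below tau (fun x => (u x `^ (s - 1) * b x)%:E).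
have k0 : ge0pos k.
  by apply: below_ge0 => x x0; rewrite lee_fin mulr_ge0 ?powR_ge0// b0.
have kni (x y : R) : (0 < x)%R -> (x <= y)%R -> k y <= k x.
  move=> x0 xy; have y0 := lt_le_trans x0 xy.
  rewrite {1}/k /below; case: ifPn => yt; last exact: k0.
  rewrite /k /below (le_lt_trans xy)// lee_fin ler_pM ?powR_ge0 ?b0 ?bni//.
  by rewrite ge0_ler_powR ?nnegrE ?subr_ge0 ?u0 ?uni.
have hardy : ipos (fun x => (u x)%:E * k x) <= 2%:E * ipos (fun x => (h x)%:E * k x).
  by apply: hardy_lemma => // x x0; rewrite lee_fin ?u0 ?h0.
have mk : mpos k by exact: mpos_nonincreasing.
have hk0 : ge0pos (fun x => (h x)%:E * k x).
  by move=> x x0; rewrite mule_ge0 ?lee_fin ?h0 ?k0.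
have IE : I = ipos (fun x => (u x)%:E * k x).
  apply: eq_ipos => x x0; rewrite /k /below; case: ifP => _; last by rewrite mule0.
  by rewrite -EFinM mulrA mulr_powRB1 ?u0.
pose P (f : R -> R) := below tau (fun x => (f x `^ s * b x)%:E).
have P0 f : ge0pos (P f).
  by apply: below_ge0 => x x0; rewrite lee_fin mulr_ge0 ?powR_ge0 ?b0.
have mP f : mpos (EFin \o f) -> mpos (P f).
  move=> mf; apply: mpos_below; under eq_fun do rewrite EFinM.
  by apply: mposM => //; exact: mpos_powR.
have : I <= (2^-1)%:E * I + (2^-1 * 4 `^ s)%:E * J.
  rewrite {1}IE; apply: le_trans hardy _.
  rewrite -(iposZl _ (mposM mh mk) hk0)//.
  have c2 : (0 <= 2^-1 :> R)%R by rewrite invr_ge0.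
  have c4 : (0 <= 2^-1 * 4 `^ s :> R)%R by rewrite mulr_ge0 ?powR_ge0.
  rewrite -(iposZl c2 (mP _ mu_) (@P0 u)) -(iposZl c4 (mP _ mh) (@P0 h)).
  have mcP c f : mpos (EFin \o f) -> mpos (fun x => c%:E * P f x).
    by move=> mf; apply: mposM; [exact: mpos_cst|exact: mP].
  have cP0 c f : (0 <= c)%R -> ge0pos (fun x => c%:E * P f x).
    by move=> c0 x x0; rewrite mule_ge0 ?lee_fin// P0.
  rewrite -(iposD (mcP _ _ mu_) (mcP _ _ mh) (cP0 _ _ c2) (cP0 _ _ c4)).
  apply: le_ipos.
    by move=> x x0; rewrite mule_ge0 ?hk0.
  move=> x x0; rewrite /k /P /below; case: ifP => _; last by rewrite !mule0 adde0.
  rewrite -!EFinM -EFinD lee_fin.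
  have := ler_wpM2r (b0 _ x0) (absorb_powR s1 (u0 _ x0) (h0 _ x0)).
  by lra.
have Ifin : I \is a fin_num.
  rewrite ge0_fin_numE//; apply: ipos_ge0; apply: below_ge0 => x x0.
  by rewrite lee_fin mulr_ge0 ?powR_ge0 ?b0.
have J0 : 0 <= J.
  apply: ipos_ge0; apply: below_ge0 => x x0.
  by rewrite lee_fin mulr_ge0 ?powR_ge0 ?b0.
move: Ifin J0; case: I {IE Ioo} => // I _; case: J => [J|_ _|//]; last first.
  by rewrite mulry gtr0_sg ?powR_gt0// mul1e leey.
by rewrite -!EFinM -EFinD !lee_fin => J0; lra.
Qed.

End halfline.

(** * Reduction to indicators of initial intervals *)
Section decomposition.
Context {R : realType}.
Local Notation mu := (@completed_lebesgue_measure R).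

Lemma ipos_below1 (t : R) : (0 <= t)%R -> ipos (below t (cst 1)) = t%:E.
Proof.
move=> t0; rewrite ipos_below.
have := integral_cst mu (measurable_itv_line `]0%R, t[) 1.
by rewrite /= mul1e => ->; exact: mu_itv0.
Qed.

Lemma below_cst1 (t : R) (c : \bar R) x : below t (fun=> c) x = c * below t (cst 1) x.
Proof. by rewrite -belowM /below mule1. Qed.

Section average.
Variables (u : R -> R) (K : R).
Hypothesis u0 : forall x : R, (0 < x)%R -> (0 <= u x)%R.
Hypothesis uni : forall x y : R, (0 < x)%R -> (x <= y)%R -> (u y <= u x)%R.
Hypothesis uK : forall x : R, (0 < x)%R -> (u x <= K)%R.

Definition prim (x : R) : R := fine (\int[mu]_(s in `]0%R, x[) (u s)%:E).

Let mU : mpos (EFin \o u).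
Proof. by apply: mpos_nonincreasing => x y x0 xy /=; rewrite lee_fin uni. Qed.

Let U0 : ge0pos (EFin \o u).
Proof. by move=> x x0; rewrite lee_fin u0. Qed.

Let K0 : (0 <= K)%R.
Proof. by apply: le_trans (u0 ltr01) (uK ltr01). Qed.

Let bound (x : R) : (0 < x)%R -> ipos (below x (EFin \o u)) <= (K * x)%:E.
Proof.
move=> x0; rewrite EFinM -(ipos_below1 (ltW x0)) -iposZl//.
- apply: le_ipos; first exact: below_ge0.
  move=> y y0; rewrite -below_cst1 /below; case: ifP => // _.
  by rewrite lee_fin uK.
- by apply: mpos_below; exact: mpos_cst.
- exact: below_ge0.
Qed.

Lemma primE (x : R) : (0 < x)%R ->
  \int[mu]_(s in `]0%R, x[) (u s)%:E = (prim x)%:E.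
Proof.
move=> x0; rewrite fineK// -ipos_below ge0_fin_numE.
  exact: le_lt_trans (bound x0) (ltry _).
exact/ipos_ge0/below_ge0.
Qed.

Let primE' (x : R) : (0 < x)%R -> ipos (below x (EFin \o u)) = (prim x)%:E.
Proof. by move=> x0; rewrite -primE// ipos_below. Qed.

Lemma prim_ge0 (x : R) : (0 < x)%R -> (0 <= prim x)%R.
Proof. by move=> x0; rewrite -lee_fin -primE'//; exact/ipos_ge0/below_ge0. Qed.

Lemma prim_le (x : R) : (0 < x)%R -> (prim x <= K * x)%R.
Proof. by move=> x0; rewrite -lee_fin -primE'//; exact: bound. Qed.

Lemma le_prim (x y : R) : (0 < x)%R -> (x <= y)%R -> (prim x <= prim y)%R.
Proof.
move=> x0 xy; have y0 := lt_le_trans x0 xy.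
rewrite -lee_fin -!primE'//; apply: le_ipos; first exact: below_ge0.
move=> z z0; rewrite /below; case: ifPn => zx; first by rewrite (lt_le_trans zx).
by case: ifP => // _; exact: U0.
Qed.

Lemma prim_ge (x : R) : (0 < x)%R -> (u x * x <= prim x)%R.
Proof.
move=> x0; rewrite -lee_fin -primE'// EFinM -(ipos_below1 (ltW x0)) -iposZl//.
- apply: le_ipos.
    by move=> y y0; rewrite mule_ge0 ?lee_fin ?u0//; exact: below_ge0.
  move=> y y0; rewrite -below_cst1 /below; case: ifP => // yx.
  by rewrite lee_fin uni// ltW.
- exact: u0.
- by apply: mpos_below; exact: mpos_cst.
- exact: below_ge0.
Qed.

(** The average of a non-increasing function is non-increasing: replacing [u]
    by the constant [u x] on the interval from [x] to [y] overestimates it,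
    and [u x] is at most the average over [(0, x)]. *)
Lemma prim_quasi (x y : R) : (0 < x)%R -> (x <= y)%R ->
  (prim y * x <= prim x * y)%R.
Proof.
move=> x0 xy; have y0 := lt_le_trans x0 xy.
have m1 t : mpos (fun z => (u x)%:E * below t (cst 1) z).
  by apply: mposM; [exact: mpos_cst|apply: mpos_below; exact: mpos_cst].
have p1 t : ge0pos (fun z => (u x)%:E * below t (cst 1) z).
  by move=> z z0; rewrite mule_ge0 ?lee_fin ?u0//; exact: below_ge0.
have p2 t : ge0pos (below t (EFin \o u)) by exact: below_ge0.
have m2 t : mpos (below t (EFin \o u)) by exact: mpos_below.
have e1 t : (0 < t)%R -> ipos (fun z => (u x)%:E * below t (cst 1) z) = (u x * t)%:E.
  move=> t0; rewrite iposZl ?ipos_below1 ?(ltW t0) ?u0//.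
  - by apply: mpos_below; exact: mpos_cst.
  - exact: below_ge0.
have : (prim y + u x * x <= prim x + u x * y)%R.
  rewrite -lee_fin !EFinD -!primE'// -!e1//.
  rewrite -(iposD (m2 y) (m1 x) (p2 y) (p1 x)) -(iposD (m2 x) (m1 y) (p2 x) (p1 y)).
  apply: le_ipos; first by move=> z z0; rewrite adde_ge0 ?p1 ?p2.
  move=> z z0; rewrite /below /=; case: (ltP z x) => zx.
    by rewrite (lt_le_trans zx xy).
  by case: ifP => zy; rewrite !mule0 ?adde0// mule1 add0e lee_fin uni.
have := prim_ge x0; move: (prim x) (prim y) (u x) => a b c; nra.
Qed.

Lemma prim_const (N x : R) : (0 < N)%R ->
  (forall x, (N <= x)%R -> u x = 0%R) -> (N <= x)%R -> prim x = prim N.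
Proof.
move=> N0 uN Nx; have x0 := lt_le_trans N0 Nx.
apply: EFin_inj; rewrite -!primE'//; apply: eq_ipos => z z0.
rewrite /below; case: (ltP z N) => zN; first by rewrite (lt_le_trans zN).
by rewrite /= uN//; case: ifP.
Qed.

End average.

Variables (m p alpha : R).
Hypotheses (m0 : (0 < m)%R) (ma : (m <= alpha)%R) (p0 : (0 < p)%R) (pa : (p <= alpha)%R).
Variables (b B : R -> R).
Hypothesis b0 : forall x : R, (0 < x)%R -> (0 <= b x)%R.
Hypothesis bni : forall x y : R, (0 < x)%R -> (x <= y)%R -> (b y <= b x)%R.
Hypothesis BE : forall t : R, (0 < t)%R -> \int[mu]_(s in `]0%R, t[) (b s)%:E = (B t)%:E.
Hypothesis B0 : forall t : R, (0 < t)%R -> (0 < B t)%R.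

Let alpha0 : (0 < alpha)%R. Proof. exact: lt_le_trans ma. Qed.

(** The level decomposition of the primitive of [g `^ p] replaces [g `^ p] by a
    step function [h] with [h `^ (m / p) = \sum_i c i * 1_(0, y i)].
    Majorisation bounds the integral of [g `^ alpha * b] by that of
    [h `^ (alpha / p) * b], and Jensen's inequality with exponent [alpha / m]
    and weights proportional to [c i * B (min tau (y i)) `^ (m / alpha)]
    evaluates the latter. *)
Lemma atomic_majorant (g : R -> R) (k N : R) : (0 < N)%R ->
  (forall x : R, (0 < x)%R -> (0 <= g x)%R) ->
  (forall x y : R, (0 < x)%R -> (x <= y)%R -> (g y <= g x)%R) ->
  (forall x : R, (0 < x)%R -> (g x <= k)%R) ->
  (forall x : R, (N <= x)%R -> g x = 0%R) ->
  (exists2 x : R, (0 < x)%R & g x != 0%R) ->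
  exists (J : nat) (c y : nat -> R),
   [/\ forall i, (0 <= c i)%R, forall i, (0 < y i)%R,
     forall tau, (0 < tau)%R ->
       \int[mu]_(t in `]0%R, tau[) (g t `^ alpha * b t)%:E <=
       (4 `^ (alpha / p) *
         (\sum_(i < J) c i * B (Num.min tau (y i)) `^ (m / alpha)) `^ (alpha / m))%:E &
     forall x : R, (0 < x)%R -> (\sum_(i < J) c i * Num.min x (y i) `^ (m / p) <=
       (1 + (1 - 2 `^ (- (m / p)))^-1) * prim (fun t => g t `^ p) x `^ (m / p))%R].
Proof.
move=> N0 g0 gni gk gN [x1 x10 gx1].
pose u t := (g t `^ p)%R.
have u0 (x : R) : (0 < x)%R -> (0 <= u x)%R by rewrite powR_ge0.
have uni (x y : R) : (0 < x)%R -> (x <= y)%R -> (u y <= u x)%R.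
  move=> xp xy; rewrite /u ge0_ler_powR ?nnegrE ?(ltW p0) ?g0 ?gni//.
  exact: lt_le_trans xy.
have uK (x : R) : (0 < x)%R -> (u x <= k `^ p)%R.
  move=> xp; rewrite /u ge0_ler_powR ?nnegrE ?(ltW p0) ?g0 ?gk//.
  by rewrite (le_trans (g0 _ xp)) ?gk.
have uN (x : R) : (N <= x)%R -> u x = 0%R by move=> /gN; rewrite /u => ->; rewrite powR0// gt_eqF.
have th0 : (0 < m / p)%R by rewrite divr_gt0.
have thK : (m / p * (p / m) = 1)%R by field; rewrite !gt_eqF.
have GN0 : (0 < prim u N)%R.
  have x1N : (x1 < N)%R by rewrite ltNge; apply: contra gx1 => /gN ->.
  have h1 : (0 < u x1 * x1)%R.
    by rewrite mulr_gt0// powR_gt0// lt_neqAle eq_sym gx1 g0.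
  have h2 := prim_ge u0 uni uK x10; have h3 := le_prim u0 uK x10 (ltW x1N).
  exact: lt_le_trans h1 (le_trans h2 h3).
have [J [c [y [c0 y0 low up]]]] := level_decomposition (prim_ge0 u0 uK)
  (le_prim u0 uK) (prim_quasi u0 uni uK) th0 (prim_le u0 uK) N0 GN0
  (fun x => prim_const u0 uK N0 uN (x := x)).
exists J, c, y; split => // tau tau0; clear up.
pose hth (x : R) := (\sum_(i < J) c i * (x < y i)%R%:R)%R.
have hth0 x : (0 <= hth x)%R by apply: sumr_ge0 => i _; rewrite mulr_ge0.
have hthni (x z : R) : (x <= z)%R -> (hth z <= hth x)%R.
  move=> xz; apply: ler_sum => i _; apply: ler_wpM2l => //.
  by case: (ltP z (y i)) => // zy; rewrite (le_lt_trans xz).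
pose h x := (hth x `^ (p / m))%R.
have h0 x : (0 <= h x)%R by exact: powR_ge0.
have hni (x z : R) : (x <= z)%R -> (h z <= h x)%R.
  by move=> xz; rewrite /h ge0_ler_powR ?nnegrE ?hthni// ltW// divr_gt0.
have mh : mpos (EFin \o h).
  by apply: mpos_nonincreasing => x z _ xz; rewrite lee_fin hni.
have s1 : (1 <= alpha / p)%R by rewrite ler_pdivlMr// mul1r.
have a1 : (1 <= alpha / m)%R by rewrite ler_pdivlMr// mul1r.
have uh (x : R) : (0 < x)%R ->
    \int[mu]_(t in `]0%R, x[) (u t)%:E <= 2%:E * \int[mu]_(t in `]0%R, x[) (h t)%:E.
  move=> xp; rewrite (primE u0 uK xp).
  have [z [D [/andP[z0 zx] D0 GD Dh]]] := low x xp.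
  apply: (@le_trans _ _ (2%:E * (D * z)%:E)); first by rewrite -EFinM lee_fin.
  apply: lee_wpmul2l; first by rewrite lee_fin.
  rewrite -ipos_below EFinM -(ipos_below1 (ltW z0)) -iposZl//; last 2 first.
  - by apply: mpos_below; exact: mpos_cst.
  - exact: below_ge0.
  apply: le_ipos.
    by move=> t t0; rewrite mule_ge0 ?lee_fin//; exact: below_ge0.
  move=> t t0; rewrite -below_cst1 /below; case: ifP => tz; last first.
    by case: ifP; rewrite ?lee_fin.
  rewrite (lt_le_trans tz zx) lee_fin /h.
  rewrite (_ : D = (D `^ (m / p)) `^ (p / m))%R; last first.
    by rewrite -powRrM thK powRr1.
  by rewrite ge0_ler_powR ?nnegrE ?powR_ge0 ?Dh// ltW// divr_gt0.
clear low; have uE t : (0 < t)%R -> (u t `^ (alpha / p) = g t `^ alpha)%R.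
  by move=> t0; rewrite /u -powRrM mulrCA divff ?mulr1// gt_eqF.
have IE : \int[mu]_(t in `]0%R, tau[) (g t `^ alpha * b t)%:E =
    \int[mu]_(t in `]0%R, tau[) (u t `^ (alpha / p) * b t)%:E.
  apply: eq_integral => t; rewrite inE/= in_itv/= => /andP[t0 _].
  by rewrite uE.
have mb : mpos (EFin \o b).
  by apply: mpos_nonincreasing => x z x0 xz /=; rewrite lee_fin bni.
have ge0b : ge0pos (EFin \o b) by move=> x x0; rewrite lee_fin b0.
have Bbelow t : (0 < t)%R -> ipos (below t (EFin \o b)) = (B t)%:E.
  by move=> t0; rewrite ipos_below BE.
rewrite {}IE; apply: le_trans (majorisation_powR s1 u0 (fun x _ => h0 x) b0 uni bni mh uh _) _.
  rewrite -ipos_below; apply: (@le_lt_trans _ _ ((k `^ alpha)%:E * (B tau)%:E)); last first.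
    by rewrite -EFinM ltry.
  rewrite -Bbelow// -iposZl ?powR_ge0//; last 2 first.
  - exact: mpos_below mb.
  - exact: below_ge0.
  apply: le_ipos.
    by apply: below_ge0 => x x0; rewrite lee_fin mulr_ge0 ?powR_ge0 ?b0.
  move=> t t0; rewrite /below; case: ifP => _; last by rewrite mule0.
  rewrite -EFinM lee_fin ler_wpM2r ?b0// uE// ge0_ler_powR ?nnegrE ?g0 ?gk ?(ltW alpha0)//.
  by rewrite (le_trans (g0 _ t0)) ?gk.
rewrite EFinM lee_wpmul2l ?lee_fin ?powR_ge0//.
pose beta i := (B (Num.min tau (y i)) `^ (m / alpha))%R.
have min0 i : (0 < Num.min tau (y i))%R by rewrite lt_min tau0 y0.
have beta0 i : (0 < beta i)%R by rewrite powR_gt0 ?B0.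
have betaE i : (beta i `^ (alpha / m) = B (Num.min tau (y i)))%R.
  rewrite /beta -powRrM (_ : m / alpha * (alpha / m) = 1)%R ?powRr1 ?(ltW (B0 _))//.
  by field; rewrite !gt_eqF.
set M := (\sum_(i < J) _)%R.
have M0 : (0 <= M)%R by apply: sumr_ge0 => i _; rewrite mulr_ge0// powR_ge0.
have hE t : (h t `^ (alpha / p) = hth t `^ (alpha / m))%R.
  by rewrite /h -powRrM; congr (_ `^ _)%R; field; rewrite !gt_eqF.
pose a := (alpha / m)%R.
pose e i := (M `^ (a - 1) * (c i * beta i `^ (1 - a)))%R.
have e0 i : (0 <= e i)%R by rewrite !mulr_ge0 ?powR_ge0.
apply: (@le_trans _ _ (ipos (fun t => \sum_(i < J)
    (e i)%:E * below (Num.min tau (y i)) (EFin \o b) t))).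
  rewrite -ipos_below; apply: le_ipos.
    by apply: below_ge0 => x x0; rewrite lee_fin mulr_ge0 ?powR_ge0 ?b0.
  move=> t t0; rewrite {1}/below; case: ifP => ttau; last first.
    apply: sume_ge0 => i _; rewrite mule_ge0 ?lee_fin ?e0//.
    exact: below_ge0.
  have := @jensen_powR R a J (fun i => c i) (fun i => beta i)
    (fun i => (t < y i)%R%:R) a1 (fun i => c0 i) (fun i => beta0 i) (fun i => ler0n _ _).
  rewrite -/M -/(hth t) hE => jen.
  apply: (@le_trans _ _ ((M `^ (a - 1) * \sum_(i < J) c i *
    (beta i `^ (1 - a) * (t < y i)%R%:R `^ a)) * b t)%:E).
    by rewrite lee_fin ler_wpM2r ?b0.
  rewrite -mulrA mulr_suml mulr_sumr -sumEFin; apply: lee_sum => i _.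
  rewrite /below lt_min ttau/=; case: ifP => ty; last first.
    by rewrite powR0 ?mulr0 ?mul0r ?mulr0 ?mule0// gt_eqF// (lt_le_trans ltr01).
  by rewrite powR1 mulr1 -EFinM lee_fin /e !mulrA.
rewrite (ipos_sum J (f := fun i t =>
    (e i)%:E * below (Num.min tau (y i)) (EFin \o b) t)); last 2 first.
- by move=> i; apply: mposM; [exact: mpos_cst|exact: mpos_below].
- by move=> i x x0; rewrite mule_ge0 ?lee_fin ?e0//; exact: below_ge0.
rewrite (eq_bigr (fun i : 'I_J => (M `^ (a - 1) * (c i * beta i))%:E)); last first.
  move=> i _; rewrite iposZl//; last 2 first.
  - exact: mpos_below mb.
  - exact: below_ge0.
  rewrite Bbelow// -EFinM -betaE /e -!mulrA -powRD.
    by rewrite -/a subrK powRr1// ltW.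
  by rewrite (gt_eqF (beta0 i)) implybT.
rewrite sumEFin lee_fin -mulr_sumr -/M mulrC mulr_powRB1//.
exact: lt_le_trans a1.
Qed.

End decomposition.

(** * The weighted inequality on the half-line *)
Section weighted_inequality.
Context {R : realType}.
Local Notation mu := (@completed_lebesgue_measure R).

Lemma mpos_nondecreasing (f : R -> \bar R) :
  (forall x y : R, (0 < x)%R -> (x <= y)%R -> f x <= f y) -> mpos f.
Proof.
move=> fnd; have mNf : mpos (fun x => - f x).
  by apply: mpos_nonincreasing => x y x0 xy; rewrite leeN2 fnd.
have := measurableT_comp (@oppe_measurable R setT) mNf.
by rewrite (_ : _ \o _ = f)//; apply/funext => x /=; rewrite oppeK.
Qed.

Lemma sum_iposZ (J : nat) (c : nat -> R) (f : nat -> R -> \bar R) :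
  (forall i, (0 <= c i)%R) -> (forall i, mpos (f i)) -> (forall i, ge0pos (f i)) ->
  \sum_(i < J) (c i)%:E * ipos (f i) = ipos (fun x => \sum_(i < J) (c i)%:E * f i x).
Proof.
move=> c0 mf f0; rewrite (ipos_sum J (f := fun i x => (c i)%:E * f i x)).
- by apply: eq_bigr => i _; rewrite iposZl.
- by move=> i; apply: mposM; [exact: mpos_cst|exact: mf].
- by move=> i x x0; rewrite mule_ge0 ?lee_fin ?c0 ?f0.
Qed.

Definition tail_sup (phi : R -> R) (F : R -> \bar R) (x : R) : \bar R :=
  ereal_sup [set F tau * ((phi tau)^-1)%:E | tau in `[x, +oo[].

Lemma tail_sup_ge phi F (x tau : R) : (x <= tau)%R ->
  F tau * ((phi tau)^-1)%:E <= tail_sup phi F x.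
Proof.
by move=> xtau; apply: ereal_sup_ubound; exists tau => //=; rewrite in_itv/= andbT.
Qed.

Lemma tail_sup_le phi F (x : R) (c : \bar R) :
  (forall tau : R, (x <= tau)%R -> F tau * ((phi tau)^-1)%:E <= c) -> tail_sup phi F x <= c.
Proof.
by move=> H; apply: ge_ereal_sup => _ [tau /= + <-]; rewrite in_itv/= andbT => /H.
Qed.

Lemma tail_sup_nonincreasing phi F (x y : R) : (x <= y)%R ->
  tail_sup phi F y <= tail_sup phi F x.
Proof. by move=> xy; apply: tail_sup_le => tau ytau; apply: tail_sup_ge; exact: le_trans ytau. Qed.

Lemma tail_sup_ge0 phi F (x : R) : (forall tau : R, (0 < tau)%R -> 0 <= F tau) ->
  (forall tau : R, (0 < tau)%R -> (0 < phi tau)%R) -> (0 < x)%R -> 0 <= tail_sup phi F x.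
Proof.
move=> F0 phi0 x0; apply: le_trans (tail_sup_ge phi F (lexx x)).
by rewrite mule_ge0 ?F0// lee_fin invr_ge0 ltW// phi0.
Qed.

Variables (m p alpha q : R).
Hypotheses (m0 : (0 < m)%R) (ma : (m <= alpha)%R) (p0 : (0 < p)%R)
  (pa : (p <= alpha)%R) (aq : (alpha < q)%R).
Variables (b B phi v w V : R -> R) (K A : R).
Hypothesis b0 : forall x : R, (0 < x)%R -> (0 <= b x)%R.
Hypothesis bni : forall x y : R, (0 < x)%R -> (x <= y)%R -> (b y <= b x)%R.
Hypothesis BE : forall t : R, (0 < t)%R -> \int[mu]_(s in `]0%R, t[) (b s)%:E = (B t)%:E.
Hypothesis B0 : forall t : R, (0 < t)%R -> (0 < B t)%R.
Hypothesis phi0 : forall t : R, (0 < t)%R -> (0 < phi t)%R.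
Hypothesis phiK : quasi_increasing K phi.
Hypothesis mv : mpos (EFin \o v).
Hypothesis v0 : forall x : R, (0 < x)%R -> (0 <= v x)%R.
Hypothesis mw : mpos (EFin \o w).
Hypothesis w0 : forall x : R, (0 < x)%R -> (0 <= w x)%R.
Hypothesis VE : forall t : R, (0 < t)%R ->
  ipos (fun x => (Num.min x t `^ (m / p) * v x)%:E) = (V t)%:E.
Hypothesis V0 : forall t : R, (0 < t)%R -> (0 < V t)%R.

Let alpha0 : (0 < alpha)%R. Proof. exact: lt_le_trans ma. Qed.
Let q0 : (0 < q)%R. Proof. exact: lt_trans aq. Qed.
Let Q1 : (1 <= q / m)%R.
Proof. by rewrite ler_pdivlMr// mul1r (le_trans ma)// ltW. Qed.

(** The value of [head_norm] at the indicator function of [(0, t)]. *)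
Definition head_norm_ind (t tau : R) : \bar R := (B (Num.min tau t) `^ alpha^-1)%:E.

Definition head_normR (g : R -> R) (tau : R) : \bar R :=
  (\int[mu]_(s in `]0%R, tau[) (g s `^ alpha * b s)%:E) `^ alpha^-1.

Hypothesis HA : forall t : R, (0 < t)%R ->
  ipos (fun x => tail_sup phi (head_norm_ind t) x `^ q * (w x)%:E) <= (A `^ q * V t `^ (q / m))%:E.

(** The constant of [level_decomposition] for the exponent [m / p]. *)
Definition level_constant : R := (1 + (1 - 2 `^ (- (m / p)))^-1)%R.

Lemma level_constant_gt0 : (0 < level_constant)%R.
Proof.
have th0 : (0 < m / p)%R by rewrite divr_gt0.
have := @gt0_ltr_powR R _ th0 1%R 2%R; rewrite !nnegrE ler01 ler0n powR1 ltr1n.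
move=> /(_ isT isT isT) h; rewrite /level_constant addr_gt0// invr_gt0 subr_gt0 powRN.
by rewrite invf_lt1// powR_gt0.
Qed.

Lemma B_mono (s t : R) : (0 < s)%R -> (s <= t)%R -> (B s <= B t)%R.
Proof.
move=> s0 st; have t0 := lt_le_trans s0 st.
rewrite -lee_fin -!BE//; apply: ge0_le_lower_integral => [x /=|x /=|x /=].
- by rewrite in_itv/= => /andP[x0 _]; rewrite lee_fin b0.
- by rewrite !in_itv/= => /andP[-> xs]; exact: lt_le_trans xs st.
- by rewrite in_itv/= => /andP[x0 _]; rewrite lee_fin b0/=.
Qed.

Lemma tail_sup_head_ind_fin (t x : R) : (0 < t)%R -> (0 < x)%R ->
  tail_sup phi (head_norm_ind t) x \is a fin_num.
Proof.
move=> t0 x0; rewrite ge0_fin_numE; last first.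
  apply: tail_sup_ge0 => // tau tau0; rewrite lee_fin powR_ge0//.
apply: (@le_lt_trans _ _ (B t `^ alpha^-1 * (K / phi x))%:E); last by rewrite ltry.
apply: tail_sup_le => tau xtau; have tau0 := lt_le_trans x0 xtau.
rewrite -EFinM lee_fin ler_pM ?powR_ge0 ?invr_ge0 ?(ltW (phi0 _))//.
  have min0 : (0 < Num.min tau t)%R by rewrite lt_min tau0.
  rewrite ge0_ler_powR ?nnegrE ?invr_ge0 ?(ltW alpha0) ?(ltW (B0 _))//.
  by rewrite B_mono// ge_min lexx orbT.
by rewrite ler_pdivlMr ?phi0// mulrC ler_pdivrMr ?phi0// phiK.
Qed.

(** By [atomic_majorant] the [m]-th power of the operator at [g] is at most a
    combination, with coefficients [c i], of its [m]-th powers at the indicators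
    of [(0, y i)].  Jensen's inequality with exponent [q / m] and weights
    [c i * V (y i)] brings in the hypothesis on indicators and leaves the power
    [q / m] of [\sum_i c i * V (y i)], which is an integral against [v] of the
    sum that the decomposition bounds by the primitive of [g `^ p]. *)
Lemma weighted_inequality_bounded (g : R -> R) (k N : R) : (0 < N)%R ->
  (forall x : R, (0 < x)%R -> (0 <= g x)%R) ->
  (forall x y : R, (0 < x)%R -> (x <= y)%R -> (g y <= g x)%R) ->
  (forall x : R, (0 < x)%R -> (g x <= k)%R) ->
  (forall x : R, (N <= x)%R -> g x = 0%R) ->
  ipos (fun x => tail_sup phi (head_normR g) x `^ q * (w x)%:E) <=
  (4 `^ (q / p) * level_constant `^ (q / m) * A `^ q)%:E *
  (ipos (fun x => (prim (fun t => g t `^ p) x `^ (m / p) * v x)%:E)) `^ (q / m).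
Proof.
move=> N0 g0 gni gk gN.
have [[x1 x10 gx1]|gz] := pselect (exists2 x : R, (0 < x)%R & g x != 0%R); last first.
  have gz' x : (0 < x)%R -> g x = 0%R.
    by move=> x0; apply/eqP/negPn/negP => gx; apply: gz; exists x.
  rewrite (_ : ipos _ = 0) ?mule_ge0 ?poweR_ge0 ?lee_fin ?mulr_ge0 ?powR_ge0//.
  rewrite /ipos; apply: integral0_eq => x /posP x0.
  rewrite (_ : tail_sup _ _ _ = 0) ?poweR0r ?mul0e ?gt_eqF//.
  have F0 tau : head_normR g tau = 0.
    rewrite /head_normR integral0_eq ?poweR0r ?invr_eq0 ?gt_eqF// => s /=.
    by rewrite in_itv/= => /andP[s0 _]; rewrite gz'// powR0 ?mul0r ?gt_eqF.
  apply/eqP; rewrite eq_le tail_sup_ge0 ?andbT//; last by move=> tau _; rewrite F0.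
  by apply: tail_sup_le => tau _; rewrite F0 mul0e.
have [|J [c [y [c0 y0 Fle cle]]]] := atomic_majorant m0 ma p0 pa b0 bni BE B0 N0 g0 gni gk gN.
  by exists x1.
pose X i x := fine (tail_sup phi (head_norm_ind (y i)) x).
have XE i x : (0 < x)%R -> (X i x)%:E = tail_sup phi (head_norm_ind (y i)) x.
  by move=> x0; rewrite /X fineK// tail_sup_head_ind_fin.
have X0 i x : (0 < x)%R -> (0 <= X i x)%R.
  move=> x0; rewrite -lee_fin XE//; apply: tail_sup_ge0 => // tau tau0.
  by rewrite lee_fin powR_ge0.
pose S x := (\sum_(i < J) c i * X i x `^ m)%R.
have S0 x : (0 <= S x)%R by apply: sumr_ge0 => i _; rewrite mulr_ge0// powR_ge0.
have Tle x : (0 < x)%R -> tail_sup phi (head_normR g) x <= (4 `^ p^-1 * S x `^ m^-1)%:E.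
  move=> x0; apply: tail_sup_le => tau xtau; have tau0 := lt_le_trans x0 xtau.
  have ph0 := phi0 tau0.
  have min0 i : (0 < Num.min tau (y i))%R by rewrite lt_min tau0 y0.
  set I := (\sum_(i < J) c i * B (Num.min tau (y i)) `^ (m / alpha))%R in Fle *.
  have I0 : (0 <= I)%R by apply: sumr_ge0 => i _; rewrite mulr_ge0// powR_ge0.
  have FI : head_normR g tau <= (4 `^ p^-1 * I `^ m^-1)%:E.
    rewrite /head_normR; apply: (@le_trans _ _ ((4 `^ (alpha / p) * I `^ (alpha / m))%:E `^ alpha^-1)).
      apply: gt0_ler_poweR; rewrite ?invr_ge0 ?(ltW alpha0)// ?in_itv/= ?leey ?andbT//.
        apply: integral_ge0 => s /=; rewrite in_itv/= => /andP[s0 _].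
        by rewrite lee_fin mulr_ge0 ?powR_ge0 ?b0.
      by rewrite lee_fin mulr_ge0 ?powR_ge0.
      exact: Fle.
    rewrite poweR_EFin powRM ?powR_ge0// -!powRrM lee_fin.
    rewrite (_ : alpha / p / alpha = p^-1)%R; last by field; rewrite !gt_eqF.
    by rewrite (_ : alpha / m / alpha = m^-1)%R//; field; rewrite !gt_eqF.
  apply: le_trans (lee_wpmul2r _ FI) _; first by rewrite lee_fin invr_ge0 ltW.
  rewrite -EFinM lee_fin -mulrA ler_wpM2l ?powR_ge0//.
  rewrite (_ : (phi tau)^-1 = ((phi tau)^-1 `^ m) `^ m^-1)%R; last first.
    by rewrite -powRrM divff ?powRr1 ?invr_ge0 ?(ltW ph0) ?gt_eqF.
  rewrite -powRM ?powR_ge0// ge0_ler_powR ?nnegrE ?invr_ge0 ?(ltW m0) ?S0 ?mulr_ge0 ?powR_ge0//.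
  rewrite /I mulr_suml; apply: ler_sum => i _; rewrite -mulrA ler_wpM2l//.
  rewrite (_ : m / alpha = alpha^-1 * m)%R 1?mulrC// powRrM mulrC -powRM ?powR_ge0 ?invr_ge0 ?(ltW ph0)//.
  rewrite ge0_ler_powR ?nnegrE ?(ltW m0) ?mulr_ge0 ?powR_ge0 ?invr_ge0 ?(ltW ph0) ?X0//.
  by rewrite -lee_fin XE// EFinM; apply: (tail_sup_ge phi (head_norm_ind (y i)) xtau).
pose M := (\sum_(i < J) c i * V (y i))%R.
have M0 : (0 <= M)%R by apply: sumr_ge0 => i _; rewrite mulr_ge0// ltW// V0.
pose e i := (c i * V (y i) `^ (1 - q / m))%R.
have e0 i : (0 <= e i)%R by rewrite mulr_ge0 ?powR_ge0.
pose C4 := (4 `^ (q / p) * M `^ (q / m - 1))%R.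
have C40 : (0 <= C4)%R by rewrite mulr_ge0 ?powR_ge0.
have Tq x : (0 < x)%R -> tail_sup phi (head_normR g) x `^ q <=
    C4%:E * \sum_(i < J) (e i)%:E * tail_sup phi (head_norm_ind (y i)) x `^ q.
  move=> x0; apply: (@le_trans _ _ ((4 `^ p^-1 * S x `^ m^-1)%:E `^ q)).
    apply: gt0_ler_poweR; rewrite ?(ltW q0)// ?in_itv/= ?leey ?andbT ?Tle//.
      by apply: tail_sup_ge0 => // tau _; rewrite poweR_ge0.
    by rewrite lee_fin mulr_ge0 ?powR_ge0.
  rewrite poweR_EFin powRM ?powR_ge0// -!powRrM.
  rewrite (mulrC (p^-1)%R) (mulrC (m^-1)%R).
  have := @jensen_powR R (q / m) J (fun i => c i) (fun i => V (y i))
    (fun i => X i x `^ m)%R Q1 (fun i => c0 i) (fun i => V0 (y0 i)) (fun i => powR_ge0 _ _).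
  rewrite -/(S x) -/M => jen.
  apply: (@le_trans _ _ (C4 * \sum_(i < J) e i * X i x `^ q)%:E).
    rewrite lee_fin /C4 -[leRHS]mulrA ler_wpM2l ?powR_ge0//.
    apply: (le_trans jen); rewrite ler_wpM2l ?powR_ge0//.
    rewrite le_eqVlt; apply/orP; left; apply/eqP; apply: eq_bigr => i _.
    rewrite /e -powRrM mulrA; congr (_ * (_ `^ _))%R.
    by rewrite mulrC divfK ?gt_eqF.
  rewrite EFinM -sumEFin; apply: lee_wpmul2l; first by rewrite lee_fin.
  apply: lee_sum => i _; rewrite EFinM lee_wpmul2l ?lee_fin ?e0//.
  by rewrite -XE// poweR_EFin.
have mX i : mpos (fun x => tail_sup phi (head_norm_ind (y i)) x `^ q * (w x)%:E).
  apply: mposM => //; apply: mpos_nonincreasing => x z x0 xz.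
  have z0 := lt_le_trans x0 xz.
  apply: gt0_ler_poweR; rewrite ?(ltW q0)// ?in_itv/= ?leey ?andbT ?tail_sup_nonincreasing//.
    by apply: tail_sup_ge0 => // tau _; rewrite lee_fin powR_ge0.
  by apply: tail_sup_ge0 => // tau _; rewrite lee_fin powR_ge0.
have pX i : ge0pos (fun x => tail_sup phi (head_norm_ind (y i)) x `^ q * (w x)%:E).
  by move=> x x0; rewrite mule_ge0 ?poweR_ge0 ?lee_fin ?w0.
have step1 : ipos (fun x => tail_sup phi (head_normR g) x `^ q * (w x)%:E) <=
    (4 `^ (q / p) * A `^ q * M `^ (q / m))%:E.
  apply: (@le_trans _ _ (C4%:E * \sum_(i < J) (e i)%:E *
      ipos (fun x => tail_sup phi (head_norm_ind (y i)) x `^ q * (w x)%:E))).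
    rewrite (sum_iposZ J (f := fun i x => tail_sup phi (head_norm_ind (y i)) x `^ q * (w x)%:E))//.
    rewrite -iposZl//; last 2 first.
    - apply: (mpos_sum J (f := fun i x => (e i)%:E * (tail_sup phi (head_norm_ind (y i)) x `^ q * (w x)%:E))).
      by move=> i; apply: mposM; [exact: mpos_cst|exact: mX].
    - by move=> x x0; apply: sume_ge0 => i _; rewrite mule_ge0 ?lee_fin ?e0 ?pX.
    apply: le_ipos; first by move=> x x0; rewrite mule_ge0 ?poweR_ge0 ?lee_fin ?w0.
    move=> x x0; apply: le_trans (lee_wpmul2r _ (Tq _ x0)) _; first by rewrite lee_fin w0.
    rewrite -muleA lee_wpmul2l ?lee_fin// ge0_sume_distrl.
      by apply: lee_sum => i _; rewrite muleA.
    by move=> i _; rewrite mule_ge0 ?lee_fin ?e0 ?poweR_ge0.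
  apply: (@le_trans _ _ (C4%:E * \sum_(i < J) (c i * V (y i) * A `^ q)%:E)).
    rewrite lee_wpmul2l ?lee_fin//; apply: lee_sum => i _.
    apply: le_trans (lee_wpmul2l _ (HA (y0 i))) _; first by rewrite lee_fin.
    rewrite -EFinM lee_fin le_eqVlt; apply/orP; left; apply/eqP.
    have VV : (V (y i) `^ (1 - q / m) * V (y i) `^ (q / m) = V (y i))%R.
      by rewrite -powRD ?(gt_eqF (V0 (y0 i))) ?implybT// subrK powRr1// ltW// V0.
    transitivity (c i * (V (y i) `^ (1 - q / m) * V (y i) `^ (q / m)) * A `^ q)%R.
      by rewrite /e; ring.
    by rewrite VV.
  rewrite sumEFin -EFinM lee_fin -mulr_suml -/M /C4 le_eqVlt; apply/orP; left; apply/eqP.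
  transitivity (4 `^ (q / p) * (M * M `^ (q / m - 1)) * A `^ q)%R; first by ring.
  by rewrite mulr_powRB1 ?(lt_le_trans _ Q1)//; ring.
apply: (le_trans step1).
set GG := ipos (fun x => (_ * v x)%:E).
have GG0 : 0 <= GG by apply: ipos_ge0 => x x0; rewrite lee_fin mulr_ge0 ?powR_ge0 ?v0.
have MGG : M%:E <= level_constant%:E * GG.
  have mmin i : mpos (fun x => (Num.min x (y i) `^ (m / p) * v x)%:E).
    under eq_fun do rewrite EFinM; apply: mposM => //.
    apply: mpos_powR; apply: mpos_nondecreasing => x z x0 xz /=.
    by rewrite lee_fin le_min !ge_min xz lexx/= orbT.
  have pmin i : ge0pos (fun x => (Num.min x (y i) `^ (m / p) * v x)%:E).
    by move=> x x0; rewrite lee_fin mulr_ge0 ?powR_ge0 ?v0.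
  have -> : M%:E = ipos (fun x => \sum_(i < J) (c i)%:E * (Num.min x (y i) `^ (m / p) * v x)%:E).
    rewrite -(sum_iposZ J (f := fun i x => (Num.min x (y i) `^ (m / p) * v x)%:E))//.
    by rewrite /M -sumEFin; apply: eq_bigr => i _; rewrite VE// EFinM.
  have Cth0 := level_constant_gt0.
  have Ci0 : (0 <= level_constant^-1)%R by rewrite invr_ge0 ltW.
  set SS := ipos _; rewrite -[leLHS]mul1e -(@divff _ level_constant) ?gt_eqF// EFinM -muleA.
  rewrite lee_wpmul2l ?lee_fin ?(ltW Cth0)// /SS -iposZl//; last 2 first.
  - apply: (mpos_sum J (f := fun i x => (c i)%:E * (Num.min x (y i) `^ (m / p) * v x)%:E)).
    by move=> i; apply: mposM; [exact: mpos_cst|exact: mmin].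
  - by move=> x x0; apply: sume_ge0 => i _; rewrite mule_ge0 ?lee_fin ?c0 ?mulr_ge0 ?powR_ge0 ?v0.
  apply: le_ipos.
    move=> x x0; rewrite mule_ge0 ?lee_fin//; apply: sume_ge0 => i _.
    by rewrite mule_ge0 ?lee_fin ?c0 ?mulr_ge0 ?powR_ge0 ?v0.
  move=> x x0; under eq_bigr do rewrite -EFinM mulrA.
  rewrite sumEFin -mulr_suml -EFinM lee_fin mulrA ler_wpM2r ?v0//.
  by rewrite ler_pdivrMl//; exact: cle.
have MQ : (M `^ (q / m))%:E <= (level_constant `^ (q / m))%:E * GG `^ (q / m).
  have Cth0 := level_constant_gt0; have Q0 := lt_le_trans ltr01 Q1.
  rewrite -!poweR_EFin -poweRM ?lee_fin ?(ltW Cth0)//.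
  apply: gt0_ler_poweR; rewrite ?(ltW Q0)// ?in_itv/= ?leey ?andbT ?lee_fin//.
  by rewrite mule_ge0 ?lee_fin ?(ltW Cth0).
rewrite EFinM (_ : (_ * _ * A `^ q) = 4 `^ (q / p) * A `^ q * level_constant `^ (q / m))%R; last by ring.
by rewrite [X in _ <= X * _]EFinM -muleA lee_wpmul2l// lee_fin mulr_ge0 ?powR_ge0.
Qed.
End weighted_inequality.

(** * Removing the boundedness of the function *)
Section monotone_limit.
Context {R : realType}.
Local Notation mu := (@completed_lebesgue_measure R).

Lemma le_poweR (r : R) (x y : \bar R) : (0 <= r)%R -> 0 <= x -> x <= y ->
  x `^ r <= y `^ r.
Proof.
move=> r0 x0 xy; apply: gt0_ler_poweR; rewrite ?in_itv/= ?leey ?andbT//.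
exact: le_trans xy.
Qed.

Lemma poweRK (r : R) (x : \bar R) : r != 0%R -> 0 <= x -> (x `^ r) `^ r^-1 = x.
Proof. by move=> r0 x0; rewrite -poweRrM divff// poweRe1. Qed.

Lemma poweRVK (r : R) (x : \bar R) : r != 0%R -> 0 <= x -> (x `^ r^-1) `^ r = x.
Proof. by move=> r0 x0; rewrite -poweRrM mulVf// poweRe1. Qed.

(** Monotone convergence, for a function only known to lie below the limit. *)
Lemma ipos_le_of_sup (f : nat -> R -> \bar R) (g : R -> \bar R) (c : \bar R) :
  (forall k, mpos (f k)) -> (forall k, ge0pos (f k)) ->
  (forall k (x : R), (0 < x)%R -> f k x <= f k.+1 x) ->
  ge0pos g ->
  (forall x : R, (0 < x)%R -> g x <= ereal_sup (range (f ^~ x))) ->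
  (forall k, ipos (f k) <= c) -> ipos g <= c.
Proof.
move=> mf f0 fnd g0 gsup fc.
have ndf (x : R) : (0 < x)%R -> nondecreasing_seq (f ^~ x).
  by move=> x0; apply/nondecreasing_seqP => k; exact: fnd.
apply: (@le_trans _ _ (ipos (fun x => limn (f ^~ x)))).
  apply: le_ipos => // x x0; apply: le_trans (gsup _ x0) _.
  by rewrite (cvg_lim _ (ereal_nondecreasing_cvgn (ndf _ x0))).
have f0' k (x : R) : `]0%R, +oo[%classic x -> 0 <= f k x by move=> /posP/f0.
have nd' (x : R) : `]0%R, +oo[%classic x -> nondecreasing_seq (f ^~ x).
  by move=> /posP/ndf.
have := cvg_monotone_convergence (mu := mu) (@measurable_pos R) mf f0' nd'.
by move/cvge_to_le; apply; apply: nearW => k; exact: fc.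
Qed.

End monotone_limit.

Section weighted_inequality_general.
Context {R : realType}.
Local Notation mu := (@completed_lebesgue_measure R).
Variables (m p alpha q : R).
Hypotheses (m0 : (0 < m)%R) (ma : (m <= alpha)%R) (p0 : (0 < p)%R)
  (pa : (p <= alpha)%R) (aq : (alpha < q)%R).
Variables (b B phi v w V : R -> R) (K A : R).
Hypothesis b0 : forall x : R, (0 < x)%R -> (0 <= b x)%R.
Hypothesis bni : forall x y : R, (0 < x)%R -> (x <= y)%R -> (b y <= b x)%R.
Hypothesis BE : forall t : R, (0 < t)%R -> \int[mu]_(s in `]0%R, t[) (b s)%:E = (B t)%:E.
Hypothesis B0 : forall t : R, (0 < t)%R -> (0 < B t)%R.
Hypothesis phi0 : forall t : R, (0 < t)%R -> (0 < phi t)%R.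
Hypothesis phiK : quasi_increasing K phi.
Hypothesis mv : mpos (EFin \o v).
Hypothesis v0 : forall x : R, (0 < x)%R -> (0 <= v x)%R.
Hypothesis mw : mpos (EFin \o w).
Hypothesis w0 : forall x : R, (0 < x)%R -> (0 <= w x)%R.
Hypothesis VE : forall t : R, (0 < t)%R ->
  ipos (fun x => (Num.min x t `^ (m / p) * v x)%:E) = (V t)%:E.
Hypothesis V0 : forall t : R, (0 < t)%R -> (0 < V t)%R.

Let alpha0 : (0 < alpha)%R. Proof. exact: lt_le_trans ma. Qed.
Let q0 : (0 < q)%R. Proof. exact: lt_trans aq. Qed.

Variable g : R -> \bar R.
Hypothesis g0 : ge0pos g.
Hypothesis gni : forall x y : R, (0 < x)%R -> (x <= y)%R -> g y <= g x.

(** Cut in height and in support at once, so that the primitive of a power of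
    the truncation is at most linear and eventually constant. *)
Definition truncate (k : nat) (x : R) : R :=
  if (x < k.+1%:R)%R then fine (mine (g x) k.+1%:R%:E) else 0%R.

Lemma truncateE k x : (0 < x)%R -> (x < k.+1%:R)%R -> (truncate k x)%:E = mine (g x) k.+1%:R%:E.
Proof.
move=> x0 xk; rewrite /truncate xk fineK// ge0_fin_numE.
  by rewrite gt_min ltry orbT.
by rewrite le_min g0//= lee_fin.
Qed.

Lemma truncate_ge0 k x : (0 < x)%R -> (0 <= truncate k x)%R.
Proof.
move=> x0; case: (ltP x k.+1%:R) => xk; last by rewrite /truncate ltNge xk.
by rewrite -lee_fin truncateE// le_min g0//= lee_fin.
Qed.

Lemma truncate_nonincreasing k x y : (0 < x)%R -> (x <= y)%R -> (truncate k y <= truncate k x)%R.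
Proof.
move=> x0 xy; case: (ltP y k.+1%:R) => yk.
  rewrite -lee_fin !truncateE ?(lt_le_trans x0 xy) ?(le_lt_trans xy)//.
  by rewrite le_min !ge_min gni//= lexx orbT.
by rewrite {1}/truncate ltNge yk/= truncate_ge0.
Qed.

Lemma truncate_le_bound k x : (0 < x)%R -> (truncate k x <= k.+1%:R)%R.
Proof.
move=> x0; case: (ltP x k.+1%:R) => xk; last by rewrite /truncate ltNge xk/= ler0n.
by rewrite -lee_fin truncateE// ge_min lexx orbT.
Qed.

Lemma truncate_eq0 k x : (k.+1%:R <= x)%R -> truncate k x = 0%R.
Proof. by rewrite /truncate ltNge => ->. Qed.

Lemma truncate_le k x : (0 < x)%R -> (truncate k x)%:E <= g x.
Proof.
move=> x0; case: (ltP x k.+1%:R) => xk; last by rewrite truncate_eq0// g0.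
by rewrite truncateE// ge_min lexx.
Qed.

Lemma truncate_leS k x : (0 < x)%R -> (truncate k x <= truncate k.+1 x)%R.
Proof.
move=> x0; case: (ltP x k.+1%:R) => xk; last by rewrite truncate_eq0// truncate_ge0.
have kS : (k.+1%:R <= k.+2%:R :> R)%R by rewrite ler_nat.
rewrite -lee_fin !truncateE ?(lt_le_trans xk)//.
by rewrite le_min !ge_min lexx/= lee_fin kS orbT.
Qed.

Lemma truncate_integrand_leS k x : (0 < x)%R ->
  (truncate k x `^ alpha * b x)%:E <= (truncate k.+1 x `^ alpha * b x)%:E.
Proof.
move=> x0; have := truncate_leS k x0; have := truncate_ge0 k x0.
move: (truncate k x) (truncate k.+1 x) => s t s0 st.
by rewrite lee_fin ler_wpM2r ?b0// ge0_ler_powR ?nnegrE ?(le_trans s0 st)// ltW.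
Qed.

Definition head_norm (tau : R) : \bar R :=
  (\int[mu]_(s in `]0%R, tau[) (g s `^ alpha * (b s)%:E)) `^ alpha^-1.

Local Notation Fk k := (head_normR alpha b (truncate k)).

Let mb : mpos (EFin \o b).
Proof. by apply: mpos_nonincreasing => x y x0 xy /=; rewrite lee_fin bni. Qed.

Lemma mpos_truncate k : mpos (fun x => (truncate k x `^ alpha * b x)%:E).
Proof.
under eq_fun do rewrite EFinM; apply: mposM mb; apply: mpos_powR.
by apply: mpos_nonincreasing => x y x0 xy; rewrite lee_fin truncate_nonincreasing.
Qed.

Lemma ge0pos_truncate k : ge0pos (fun x => (truncate k x `^ alpha * b x)%:E).
Proof. by move=> x x0; rewrite lee_fin mulr_ge0 ?powR_ge0 ?b0. Qed.

Lemma le_sup_truncate x : (0 < x)%R ->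
  g x `^ alpha * (b x)%:E <= ereal_sup (range (fun k => (truncate k x `^ alpha * b x)%:E)).
Proof.
move=> x0; have := g0 x0; case E : (g x) => [r| |//]; last first.
  move=> _; rewrite poweRyr ?gt_eqF//.
  have [bx0|bx0] := eqVneq (b x) 0%R.
    rewrite bx0 mule0; apply: ereal_sup_ubound; exists 0%N => //.
    by rewrite mulr0.
  have bx : (0 < b x)%R by rewrite lt_neqAle eq_sym bx0 b0.
  rewrite gt0_mulye ?lte_fin//.
  have -> // : ereal_sup (range (fun k => (truncate k x `^ alpha * b x)%:E)) = +oo.
  apply/eqyP => M M0.
  (* the height above which the truncation raises the integrand beyond [M] *)
  pose z := ((M / b x) `^ alpha^-1)%R.
  have z0 : (0 <= z)%R by exact: powR_ge0.
  pose k := Num.truncn (x + z).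
  have /andP[_ kxz] := truncn_itv (addr_ge0 (ltW x0) z0).
  have xk : (x < k.+1%:R)%R by apply: le_lt_trans kxz; rewrite lerDl.
  apply: le_ereal_sup_tmp; exists (truncate k x `^ alpha * b x)%:E; first by exists k.
  have -> : truncate k x = k.+1%:R.
    by apply: EFin_inj; rewrite truncateE// E min_r ?leey.
  rewrite lee_fin -ler_pdivrMr//.
  have -> : (M / b x = z `^ alpha)%R.
    by rewrite /z -powRrM mulVf ?powRr1 ?gt_eqF// divr_ge0// ltW.
  rewrite ge0_ler_powR ?nnegrE ?(ltW alpha0) ?ler0n//.
  by rewrite ltW// (le_lt_trans _ kxz)// lerDr ltW.
rewrite lee_fin => r0.
pose k := Num.truncn (x + r).
have /andP[_ kxz] := truncn_itv (addr_ge0 (ltW x0) r0).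
have xk : (x < k.+1%:R)%R by apply: le_lt_trans kxz; rewrite lerDl.
have rk : (r < k.+1%:R)%R by apply: le_lt_trans kxz; rewrite lerDr ltW.
apply: ereal_sup_ubound; exists k => //; rewrite poweR_EFin -EFinM.
do 3 f_equal; apply: EFin_inj; rewrite truncateE// E.
by rewrite min_l// lee_fin ltW.
Qed.

Let Fk_ge0 k tau : 0 <= Fk k tau. Proof. exact: poweR_ge0. Qed.

Lemma tail_sup_le_sup_truncate x : (0 < x)%R ->
  tail_sup phi head_norm x <= ereal_sup (range (fun k => tail_sup phi (Fk k) x)).
Proof.
move=> x0; set S := ereal_sup _.
have S0 : 0 <= S.
  apply: le_trans (ereal_sup_ubound (ex_intro2 _ _ 0%N I erefl)).
  by apply: tail_sup_ge0 => // tau _.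
apply: tail_sup_le => tau xtau; have tau0 := lt_le_trans x0 xtau.
have ph0 := phi0 tau0.
have SP0 : 0 <= S * (phi tau)%:E by rewrite mule_ge0// lee_fin ltW.
suff H : head_norm tau <= S * (phi tau)%:E.
  apply: le_trans (lee_wpmul2r _ H) _; first by rewrite lee_fin invr_ge0 ltW.
  by rewrite -muleA -EFinM divff ?gt_eqF// mule1.
rewrite -(poweRK (lt0r_neq0 alpha0) SP0); apply: le_poweR.
- by rewrite invr_ge0 ltW.
- apply: integral_ge0 => s /=; rewrite in_itv/= => /andP[s0 _].
  by rewrite mule_ge0 ?poweR_ge0 ?lee_fin ?b0.
rewrite -ipos_below.
apply: (ipos_le_of_sup (f := fun k => below tau (fun s => (truncate k s `^ alpha * b s)%:E))).
- by move=> k; exact: mpos_below (mpos_truncate k).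
- by move=> k; exact: below_ge0 (ge0pos_truncate k).
- move=> k y y0; rewrite /below; case: (y < tau)%R; last exact: lexx.
  exact: truncate_integrand_leS.
- by apply: below_ge0 => y y0; rewrite mule_ge0 ?poweR_ge0 ?lee_fin ?b0.
- move=> y y0; rewrite /below; case: ifP => _; first exact: le_sup_truncate.
  by apply: ereal_sup_ubound; exists 0%N.
- move=> k; rewrite ipos_below.
  have I0 : 0 <= \int[mu]_(s in `]0%R, tau[) (truncate k s `^ alpha * b s)%:E.
    apply: integral_ge0 => s /=; rewrite in_itv/= => /andP[s0 _].
    by rewrite lee_fin mulr_ge0 ?powR_ge0 ?b0.
  rewrite -(poweRVK (lt0r_neq0 alpha0) I0); apply: le_poweR.
  + exact: ltW.
  + exact: poweR_ge0.
  have : Fk k tau * ((phi tau)^-1)%:E <= S.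
    apply: le_trans (tail_sup_ge phi (Fk k) xtau) _.
    by apply: ereal_sup_ubound; exists k.
  have ph0' : 0 <= (phi tau)%:E by rewrite lee_fin ltW.
  move=> /(lee_wpmul2r ph0'); apply: le_trans.
  by rewrite -muleA -EFinM mulVf ?gt_eqF// mule1.
Qed.

Hypothesis HA : forall t : R, (0 < t)%R ->
  ipos (fun x => tail_sup phi (head_norm_ind alpha B t) x `^ q * (w x)%:E) <= (A `^ q * V t `^ (q / m))%:E.

(** Both the integrals of powers and the suprema commute with the increasing
    limit of the truncations. *)
Lemma weighted_inequality_general :
  ipos (fun x => tail_sup phi head_norm x `^ q * (w x)%:E) <=
  (4 `^ (q / p) * level_constant m p `^ (q / m) * A `^ q)%:E *
  (ipos (fun x => (\int[mu]_(s in `]0%R, x[) (g s `^ p)) `^ (m / p) * (v x)%:E)) `^ (q / m).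
Proof.
have T0 k x : (0 < x)%R -> 0 <= tail_sup phi (Fk k) x.
  by move=> x0; apply: tail_sup_ge0 => // tau _.
apply: (ipos_le_of_sup (f := fun k x => tail_sup phi (Fk k) x `^ q * (w x)%:E)).
- move=> k; apply: mposM => //; apply: mpos_nonincreasing => x y x0 xy.
  apply: le_poweR; [exact: ltW|exact: T0 (lt_le_trans x0 xy)|].
  exact: tail_sup_nonincreasing.
- by move=> k x x0; rewrite mule_ge0 ?poweR_ge0 ?lee_fin ?w0.
- move=> k x x0; apply: lee_wpmul2r; first by rewrite lee_fin w0.
  apply: le_poweR; [exact: ltW|exact: T0|].
  apply: tail_sup_le => tau xtau; have tau0 := lt_le_trans x0 xtau.
  apply: le_trans (tail_sup_ge phi (Fk k.+1) xtau); apply: lee_wpmul2r.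
    by rewrite lee_fin invr_ge0 ltW// phi0.
  apply: le_poweR; first by rewrite invr_ge0 ltW.
    apply: integral_ge0 => s /=; rewrite in_itv/= => /andP[s0 _].
    by rewrite lee_fin mulr_ge0 ?powR_ge0 ?b0.
  apply: ge0_le_lower_integral => [s /=|//|s /=]; rewrite in_itv/= => /andP[s0 _].
    by rewrite lee_fin mulr_ge0 ?powR_ge0 ?b0.
  apply/andP; split; first by rewrite lee_fin mulr_ge0 ?powR_ge0 ?b0.
  exact: truncate_integrand_leS.
- by move=> x x0; rewrite mule_ge0 ?poweR_ge0 ?lee_fin ?w0.
- move=> x x0; set Z := ereal_sup _.
  have [wx0|wx0] := eqVneq (w x) 0%R.
    rewrite wx0 mule0; apply: le_trans (ereal_sup_ubound (ex_intro2 _ _ 0%N I erefl)).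
    by rewrite wx0 mule0.
  have wx : (0 < w x)%R by rewrite lt_neqAle eq_sym wx0 w0.
  have Z0 : 0 <= Z.
    apply: le_trans (ereal_sup_ubound (ex_intro2 _ _ 0%N I erefl)).
    by rewrite mule_ge0 ?poweR_ge0 ?lee_fin ?w0.
  pose z := Z * ((w x)^-1)%:E.
  have z0 : 0 <= z by rewrite mule_ge0// lee_fin invr_ge0 ltW.
  have -> : Z = z * (w x)%:E by rewrite /z -muleA -EFinM mulVf// mule1.
  apply: lee_wpmul2r; first by rewrite lee_fin w0.
  rewrite -(poweRVK (lt0r_neq0 q0) z0); apply: le_poweR; first exact: ltW.
    by apply: tail_sup_ge0 => // tau _; exact: poweR_ge0.
  apply: le_trans (tail_sup_le_sup_truncate x0) _; apply: ge_ereal_sup => _ [k _ <-].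
  rewrite -(poweRK (lt0r_neq0 q0) (T0 k x x0)); apply: le_poweR.
  + by rewrite invr_ge0 ltW.
  + exact: poweR_ge0.
  have wi : 0 <= ((w x)^-1)%:E by rewrite lee_fin invr_ge0 ltW.
  rewrite -[leLHS]mule1 -(divff (wx0)) EFinM muleA; apply: lee_wpmul2r => //.
  by apply: ereal_sup_ubound; exists k.
- move=> k; have k0 : (0 < k.+1%:R :> R)%R by rewrite ltr0n.
  apply: le_trans (weighted_inequality_bounded m0 ma p0 pa aq b0 bni BE B0 phi0 phiK
    mv v0 mw w0 VE V0 HA k0 (@truncate_ge0 k) (@truncate_nonincreasing k) (@truncate_le_bound k) (@truncate_eq0 k)) _.
  apply: lee_wpmul2l; first by rewrite lee_fin !mulr_ge0 ?powR_ge0.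
  apply: le_poweR; first by rewrite ltW// divr_gt0.
    by apply: ipos_ge0 => x x0; rewrite lee_fin mulr_ge0 ?powR_ge0 ?v0.
  apply: le_ipos => x x0; first by rewrite lee_fin mulr_ge0 ?powR_ge0 ?v0.
  rewrite EFinM; apply: lee_wpmul2r; first by rewrite lee_fin v0.
  rewrite -poweR_EFin; apply: le_poweR; first by rewrite ltW// divr_gt0.
    rewrite lee_fin fine_ge0//; apply: integral_ge0 => s _.
    by rewrite lee_fin powR_ge0.
  rewrite -(primE (u := fun t => (truncate k t `^ p)%R) (K := (k.+1%:R `^ p)%R))//.
  + apply: ge0_le_lower_integral => // s /=; rewrite in_itv/= => /andP[s0 _].
      exact: poweR_ge0.
    rewrite lee_fin powR_ge0/= -poweR_EFin; apply: le_poweR; first exact: ltW.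
      by rewrite lee_fin truncate_ge0.
    exact: truncate_le.
  + by move=> y y0; exact: powR_ge0.
  + by move=> y y0; rewrite ge0_ler_powR ?nnegrE ?truncate_ge0 ?truncate_le_bound ?ler0n// ltW.
Qed.

End weighted_inequality_general.

(** * Cubes and Vitali's covering lemma *)
Section cubes.
Context {R : realType} (n : nat).
Local Notation tup := (n.-tuple (measurableTypeR R)).
Local Notation Rn := (lebesgue_space R n).
Local Notation leb := (@lebesgue_n R n).

Lemma measurable_cube_borel (c : n.-tuple R) (l : R) :
  measurable (cube c l : set tup).
Proof.
rewrite (_ : cube c l = \bigcap_(i in [set: 'I_n])
    ((fun x : tup => tnth x i) @^-1` `](tnth c i), (tnth c i + l)%R[)).
  apply: fin_bigcap_measurable => // i _.
  by rewrite -[X in measurable X]setTI; apply: measurable_tnth.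
apply/seteqP; split => x /=.
  by move=> h i _; rewrite /= in_itv/=.
by move=> h i; have := h i Logic.I; rewrite /= in_itv.
Qed.

Lemma measurable_borel_Rn (A : set tup) : measurable A -> measurable (A : set Rn).
Proof. by move=> mA; apply: sub_caratheodory; exact: sub_sigma_algebra. Qed.

Lemma measurable_cube (c : n.-tuple R) (l : R) : measurable (cube c l : set Rn).
Proof. by apply: measurable_borel_Rn; exact: measurable_cube_borel. Qed.

Lemma lebesgue_n_borelE (A : set tup) : measurable A ->
  leb A = tuple_measure (@lebesgue_measure R) n A.
Proof. by move=> mA; rewrite /lebesgue_n /completed_measure_extension measurable_mu_extE. Qed.

End cubes.

Lemma tuple_measure_cube (R : realType) n (c : n.-tuple R) (l : R) : (0 < l)%R ->
  tuple_measure (@lebesgue_measure R) n (cube c l) = (l ^+ n)%:E.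
Proof.
move=> l0; elim: n c => [|n IH] c.
  by rewrite /= diracE mem_set ?expr0// => -[].
case/tupleP: c => x0 c; rewrite /= /tuple_step /pushforward.
have -> : (@cons_pair _ (measurableTypeR R) n @^-1` cube [tuple of x0 :: c] l) =
    `]x0, (x0 + l)%R[%classic `*` cube c l.
  apply/seteqP; split => -[x t] /=.
    move=> h; split; first by have := h ord0; rewrite in_itv/= !tnth0.
    by move=> i; have := h (lift ord0 i); rewrite !tnthS.
  move=> [hx ht] i; case: (unliftP ord0 i) => [j ->|->].
    by rewrite !tnthS; exact: ht.
  by move: hx; rewrite in_itv/= !tnth0.
rewrite product_measure1E; [|exact: measurable_itv|exact: measurable_cube_borel].
rewrite IH exprS EFinM; congr (_ * _).
have /= := @lebesgue_measure_itv R `]x0, (x0 + l)%R[.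
by rewrite lte_fin ltrDl l0 -EFinB addrAC subrr add0r.
Qed.

Section cubes2.
Context {R : realType} (n : nat).
Local Notation Rn := (lebesgue_space R n).
Local Notation leb := (@lebesgue_n R n).

Lemma lebesgue_n_cube (c : n.-tuple R) (l : R) : (0 < l)%R ->
  leb (cube c l) = (l ^+ n)%:E.
Proof.
by move=> l0; rewrite lebesgue_n_borelE ?tuple_measure_cube//; exact: measurable_cube_borel.
Qed.

Lemma le_cube (c d : n.-tuple R) (l k : R) :
  (forall i, (tnth d i <= tnth c i)%R) ->
  (forall i, (tnth c i + l <= tnth d i + k)%R) -> cube c l `<=` cube d k.
Proof.
move=> dc cd x cx i; have /andP[h1 h2] := cx i.
by rewrite (le_lt_trans (dc i) h1) (lt_le_trans h2 (cd i)).
Qed.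

(** Place the corner [d] so that [x] has the same relative position in both
    cubes. *)
Lemma subcube (c x : n.-tuple R) (l k : R) : (0 < k)%R -> (k <= l)%R ->
  cube c l x -> exists2 d, cube d k x & cube d k `<=` cube c l.
Proof.
move=> k0 kl cx; have l0 := lt_le_trans k0 kl.
pose d := [tuple (tnth c i + (tnth x i - tnth c i) * (1 - k / l))%R | i < n].
have kl1 : (k / l <= 1)%R by rewrite ler_pdivrMr// mul1r.
have kl0 : (0 < k / l)%R by rewrite divr_gt0.
exists d.
  move=> i; rewrite tnth_mktuple; have /andP[h1 h2] := cx i.
  have e : (l * (k / l) = k)%R by field; rewrite gt_eqF.
  move: (tnth c i) (tnth x i) h1 h2 => a b h1 h2; apply/andP; split; first by nra.
  by rewrite -{2}e; nra.
have e : (l * (k / l) = k)%R by field; rewrite gt_eqF.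
apply: le_cube => i; rewrite tnth_mktuple; have /andP[h1 h2] := cx i; first by nra.
rewrite -{2}e; nra.
Qed.

Hypothesis n0 : (0 < n)%N.

Lemma side_length (t : R) : (0 < t)%R -> exists2 l : R, (0 < l)%R & (l ^+ n = t)%R.
Proof.
move=> t0; exists (t `^ n%:R^-1)%R; first exact: powR_gt0.
by rewrite -powR_mulrn ?powR_ge0// -powRrM mulVf ?powRr1 ?ltW// pnatr_eq0 -lt0n.
Qed.

Lemma cube_meet (c d : n.-tuple R) (l k : R) : (k <= l)%R ->
  cube c l `&` cube d k !=set0 ->
  cube d k `<=` cube [tuple (tnth c i - l)%R | i < n] (3 * l).
Proof.
move=> kl [z [cz dz]]; apply: le_cube => i; rewrite tnth_mktuple.
  by have /andP[? ?] := cz i; have /andP[? ?] := dz i; lra.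
by have /andP[? ?] := cz i; have /andP[? ?] := dz i; lra.
Qed.

Definition ratcube (P : n.-tuple rat * rat) : set Rn :=
  cube [tuple (ratr (tnth P.1 i) : R) | i < n] (ratr P.2).

(** Cubes with rational data form a countable base, so that an arbitrary union
    of open cubes is a countable one. *)
Lemma ratcube_inside (c x : n.-tuple R) (l : R) : cube c l x ->
  exists P, ratcube P x /\ ratcube P `<=` cube c l.
Proof.
move=> cx.
pose e := \big[Num.min/1%R]_(i < n)
  Num.min (tnth x i - tnth c i)%R (tnth c i + l - tnth x i)%R.
have e0 : (0 < e)%R.
  rewrite /e; elim/big_ind: _ => //; first by move=> a b a0 b0; rewrite lt_min a0.
  by move=> i _; have /andP[h1 h2] := cx i; rewrite lt_min !subr_gt0 h1.
have ele i : (e <= tnth x i - tnth c i)%R /\ (e <= tnth c i + l - tnth x i)%R.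
  have : (e <= Num.min (tnth x i - tnth c i) (tnth c i + l - tnth x i))%R.
    by rewrite /e (bigD1 i)//= ge_min lexx.
  by rewrite le_min => /andP.
have [s] := rat_in_itvoo e0; rewrite in_itv/= => /andP[s0 se].
have /choice[f fP] : forall i : 'I_n, exists r : rat,
    ratr r \in `](tnth x i - ratr s)%R, (tnth x i)[.
  by move=> i; apply: rat_in_itvoo; rewrite gtrBl.
exists ([tuple f i | i < n], s); split.
  move=> i; rewrite /= !tnth_mktuple; have := fP i.
  by rewrite in_itv/= => /andP[h1 h2]; rewrite h2 -ltrBlDr.
apply: le_cube => i; rewrite /= !tnth_mktuple; have := fP i;
  rewrite in_itv/= => /andP[h1 h2]; have [? ?] := ele i; lra.
Qed.

End cubes2.

Section vitali.
Context {R : realType} (n : nat).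
Local Notation Rn := (lebesgue_space R n).
Local Notation leb := (@lebesgue_n R n).
Local Notation box := (n.-tuple R * R)%type.
Implicit Types (P Q : box) (s D : seq box).

Definition box_cube Q : set Rn := cube Q.1 Q.2.

Definition disjoint_boxes D : bool := pairwise (fun P Q => `[< box_cube P `&` box_cube Q = set0 >]) D.

Lemma measurable_box_cube Q : measurable (box_cube Q). Proof. exact: measurable_cube. Qed.

Lemma box_cube_self Q : (0 < Q.2)%R -> box_cube Q `&` box_cube Q !=set0.
Proof.
move=> Q0; exists [tuple (tnth Q.1 i + Q.2 / 2)%R | i < n]; split => i;
  by rewrite tnth_mktuple; apply/andP; split; lra.
Qed.

Definition unionb s : set Rn := \big[setU/set0]_(Q <- s) box_cube Q.

Lemma unionbP s x : unionb s x <-> exists2 Q, Q \in s & box_cube Q x.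
Proof.
rewrite /unionb; elim: s => [|P s IH].
  by rewrite big_nil; split => // -[].
rewrite big_cons; split.
  move=> [Px|/IH[Q Qs Qx]]; first by exists P; rewrite ?mem_head.
  by exists Q; rewrite // inE Qs orbT.
move=> [Q]; rewrite inE => /predU1P[->|Qs] Qx; first by left.
by right; apply/IH; exists Q.
Qed.

Lemma measurable_unionb s : measurable (unionb s).
Proof. by apply: bigsetU_measurable => Q _; exact: measurable_box_cube. Qed.

Lemma exists_largest_box s : s != [::] ->
  exists2 Q, Q \in s & forall P, P \in s -> (P.2 <= Q.2)%R.
Proof.
elim: s => // P s IH _; have [->|s0] := eqVneq s [::].
  by exists P; rewrite ?mem_head// => Q; rewrite inE => /eqP ->.
have [Q Qs Qmax] := IH s0; have [PQ|/ltW QP] := leP P.2 Q.2.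
  exists Q; first by rewrite inE Qs orbT.
  by move=> P'; rewrite inE => /predU1P[->//|/Qmax].
exists P; first exact: mem_head.
by move=> P'; rewrite inE => /predU1P[->//|/Qmax/le_trans]; apply.
Qed.

Definition triple Q : box := ([tuple (tnth Q.1 i - Q.2)%R | i < n], (3 * Q.2)%R).

(** Greedy choice: keep a largest cube, discard those that meet it (they lie in
    its triple), and continue with the others. *)
Lemma vitali_boxes s : (forall Q, Q \in s -> (0 < Q.2)%R) ->
  exists D, [/\ {subset D <= s}, disjoint_boxes D & unionb s `<=` unionb (map triple D)].
Proof.
have [k] := ubnP (size s); elim: k s => // k IH s sk s0.
have [->|sn] := eqVneq s [::].
  by exists [::]; split => // x /unionbP[].
have [Q Qs Qmax] := exists_largest_box sn.
pose far P := `[< box_cube Q `&` box_cube P = set0 >].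
have Qfar : ~~ far Q.
  by apply/negP => /asboolP; apply/eqP/set0P; exact/box_cube_self/s0.
have [||D [Ds Dd Dc]] := IH [seq P <- s | far P].
- rewrite size_filter (leq_trans _ (_ : size s <= k)%N)//.
  by rewrite ltn_neqAle count_size andbT -all_count; apply/allPn; exists Q.
- by move=> P; rewrite mem_filter => /andP[_ /s0].
exists (Q :: D); split.
- by move=> P; rewrite inE => /predU1P[->//|/Ds]; rewrite mem_filter => /andP[].
- rewrite /disjoint_boxes/= -/(disjoint_boxes D) Dd andbT.
  by apply/allP => P /Ds; rewrite mem_filter => /andP[].
move=> x /unionbP[P Ps Px]; apply/unionbP.
have [Pfar|Pnear] := boolP (far P).
  have : unionb [seq P <- s | far P] x.
    by apply/unionbP; exists P; rewrite ?mem_filter ?Pfar.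
  move=> /Dc/unionbP[P' P'D P'x]; exists P' => //.
  by rewrite /= inE P'D orbT.
exists (triple Q); first by rewrite /= mem_head.
move/asboolP/eqP/set0P : Pnear => ne.
exact: (cube_meet (Qmax _ Ps) ne Px).
Qed.

Lemma lebesgue_unionb_le s : (forall Q, Q \in s -> (0 < Q.2)%R) ->
  leb (unionb s) <= (\sum_(Q <- s) Q.2 ^+ n)%:E.
Proof.
elim: s => [|Q s IH] s0; first by rewrite /unionb !big_nil measure0.
rewrite /unionb !big_cons EFinD; apply: (le_trans (measureU2 leb (measurable_box_cube Q) (measurable_unionb s))).
apply: leeD; first by rewrite -(lebesgue_n_cube Q.1 (s0 _ (mem_head _ _))).
by apply: IH => P Ps; apply: s0; rewrite inE Ps orbT.
Qed.

Lemma measure_disjoint_boxes D (A : set Rn) : measurable A -> disjoint_boxes D ->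
  leb (A `&` unionb D) = \sum_(Q <- D) leb (A `&` box_cube Q).
Proof.
move=> mA; elim: D => [|Q D IH]; first by rewrite /unionb !big_nil setI0 measure0.
rewrite /disjoint_boxes/= => /andP[QD dD].
rewrite /unionb !big_cons setIUr -IH// measureU//.
- by apply: measurableI => //; exact: measurable_box_cube.
- by apply: measurableI => //; exact: measurable_unionb.
- rewrite setIACA setIid; apply/seteqP; split => // x [_ [Qx /unionbP[P PD Px]]].
  have /asboolP h := allP QD _ PD.
  by have : (box_cube Q `&` box_cube P) x by []; rewrite h.
Qed.

Section cover.
Variable G : set box.
Hypothesis G0 : forall Q, G Q -> (0 < Q.2)%R.

Definition unionG : set Rn := [set x | exists2 Q, G Q & box_cube Q x].

Let inside (P : n.-tuple rat * rat) Q := G Q /\ ratcube P `<=` box_cube Q.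

(** One member of [G] around each rational cube that fits into some member: a
    countable subfamily with the same union. *)
Let pickbox (k : nat) : option box :=
  if unpickle k is Some P then
    (if pselect (exists Q, inside P Q) is left h then Some (sval (cid h)) else None)
  else None.

Let pickboxG k Q : pickbox k = Some Q -> G Q.
Proof.
rewrite /pickbox; case: unpickle => // P; case: pselect => // h [<-].
by case: cid => Q' [].
Qed.

Let Fk k : set Rn := if pickbox k is Some Q then box_cube Q else set0.

Let unionGE : unionG = \bigcup_k Fk k.
Proof.
apply/seteqP; split => x.
  move=> [Q GQ /ratcube_inside[P [Px PQ]]]; exists (pickle P) => //.
  rewrite /Fk /pickbox pickleK; case: pselect => [h|]; last by case; exists Q.
  by case: cid => Q' [_ /=]; apply.
move=> [k _]; rewrite /Fk; case E : (pickbox k) => [Q|//] Qx.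
by exists Q => //; exact: pickboxG E.
Qed.

Let mFk k : measurable (Fk k).
Proof. by rewrite /Fk; case: (pickbox k) => [Q|]; [exact: measurable_box_cube|exact: measurable0]. Qed.

Lemma measurable_unionG : measurable unionG.
Proof. by rewrite unionGE; exact: bigcupT_measurable. Qed.

Lemma finite_subfamily (t : R) : t%:E < leb unionG ->
  exists s, (forall Q, Q \in s -> G Q) /\ t%:E < leb (unionb s).
Proof.
move=> tG.
pose s k := pmap pickbox (iota 0 k).
have sG k Q : Q \in s k -> G Q.
  by rewrite mem_pmap => /mapP[i _ /esym/pickboxG].
have us : unionG = \bigcup_k unionb (s k).
  rewrite unionGE; apply/seteqP; split => x [k _].
    rewrite /Fk; case E : (pickbox k) => [Q|//] Qx; exists k.+1 => //.
    apply/unionbP; exists Q => //; rewrite mem_pmap -E.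
    by apply: map_f; rewrite mem_iota/= add0n.
  move=> /unionbP[Q]; rewrite mem_pmap => /mapP[i _ E] Qx.
  by exists i => //; rewrite /Fk -E.
have nds : nondecreasing_seq (fun k => unionb (s k)).
  move=> a c ac; rewrite subsetEset => x /unionbP[Q]; rewrite mem_pmap => /mapP[i ia E] Qx.
  apply/unionbP; exists Q => //; rewrite mem_pmap E; apply: map_f.
  by move: ia; rewrite !mem_iota/= !add0n => /leq_trans; apply.
have := nondecreasing_cvg_mu (mu := leb) (fun k => measurable_unionb (s k)).
rewrite -us => /(_ measurable_unionG nds) cv.
apply: contrapT => H; move: tG; apply/negP; rewrite -leNgt.
apply: (cvge_to_le cv); apply: nearW => k /=; rewrite leNgt; apply/negP => tk.
by apply: H; exists (s k); split => //; exact: sG.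
Qed.

Lemma disjoint_subfamily (t : R) : t%:E < leb unionG ->
  exists D, [/\ forall Q, Q \in D -> G Q, disjoint_boxes D &
    (t < 3 ^+ n * \sum_(Q <- D) Q.2 ^+ n)%R].
Proof.
move=> /finite_subfamily[s [sG ts]].
have [|D [Ds Dd Dc]] := @vitali_boxes s; first by move=> Q /sG/G0.
exists D; split => //; first by move=> Q /Ds/sG.
rewrite -lte_fin; apply: (lt_le_trans ts).
apply: (@le_trans _ _ (leb (unionb (map triple D)))).
  by apply: le_measure => //; rewrite inE; exact: measurable_unionb.
apply: le_trans (lebesgue_unionb_le _) _.
  by move=> _ /mapP[Q /Ds/sG/G0 Q0 ->] /=; rewrite mulr_gt0.
rewrite big_map lee_fin mulr_sumr le_eqVlt; apply/orP; left; apply/eqP.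
by apply: eq_bigr => Q _; rewrite exprMn.
Qed.

End cover.
End vitali.

(** * Rearrangements *)
Section rearrangement_theory.
Context {R : realType} (n : nat).
Local Notation Rn := (lebesgue_space R n).
Local Notation leb := (@lebesgue_n R n).
Local Notation mu := (@completed_lebesgue_measure R).
Implicit Types f g : Rn -> \bar R.

Lemma le_lebesgue_n (A C : set Rn) : A `<=` C -> leb A <= leb C.
Proof. exact: (le_outer_measure (tuple_measure (@lebesgue_measure R) n)^*%mu). Qed.

Definition distr f (l : R) : \bar R := leb [set x | l%:E < `|f x|].

Lemma le_distr f (l k : R) : (l <= k)%R -> distr f k <= distr f l.
Proof.
by move=> lk; apply: le_lebesgue_n => x /=; apply: le_lt_trans; rewrite lee_fin.
Qed.

Lemma rearrangement_ge0 f s : 0 <= rearrangement f s.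
Proof. by apply: le_ereal_inf_tmp => _ [l [l0 _] <-]; rewrite lee_fin. Qed.

Lemma rearrangement_nonincreasing f (s t : R) : (s <= t)%R ->
  rearrangement f t <= rearrangement f s.
Proof.
move=> st; apply: le_ereal_inf => _ [l [l0 ls] <-]; exists l => //; split => //.
by apply: le_trans ls _; rewrite lee_fin.
Qed.

Lemma rearrangement_le f (s l : R) : (0 <= l)%R -> distr f l <= s%:E ->
  rearrangement f s <= l%:E.
Proof. by move=> l0 ls; apply: ereal_inf_lbound; exists l. Qed.

Lemma rearrangement_ge f (s : R) (c : \bar R) :
  (forall l : R, (0 <= l)%R -> l%:E < c -> s%:E < distr f l) ->
  c <= rearrangement f s.
Proof.
move=> H; apply: le_ereal_inf_tmp => _ [l [l0 ls] <-]; rewrite leNgt; apply/negP => lc.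
by have := H l l0 lc; rewrite ltNge => /negP; apply.
Qed.

Lemma measurable_superlevel f (l : R) : measurable_fun setT f ->
  measurable [set x | l%:E < `|f x|].
Proof.
move=> mf; rewrite -[X in measurable X]setTI.
exact: (emeasurable_fun_o_infty measurableT (measurableT_comp (@abse_measurable R setT) mf)).
Qed.

(** Right continuity of the distribution function. *)
Lemma rearrangement_gtP f (s l : R) : measurable_fun setT f -> (0 <= l)%R ->
  (l%:E < rearrangement f s) = (s%:E < distr f l).
Proof.
move=> mf l0; apply/idP/idP => [ls|sl].
  by rewrite ltNge; apply/negP => /(rearrangement_le l0); rewrite leNgt ls.
pose E k := [set x : Rn | (l + k.+1%:R^-1)%:E < `|f x|].
have EU : [set x : Rn | l%:E < `|f x|] = \bigcup_k E k.
  apply/seteqP; split => x /=; last first.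
    by move=> [k _]; apply: le_lt_trans; rewrite lee_fin lerDl invr_ge0.
  case fx : `|f x| => [y| |//].
    rewrite lte_fin -subr_gt0 => ly.
    have [k kly] : exists k : nat, (k.+1%:R^-1 < y - l)%R.
      exists (Num.truncn (y - l)^-1); rewrite invf_plt ?posrE//.
      have yi : (0 < (y - l)^-1)%R by rewrite invr_gt0.
      by have /andP[] := truncn_itv (ltW yi).
    by exists k => //; rewrite /E/= fx lte_fin -ltrBrDl.
  by exists 0%N => //; rewrite /E/= fx ltry.
have nd : nondecreasing_seq E.
  move=> a c ac; rewrite subsetEset => x; apply: le_lt_trans.
  by rewrite lee_fin lerD2l lef_pV2 ?posrE// ler_nat.
have cv := nondecreasing_cvg_mu (mu := leb)
  (fun k => measurable_superlevel (l + k.+1%:R^-1) mf)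
  (bigcupT_measurable E (fun k => measurable_superlevel (l + k.+1%:R^-1) mf)) nd.
rewrite -EU in cv.
have [k sk] : exists k, s%:E < leb (E k).
  apply: contrapT => H; move: sl; apply/negP; rewrite -leNgt.
  apply: (cvge_to_le cv); apply: nearW => k /=; rewrite leNgt; apply/negP => sk.
  by apply: H; exists k.
apply: (@lt_le_trans _ _ (l + k.+1%:R^-1)%:E); first by rewrite lte_fin ltrDl invr_gt0.
apply: rearrangement_ge => h h0 hk; apply: (lt_le_trans sk).
by apply: le_distr; rewrite -lee_fin ltW.
Qed.

Lemma mpos_rearrangement_powR f (a : R) : (0 <= a)%R ->
  mpos (fun s => rearrangement f s `^ a).
Proof.
move=> a0; apply: mpos_nonincreasing => x y _ xy.
by apply: le_poweR => //; [exact: rearrangement_ge0|exact: rearrangement_nonincreasing].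
Qed.

Lemma distr_restrict f (Q : set Rn) (l : R) : (0 <= l)%R ->
  distr (f \_ Q) l = leb ([set x | l%:E < `|f x|] `&` Q).
Proof.
move=> l0; congr leb; apply/seteqP; split => x /=; rewrite patchE.
  case: ifPn => [xQ lf|_]; first by split => //; rewrite -in_setE.
  by rewrite abse0 lte_fin ltNge l0.
by move=> [lf Qx]; rewrite mem_set.
Qed.

Lemma rearrangement_restrict_le f (Q : set Rn) (s : R) :
  rearrangement (f \_ Q) s <= rearrangement f s.
Proof.
apply: le_ereal_inf_tmp => _ [l [l0 ls] <-]; apply: rearrangement_le => //.
by apply: le_trans ls; rewrite distr_restrict//; apply: le_lebesgue_n => x [].
Qed.

Lemma rearrangement_restrict_eq0 f (Q : set Rn) (s : R) : leb Q <= s%:E ->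
  rearrangement (f \_ Q) s = 0.
Proof.
move=> Qs; apply/eqP; rewrite eq_le rearrangement_ge0 andbT.
apply: rearrangement_le => //; apply: le_trans Qs; rewrite distr_restrict//.
by apply: le_lebesgue_n => x [].
Qed.

(** Extends the primitive of [b] to infinite arguments, as a distribution
    function may be infinite. *)
Definition upto (b : R -> R) (y : \bar R) : \bar R :=
  ipos (fun s => if s%:E < y then (b s)%:E else 0).

Lemma upto_fin (b : R -> R) (y : R) : upto b y%:E = \int[mu]_(s in `]0%R, y[) (b s)%:E.
Proof. by rewrite -ipos_below; apply: eq_ipos => s _; rewrite /below lte_fin. Qed.

Lemma le_upto (b : R -> R) (y z : \bar R) :
  (forall x : R, (0 < x)%R -> (0 <= b x)%R) -> y <= z -> upto b y <= upto b z.
Proof.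
move=> b0 yz; apply: le_ipos.
  by move=> s s0; case: ifP; rewrite ?lee_fin ?b0.
move=> s s0; case: ifPn => sy; first by rewrite (lt_le_trans sy yz).
by case: ifP; rewrite ?lee_fin ?b0.
Qed.

Lemma upto_ge0 (b : R -> R) y : (forall x : R, (0 < x)%R -> (0 <= b x)%R) -> 0 <= upto b y.
Proof. by move=> b0; apply: ipos_ge0 => s s0; case: ifP; rewrite ?lee_fin ?b0. Qed.

(** The layer-cake formula after the substitution of [l `^ a^-1] for the level;
    it allows the norms of the restrictions of a function to disjoint sets to
    be compared level by level. *)
Lemma Lambda_layer f (a : R) (b : R -> R) : measurable_fun setT f -> (0 < a)%R ->
  mpos (EFin \o b) -> (forall x : R, (0 < x)%R -> (0 <= b x)%R) ->
  ipos (fun s => rearrangement f s `^ a * (b s)%:E) =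
  ipos (fun l => upto b (distr f (l `^ a^-1))).
Proof.
move=> mf a0 mb b0.
have mk := mpos_rearrangement_powR f (ltW a0).
have b0' (x : R) : `]0%R, +oo[%classic x -> 0 <= (EFin \o b) x by move=> /posP x0; rewrite lee_fin b0.
have k0' (x : R) : `]0%R, +oo[%classic x -> 0 <= rearrangement f x `^ a by rewrite poweR_ge0.
have -> : ipos (fun s => rearrangement f s `^ a * (b s)%:E) =
   ipos (fun s => (EFin \o b) s * rearrangement f s `^ a).
  by apply: eq_ipos => s _; rewrite muleC.
rewrite /ipos (layer_cake mu (@measurable_pos R) mb mk b0' k0').
apply: eq_integral => l; rewrite inE => /posP l0.
rewrite /upto /ipos integral_mkcond [RHS]integral_mkcond; apply: eq_integral => s _.
rewrite !patchE; case: (boolP (s \in `]0%R, +oo[%classic)) => s0; last first.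
  by rewrite ifF//; apply/negbTE; apply: contra s0; rewrite !inE => -[].
have -> : (s \in `]0%R, +oo[ `&` [set x | l%:E < rearrangement f x `^ a]) =
    (s%:E < distr f (l `^ a^-1)); last by [].
rewrite -rearrangement_gtP ?powR_ge0//.
have lE : (l%:E = (l `^ a^-1)%:E `^ a).
  by rewrite poweR_EFin -powRrM mulVf ?gt_eqF// powRr1// ltW.
apply/idP/idP.
  rewrite inE => -[_ /=]; rewrite ltNge => lf; rewrite ltNge; apply: contra lf => lf.
  rewrite lE; apply: le_poweR => //; first exact: ltW.
  exact: rearrangement_ge0.
move=> lf; rewrite inE; split; first by move: s0; rewrite inE.
rewrite /= ltNge; apply/negP => fl; move: lf; rewrite ltNge => /negP; apply.
rewrite -(poweRK (lt0r_neq0 a0) (rearrangement_ge0 f s)) -poweR_EFin.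
apply: le_poweR => //; first by rewrite invr_ge0 ltW.
exact: poweR_ge0.
Qed.

End rearrangement_theory.

(** * The lower r-estimate for the Lorentz norm *)
Section lower_estimate.
Context {R : realType} (n : nat).
Local Notation Rn := (lebesgue_space R n).
Local Notation leb := (@lebesgue_n R n).
Local Notation mu := (@completed_lebesgue_measure R).
Local Notation box := (n.-tuple R * R)%type.

Lemma hoelder_sum (I : eqType) (D : seq I) (s : R) (z pi : I -> R) : (1 <= s)%R ->
  (forall i, (0 <= z i)%R) -> (forall i, (0 <= pi i)%R) ->
  (\sum_(i <- D) pi i <= 1)%R -> (0 < \sum_(i <- D) z i `^ s)%R ->
  (\sum_(i <- D) z i `^ (s - 1) * pi i `^ s^-1 <=
   (\sum_(i <- D) z i `^ s) `^ (1 - s^-1))%R.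
Proof.
move=> s1 z0 pi0 pi1; set W := (\sum_(i <- D) z i `^ s)%R => W0.
have s0 : (0 < s)%R by exact: lt_le_trans s1.
set w := (W `^ s^-1)%R; have w0 : (0 < w)%R by exact: powR_gt0.
have wW : (w `^ s = W)%R by rewrite /w -powRrM mulVf ?gt_eqF// powRr1// ltW.
have wW1 : (w `^ (s - 1) = W `^ (1 - s^-1))%R.
  by rewrite /w -powRrM mulrBr mulVf ?gt_eqF// mulr1.
have key : (\sum_(i <- D) (z i / w) `^ (s - 1) * pi i `^ s^-1 <= 1)%R.
  apply: (@le_trans _ _ (\sum_(i <- D) (pi i / s + (1 - s^-1) * (z i / w) `^ s))%R).
    apply: ler_sum => i _; rewrite mulrC.
    have := @young_powR R s (pi i `^ s^-1) (z i / w) s1 (powR_ge0 _ _).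
    rewrite -powRrM mulVf ?gt_eqF// powRr1//; apply.
    by rewrite divr_ge0// ltW.
  rewrite big_split/= -mulr_suml -mulr_sumr.
  have -> : (\sum_(i <- D) (z i / w) `^ s = 1)%R.
    rewrite (eq_bigr (fun i => z i `^ s * W^-1)%R); last first.
      move=> i _; rewrite powRM ?invr_ge0 ?(ltW w0)//; congr (_ * _)%R.
      by rewrite -powR_inv1 ?(ltW w0)// -powRrM mulN1r powRN wW.
    by rewrite -mulr_suml divff// gt_eqF.
  have : ((\sum_(i <- D) pi i) / s <= 1 / s)%R by rewrite ler_pM2r ?invr_gt0.
  by move: ((\sum_(i <- D) pi i) / s)%R => S; lra.
apply: (@le_trans _ _ (w `^ (s - 1) * \sum_(i <- D) (z i / w) `^ (s - 1) * pi i `^ s^-1)%R).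
  rewrite mulr_sumr le_eqVlt; apply/orP; left; apply/eqP; apply: eq_bigr => i _.
  rewrite mulrA; congr (_ * _)%R; rewrite -powRM ?(ltW w0) ?divr_ge0 ?(ltW w0)//.
  by rewrite mulrC divfK// gt_eqF.
by rewrite wW1 -[leRHS]mulr1 ler_wpM2l ?powR_ge0.
Qed.

Variables (alpha r K2 : R) (b B : R -> R).
Hypotheses (alpha0 : (0 < alpha)%R) (ar : (alpha <= r)%R) (K20 : (0 < K2)%R).
Hypothesis mb : mpos (EFin \o b).
Hypothesis b0 : forall x : R, (0 < x)%R -> (0 <= b x)%R.
Hypothesis BE : forall t : R, (0 < t)%R -> \int[mu]_(s in `]0%R, t[) (b s)%:E = (B t)%:E.
Hypothesis Bq : quasi_increasing K2 (fun t => B t / t `^ (alpha / r))%R.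

Let r0 : (0 < r)%R. Proof. exact: lt_le_trans ar. Qed.

Lemma upto_ratio (x y : R) : (0 <= x)%R -> (x <= y)%R -> (0 < y)%R ->
  upto b x%:E <= (K2 * (x / y) `^ (alpha / r))%:E * upto b y%:E.
Proof.
move=> x0 xy y0; move: x0; rewrite le_eqVlt => /predU1P[<-|x0].
  rewrite {1}upto_fin set_itvoo0 integral_set0 mule_ge0 ?upto_ge0//.
  by rewrite lee_fin mulr_ge0 ?powR_ge0// ltW.
rewrite !upto_fin !BE// -EFinM lee_fin.
have := Bq x0 xy; rewrite ler_pdivrMr ?powR_gt0// => /le_trans; apply.
rewrite powRM ?invr_ge0 ?(ltW x0) ?(ltW y0)// -[(y^-1)%R]powR_inv1 ?(ltW y0)//.
rewrite -powRrM mulN1r powRN le_eqVlt; apply/orP; left; apply/eqP; ring.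
Qed.

(** Put [s = r / alpha].  Each [z Q] is at most the integral over the levels of
    the primitive of [b] at the measure [m Q] of the part of a superlevel set
    in [Q], and quasi-monotonicity bounds that primitive by
    [K2 * (m Q / M) `^ s^-1] times its value at the total measure [M].
    Multiplying by [z Q `^ (s - 1)] and summing under the integral, Hoelder's
    inequality gives [W <= K2 * W `^ (1 - s^-1) * I] for the sum [W] of the
    [z Q `^ s]. *)
Lemma lower_r_estimate (f : Rn -> \bar R) (D : seq box) (z : box -> R) :
  measurable_fun setT f -> disjoint_boxes D ->
  (forall Q, Q \in D -> (0 < Q.2)%R) ->
  (forall Q, (0 <= z Q)%R) ->
  (forall Q, Q \in D -> (z Q)%:E <=
     ipos (fun s => rearrangement (f \_ (box_cube Q)) s `^ alpha * (b s)%:E)) ->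
  ((\sum_(Q <- D) z Q `^ (r / alpha)) `^ (alpha / r))%:E <=
  K2%:E * ipos (fun s => rearrangement (f \_ (unionb D)) s `^ alpha * (b s)%:E).
Proof.
move=> mf dD D0 z0 za.
set s := (r / alpha)%R; set W := (\sum_(Q <- D) z Q `^ s)%R.
have sV : (alpha / r = s^-1)%R by rewrite /s invf_div.
have s1 : (1 <= s)%R by rewrite ler_pdivlMr// mul1r.
have s0 : (0 < s)%R by exact: lt_le_trans s1.
have W0 : (0 <= W)%R by apply: sumr_ge0 => Q _; exact: powR_ge0.
have mfQ Q : measurable_fun setT (f \_ (box_cube Q)).
  by apply/(measurable_restrictT _ (measurable_box_cube Q)); exact: measurable_funTS.
have mfU : measurable_fun setT (f \_ (unionb D)).
  by apply/(measurable_restrictT _ (measurable_unionb D)); exact: measurable_funTS.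
rewrite sV; have [WE|Wn0] := eqVneq W 0%R.
  rewrite WE powR0 ?invr_eq0 ?gt_eqF// mule_ge0 ?lee_fin ?(ltW K20)//.
  by apply: ipos_ge0 => x x0; rewrite mule_ge0 ?poweR_ge0 ?lee_fin ?b0.
have Wgt0 : (0 < W)%R by rewrite lt_neqAle eq_sym Wn0.
set I := ipos _.
have I0 : 0 <= I.
  by apply: ipos_ge0 => x x0; rewrite mule_ge0 ?poweR_ge0 ?lee_fin ?b0.
pose h Q (l : R) := upto b (distr (f \_ (box_cube Q)) (l `^ alpha^-1)).
have h0 Q : ge0pos (h Q) by move=> l _; exact: upto_ge0.
have hni (g : Rn -> \bar R) (l k : R) : (0 < l)%R -> (l <= k)%R ->
    upto b (distr g (k `^ alpha^-1)) <= upto b (distr g (l `^ alpha^-1)).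
  move=> l0 lk; apply: le_upto => //; apply: le_distr.
  by rewrite ge0_ler_powR ?nnegrE ?invr_ge0 ?(ltW alpha0) ?(ltW l0) ?(le_trans (ltW l0) lk).
have mh Q : mpos (h Q) by apply: mpos_nonincreasing => l k l0 lk; exact: hni.
have W1 : W%:E <= (K2 * W `^ (1 - s^-1))%:E * I.
  apply: (@le_trans _ _ (\sum_(Q <- D) (z Q `^ (s - 1))%:E * ipos (h Q))).
    rewrite /W -sumEFin big_seq [leRHS]big_seq; apply: lee_sum => Q QD.
    rewrite /h -Lambda_layer// -(@mulr_powRB1 _ (z Q) s)// mulrC EFinM.
    by apply: lee_wpmul2l; [rewrite lee_fin powR_ge0|exact: za].
  have -> : \sum_(Q <- D) (z Q `^ (s - 1))%:E * ipos (h Q) =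
      ipos (fun l => \sum_(Q <- D) (z Q `^ (s - 1))%:E * h Q l).
    elim: (D) => [|Q D' IH].
      by rewrite big_nil /ipos integral0_eq// => l _; rewrite big_nil.
    rewrite big_cons IH -iposZl ?powR_ge0// -iposD.
    - by apply: eq_ipos => l _; rewrite big_cons.
    - by apply: mposM; [exact: mpos_cst|exact: mh].
    - elim: D' {IH} => [|Q' D' IH]; first by under eq_fun do rewrite big_nil; exact: mpos_cst.
      under eq_fun do rewrite big_cons; apply: mposD => //.
      by apply: mposM; [exact: mpos_cst|exact: mh].
    - by move=> l l0; rewrite mule_ge0 ?lee_fin ?powR_ge0// h0.
    - by move=> l l0; apply: sume_ge0 => Q' _; rewrite mule_ge0 ?lee_fin ?powR_ge0// h0.
  rewrite /I Lambda_layer// -iposZl; last 3 first.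
  - by rewrite mulr_ge0 ?powR_ge0// ltW.
  - by apply: mpos_nonincreasing => l k l0 lk; exact: hni.
  - by move=> l _; exact: upto_ge0.
  apply: le_ipos.
    by move=> l l0; apply: sume_ge0 => Q' _; rewrite mule_ge0 ?lee_fin ?powR_ge0// h0.
  move=> l l0; rewrite /h; set k := (l `^ alpha^-1)%R.
  have k0 : (0 <= k)%R by exact: powR_ge0.
  set A := [set x | k%:E < `|f x|].
  have mA : measurable A by exact: measurable_superlevel.
  have fQ Q : distr (f \_ (box_cube Q)) k = leb (A `&` box_cube Q) by exact: distr_restrict.
  have fU : distr (f \_ (unionb D)) k = \sum_(Q <- D) leb (A `&` box_cube Q).
    by rewrite distr_restrict// measure_disjoint_boxes.
  pose m Q := if Q \in D then fine (leb (A `&` box_cube Q)) else 0%R.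
  have m0 Q : (0 <= m Q)%R by rewrite /m; case: ifP => // _; exact: fine_ge0.
  have mE Q : Q \in D -> leb (A `&` box_cube Q) = (m Q)%:E.
    move=> QD; rewrite /m QD fineK// ge0_fin_numE//.
    apply: (@le_lt_trans _ _ (leb (box_cube Q))); first by apply: le_lebesgue_n => x [].
    by rewrite /box_cube lebesgue_n_cube ?D0// ltry.
  pose M := (\sum_(Q <- D) m Q)%R.
  have ME : distr (f \_ (unionb D)) k = M%:E.
    rewrite fU /M -sumEFin big_seq [RHS]big_seq; apply: eq_bigr => Q QD.
    exact: mE.
  have M0 : (0 <= M)%R by apply: sumr_ge0.
  rewrite ME; move: M0; rewrite le_eqVlt => /predU1P[ME0|M0].
    have mz Q : Q \in D -> m Q = 0%R.
      move=> QD; apply/eqP; rewrite eq_le m0 andbT ME0 /M.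
      rewrite (big_rem Q)//= lerDl; apply: sumr_ge0 => Q' _; exact: m0.
    rewrite big_seq big1 ?mule_ge0 ?upto_ge0 ?lee_fin ?mulr_ge0 ?powR_ge0 ?(ltW K20)//.
    move=> Q QD; rewrite fQ mE// mz// upto_fin set_itvoo0 integral_set0 mule0//.
  have mM Q : Q \in D -> (m Q <= M)%R.
    move=> QD; rewrite /M (big_rem Q)//= lerDl; apply: sumr_ge0 => Q' _; exact: m0.
  apply: (@le_trans _ _ (\sum_(Q <- D) (z Q `^ (s - 1) * (K2 * (m Q / M) `^ s^-1))%:E * upto b M%:E)).
    rewrite big_seq [leRHS]big_seq; apply: lee_sum => Q QD.
    rewrite [in leRHS]EFinM -muleA; apply: lee_wpmul2l; first by rewrite lee_fin powR_ge0.
    by rewrite fQ mE// -sV; apply: upto_ratio => //; exact: mM.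
  rewrite -ge0_sume_distrl; last first.
    by move=> Q _; rewrite lee_fin !mulr_ge0 ?powR_ge0// ltW.
  apply: lee_wpmul2r; first exact: upto_ge0.
  rewrite sumEFin lee_fin.
  have := @hoelder_sum _ D s z (fun Q => m Q / M)%R s1 z0 _ _ Wgt0.
  rewrite -mulr_suml -/M divff ?gt_eqF// lexx => hs.
  apply: (@le_trans _ _ (K2 * \sum_(Q <- D) z Q `^ (s - 1) * (m Q / M) `^ s^-1)%R).
    rewrite mulr_sumr le_eqVlt; apply/orP; left; apply/eqP; apply: eq_bigr => Q _; ring.
  rewrite ler_wpM2l ?(ltW K20)//; apply: hs => // Q.
  by rewrite divr_ge0// ltW.
have w0 : (0 < W `^ (1 - s^-1))%R by exact: powR_gt0.
have wi : 0 <= ((W `^ (1 - s^-1))^-1)%:E by rewrite lee_fin invr_ge0 ltW.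
have := lee_wpmul2l wi W1.
have -> : (W `^ (1 - s^-1))^-1%:E * W%:E = (W `^ s^-1)%:E.
  rewrite -EFinM; congr EFin; rewrite -powRN opprB.
  rewrite -[X in (_ * X)%R]powRr1// -powRD ?subrK//.
  by rewrite Wn0 implybT.
rewrite muleA -EFinM (_ : ((W `^ (1 - s^-1))^-1 * (K2 * W `^ (1 - s^-1)))%R = K2)//.
by rewrite mulrCA mulVf ?mulr1// gt_eqF.
Qed.

End lower_estimate.

(** * Rearrangement of the maximal function *)
Section maximal_upper.
Context {R : realType} (n : nat).
Local Notation Rn := (lebesgue_space R n).
Local Notation leb := (@lebesgue_n R n).
Local Notation mu := (@completed_lebesgue_measure R).
Local Notation box := (n.-tuple R * R)%type.
Implicit Types (f : Rn -> \bar R) (P : box).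

Lemma Q_class_mul (r K4 : R) (phi : R -> R) (N : nat) (t : R) : (0 < r)%R ->
  (forall s : R, (0 < s)%R -> (0 < phi s)%R) -> Q_class r K4 phi -> (0 < t)%R ->
  (phi (N.+1%:R * t) <= K4 * (N.+1%:R `^ r^-1 * phi t))%R.
Proof.
move=> r0 phi0 Qphi t0; have := Qphi N (fun=> t) (fun=> t0).
rewrite !sumr_const card_ord -[(t *+ _)%R]mulr_natl -[((_ `^ r) *+ _)%R]mulr_natl.
rewrite powRM ?powR_ge0// -powRrM divff ?gt_eqF// powRr1//.
by rewrite ltW// phi0.
Qed.

Lemma Q_class_sum (I : eqType) (r K4 : R) (phi : R -> R) (D : seq I) (F : I -> R) :
  Q_class r K4 phi -> D != [::] -> (forall i, i \in D -> (0 < F i)%R) ->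
  (phi (\sum_(i <- D) F i) <= K4 * (\sum_(i <- D) phi (F i) `^ r) `^ r^-1)%R.
Proof.
case: D => // i0 D Qphi _ F0.
have E (G : I -> R) : (\sum_(i <- i0 :: D) G i =
    \sum_(j < (size D).+1) G (tnth (in_tuple (i0 :: D)) j))%R by rewrite big_tnth.
rewrite (E F) (E (fun i => phi (F i) `^ r)%R).
apply: (Qphi (size D) (fun j => F (tnth (in_tuple (i0 :: D)) j))) => j.
by apply: F0; exact: mem_tnth.
Qed.

Lemma Lambda_normE (a : R) (b : R -> R) (f : Rn -> \bar R) :
  Lambda_norm a b f = (ipos (fun s => rearrangement f s `^ a * (b s)%:E)) `^ a^-1.
Proof. by []. Qed.

Lemma Lambda_norm_ge0 (a : R) (b : R -> R) (f : Rn -> \bar R) : 0 <= Lambda_norm a b f.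
Proof. exact: poweR_ge0. Qed.

Lemma is_cubeP (Q : set Rn) : is_cube Q <-> exists P : box, (0 < P.2)%R /\ Q = box_cube P.
Proof.
split; first by move=> [c [l [l0 ->]]]; exists (c, l).
by move=> [[c l] [/= l0 ->]]; exists c, l.
Qed.

Lemma fine_lebesgue_box_cube (P : box) : (0 < P.2)%R -> fine (leb (box_cube P)) = (P.2 ^+ n)%R.
Proof. by move=> P0; rewrite /box_cube lebesgue_n_cube. Qed.

Variables (phi : R -> R) (alpha : R) (b : R -> R).
Hypothesis phi0 : forall t : R, (0 < t)%R -> (0 < phi t)%R.

Definition cube_ratio (f : Rn -> \bar R) (P : box) : \bar R :=
  Lambda_norm alpha b (f \_ (box_cube P)) * ((phi (P.2 ^+ n))^-1)%:E.

Lemma cube_ratio_ge0 f P : (0 < P.2)%R -> 0 <= cube_ratio f P.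
Proof.
by move=> P0; rewrite mule_ge0 ?Lambda_norm_ge0// lee_fin invr_ge0 ltW// phi0// exprn_gt0.
Qed.

Lemma cube_ratioE f (P : box) : (0 < P.2)%R ->
  Lambda_norm alpha b (f \_ (box_cube P)) / (phi (fine (leb (box_cube P))))%:E = cube_ratio f P.
Proof.
move=> P0; rewrite fine_lebesgue_box_cube// /cube_ratio inver gt_eqF//.
by rewrite phi0// exprn_gt0.
Qed.

Lemma maximal_ge f P (x : Rn) : (0 < P.2)%R -> box_cube P x ->
  cube_ratio f P <= maximal phi alpha b f x.
Proof.
move=> P0 Px; rewrite -cube_ratioE//; apply: ereal_sup_ubound; exists (box_cube P) => //.
by split => //; apply/is_cubeP; exists P.
Qed.

Lemma maximal_le f (x : Rn) (c : \bar R) :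
  (forall P, (0 < P.2)%R -> box_cube P x -> cube_ratio f P <= c) ->
  maximal phi alpha b f x <= c.
Proof.
move=> H; apply: ge_ereal_sup => _ [Q [/is_cubeP[P [P0 ->]] Px] <-].
by rewrite cube_ratioE//; exact: H.
Qed.

Lemma maximal_ge0 f (x : Rn) : 0 <= maximal phi alpha b f x.
Proof.
pose P : box := ([tuple (tnth (x : n.-tuple R) i - 1)%R | i < n], 2%R).
apply: le_trans (maximal_ge f (P := P) _ _); first exact: cube_ratio_ge0.
  by [].
by move=> i; rewrite tnth_mktuple; apply/andP; split => /=; lra.
Qed.

(** The cubes that witness that the maximal function exceeds [l]. *)
Definition good_boxes f (l : R) : set box :=
  [set P | (0 < P.2)%R /\ l%:E < cube_ratio f P].

Lemma superlevel_maximal f (l : R) :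
  [set x | l%:E < `|maximal phi alpha b f x|] = unionG (good_boxes f l).
Proof.
apply/seteqP; split => x /=; rewrite ?gee0_abs ?maximal_ge0//.
  move=> lM; apply: contrapT => H; move: lM; apply/negP; rewrite -leNgt.
  apply: maximal_le => P P0 Px; rewrite leNgt; apply/negP => lP.
  by apply: H; exists P.
by move=> [P [P0 lP] Px]; apply: (lt_le_trans lP); exact: maximal_ge.
Qed.

Variables (r K2 K3 K4 : R) (B : R -> R).
Hypotheses (alpha0 : (0 < alpha)%R) (ar : (alpha <= r)%R).
Hypotheses (K20 : (0 < K2)%R) (K30 : (0 < K3)%R) (K40 : (0 < K4)%R).
Hypothesis mb : mpos (EFin \o b).
Hypothesis b0 : forall x : R, (0 < x)%R -> (0 <= b x)%R.
Hypothesis BE : forall t : R, (0 < t)%R -> \int[mu]_(s in `]0%R, t[) (b s)%:E = (B t)%:E.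
Hypothesis Bq : quasi_increasing K2 (fun t => B t / t `^ (alpha / r))%R.
Hypothesis phiK : quasi_increasing K3 phi.
Hypothesis Qphi : Q_class r K4 phi.

Let r0 : (0 < r)%R. Proof. exact: lt_le_trans ar. Qed.

Lemma le_head_norm (g : R -> \bar R) (s t : R) : (s <= t)%R ->
  head_norm alpha b g s <= head_norm alpha b g t.
Proof.
move=> st; apply: le_poweR; first by rewrite invr_ge0 ltW.
  apply: integral_ge0 => x /=; rewrite in_itv/= => /andP[x0 _].
  by rewrite mule_ge0 ?poweR_ge0 ?lee_fin ?b0.
apply: ge0_le_lower_integral => x /=; rewrite !in_itv/= => /andP[x0 xs].
- by rewrite mule_ge0 ?poweR_ge0 ?lee_fin ?b0.
- by rewrite x0 (lt_le_trans xs).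
- by rewrite mule_ge0 ?poweR_ge0 ?lee_fin ?b0/=.
Qed.

(** The two summands in the last factor belong to the two possible positions
    of [x] relative to the total measure [tau] of a disjoint family of cubes:
    if [x <= tau] the supremum sees [tau] itself, otherwise [x < 3 ^ n * tau]
    and [phi x] is compared with [phi tau] through the [3 ^ n]-fold sum. *)
Definition maximal_constant : R :=
  (K4 * K2 `^ alpha^-1 * (1 + K3 * (K4 * (3 ^+ n) `^ r^-1)))%R.

(** Vitali's lemma gives disjoint cubes with [l * phi |Q|] below the local norm
    on [Q].  Summing [r]-th powers, the left-hand sides dominate [l * phi tau]
    by the [Q_r] condition, and the right-hand sides are dominated by the norm
    on the union, which has measure at most [tau]. *)
Lemma superlevel_maximal_bound f (l x : R) : measurable_fun setT f -> (0 < x)%R ->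
  (0 <= l)%R -> x%:E < distr (maximal phi alpha b f) l ->
  l%:E <= maximal_constant%:E * tail_sup phi (head_norm alpha b (rearrangement f)) x.
Proof.
move=> mf x0 l0; rewrite /distr superlevel_maximal => xG.
have [|D [DG dD xD]] := disjoint_subfamily _ xG; first by move=> Q [].
set tau := (\sum_(Q <- D) Q.2 ^+ n)%R in xD.
have D0 Q : Q \in D -> (0 < Q.2)%R by move=> /DG[].
have tau0 : (0 < tau)%R.
  by have := lt_trans x0 xD; rewrite pmulr_rgt0// exprn_gt0.
pose z (Q : box) := ((l * phi (Q.2 ^+ n)) `^ alpha)%R.
have lphi0 Q : Q \in D -> (0 <= l * phi (Q.2 ^+ n))%R.
  by move=> QD; rewrite mulr_ge0// ltW// phi0// exprn_gt0// D0.
have zle Q : Q \in D -> (z Q)%:E <=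
    ipos (fun s => rearrangement (f \_ (box_cube Q)) s `^ alpha * (b s)%:E).
  move=> QD; have [Q0 lQ] := DG _ QD.
  have ph : (0 < phi (Q.2 ^+ n))%R by rewrite phi0// exprn_gt0.
  have I0 : 0 <= ipos (fun s => rearrangement (f \_ (box_cube Q)) s `^ alpha * (b s)%:E).
    by apply: ipos_ge0 => s s0; rewrite mule_ge0 ?poweR_ge0 ?lee_fin ?b0.
  rewrite -(poweRVK (lt0r_neq0 alpha0) I0) /z -poweR_EFin; apply: le_poweR.
  - exact: ltW.
  - by rewrite lee_fin lphi0.
  move: (ltW lQ); rewrite /cube_ratio Lambda_normE => lQ'.
  have ph' : 0 <= (phi (Q.2 ^+ n))%:E by rewrite lee_fin ltW.
  have := lee_wpmul2r ph' lQ'.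
  by rewrite -muleA -!EFinM mulVf ?gt_eqF// mule1.
have H1 := lower_r_estimate alpha0 ar K20 mb b0 BE Bq mf dD D0 (fun Q => powR_ge0 _ _) zle.
have H2 : ipos (fun s => rearrangement (f \_ (unionb D)) s `^ alpha * (b s)%:E) <=
    \int[mu]_(s in `]0%R, tau[) (rearrangement f s `^ alpha * (b s)%:E).
  rewrite -ipos_below; apply: le_ipos.
    by move=> s s0; rewrite mule_ge0 ?poweR_ge0 ?lee_fin ?b0.
  move=> s s0; rewrite /below; case: ltP => st.
    apply: lee_wpmul2r; first by rewrite lee_fin b0.
    apply: le_poweR; [exact: ltW|exact: rearrangement_ge0|].
    exact: rearrangement_restrict_le.
  rewrite rearrangement_restrict_eq0 ?poweR0r ?mul0e ?gt_eqF//.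
  by apply: (le_trans (lebesgue_unionb_le D0)); rewrite lee_fin.
set J := \int[mu]_(s in _) _ in H2.
set Y := (\sum_(Q <- D) z Q `^ (r / alpha))%R in H1.
have Y0 : (0 <= Y)%R by apply: sumr_ge0 => Q _; exact: powR_ge0.
have YE : Y = (l `^ r * \sum_(Q <- D) phi (Q.2 ^+ n) `^ r)%R.
  rewrite /Y mulr_sumr big_seq [RHS]big_seq; apply: eq_bigr => Q QD.
  rewrite /z -powRrM (_ : alpha * (r / alpha) = r)%R; last by field; rewrite gt_eqF.
  by rewrite powRM// ltW// phi0// exprn_gt0// D0.
have H3 : (Y `^ r^-1)%:E <= (K2 `^ alpha^-1)%:E * head_norm alpha b (rearrangement f) tau.
  rewrite -[(K2 `^ _)%:E]poweR_EFin /head_norm -poweRM ?lee_fin ?(ltW K20)//; last first.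
    apply: integral_ge0 => s /=; rewrite in_itv/= => /andP[s0 _].
    by rewrite mule_ge0 ?poweR_ge0 ?lee_fin ?b0.
  rewrite (_ : r^-1 = alpha / r / alpha)%R; last by field; rewrite !gt_eqF.
  rewrite powRrM -poweR_EFin; apply: le_poweR; first by rewrite invr_ge0 ltW.
    by rewrite lee_fin powR_ge0.
  by apply: (le_trans H1); rewrite lee_wpmul2l// lee_fin ltW.
clear H1 H2; have phtau := phi0 tau0.
have H4 : (phi tau <= K4 * (\sum_(Q <- D) phi (Q.2 ^+ n) `^ r) `^ r^-1)%R.
  apply: (Q_class_sum (F := fun Q : box => (Q.2 ^+ n)%R) Qphi).
    by apply: contraTneq tau0 => DE; rewrite /tau DE big_nil ltxx.
  by move=> Q QD; rewrite exprn_gt0// D0.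
have H5 : (l * phi tau)%:E <=
    (K4 * K2 `^ alpha^-1)%:E * head_norm alpha b (rearrangement f) tau.
  apply: (@le_trans _ _ (K4 * Y `^ r^-1)%:E).
    rewrite lee_fin YE powRM ?powR_ge0 ?sumr_ge0//; last by move=> Q _; rewrite powR_ge0.
    rewrite -powRrM divff ?gt_eqF// powRr1// mulrCA.
    by rewrite ler_wpM2l.
  by rewrite !EFinM -muleA lee_wpmul2l// lee_fin ltW.
clear H3 H4.
set F := head_norm alpha b (rearrangement f) in H5 *.
have F0 t : 0 <= F t by exact: poweR_ge0.
have c0 : (0 <= K4 * K2 `^ alpha^-1)%R by rewrite mulr_ge0 ?powR_ge0// ltW.
have k0 : (0 <= K3 * (K4 * (3 ^+ n) `^ r^-1))%R by rewrite !mulr_ge0 ?powR_ge0// ltW.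
have hs0 : 0 <= tail_sup phi F x by apply: tail_sup_ge0.
have H6 : l%:E <= (K4 * K2 `^ alpha^-1)%:E * (F tau * ((phi tau)^-1)%:E).
  have ph' : 0 <= ((phi tau)^-1)%:E by rewrite lee_fin invr_ge0 ltW.
  by have := lee_wpmul2r ph' H5; rewrite -EFinM mulfK ?gt_eqF// muleA.
apply: (le_trans H6); rewrite /maximal_constant [X in _ <= X * _]EFinM -muleA; apply: lee_wpmul2l.
  by rewrite lee_fin.
have [xtau|taux] := leP x tau.
  apply: le_trans (tail_sup_ge phi F xtau) _; rewrite -[leLHS]mul1e.
  by apply: lee_wpmul2r => //; rewrite lee_fin lerDl.
apply: (@le_trans _ _ ((K3 * (K4 * (3 ^+ n) `^ r^-1))%:E * tail_sup phi F x)); last first.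
  by apply: lee_wpmul2r => //; rewrite lee_fin lerDr.
apply: (@le_trans _ _ ((K3 * (K4 * (3 ^+ n) `^ r^-1))%:E * (F x * ((phi x)^-1)%:E))); last first.
  by apply: lee_wpmul2l; rewrite ?lee_fin// tail_sup_ge.
rewrite muleCA; apply: (@le_trans _ _ (F x * ((phi tau)^-1)%:E)).
  by apply: lee_wpmul2r; [rewrite lee_fin invr_ge0 ltW|exact/le_head_norm/ltW].
apply: lee_wpmul2l => //; rewrite -EFinM lee_fin.
rewrite ler_pdivlMr ?phi0// mulrC ler_pdivrMr//.
apply: le_trans (phiK x0 (ltW xD)) _; rewrite -mulrA ler_pM2l//.
have := @Q_class_mul r K4 phi (3 ^ n).-1 tau r0 phi0 Qphi tau0.
by rewrite prednK ?expn_gt0// natrX mulrA.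
Qed.

Lemma rearrangement_maximal_le f (x : R) : measurable_fun setT f -> (0 < x)%R ->
  rearrangement (maximal phi alpha b f) x <=
  maximal_constant%:E * tail_sup phi (head_norm alpha b (rearrangement f)) x.
Proof.
move=> mf x0; set c := _ * _.
have c0 : 0 <= c.
  rewrite mule_ge0//.
    rewrite lee_fin /maximal_constant !mulr_ge0 ?powR_ge0 ?(ltW K40)// addr_ge0//.
    by rewrite !mulr_ge0 ?powR_ge0 ?(ltW K30) ?(ltW K40).
  by apply: tail_sup_ge0 => // tau _; exact: poweR_ge0.
apply/lee_addgt0Pr => e e0.
case cE : c c0 => [d| |//]; last by move=> _; rewrite addye ?leey.
rewrite lee_fin => d0; rewrite -EFinD; apply: rearrangement_le.
  by rewrite addr_ge0// ltW.
(* A level strictly above the bound has a superlevel set of measure at most x. *)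
rewrite leNgt; apply/negP => /(superlevel_maximal_bound mf x0).
rewrite addr_ge0 ?(ltW e0)// => /(_ isT); rewrite -/c cE lee_fin.
by rewrite gerDl leNgt e0.
Qed.

End maximal_upper.

(** * The fundamental function of the GGamma space *)
Section fundamental_function.
Context {R : realType}.
Local Notation mu := (@completed_lebesgue_measure R).
Local Notation line := (lebesgue_line R).

Lemma ipos_split (f : R -> \bar R) (t : R) : (0 < t)%R -> mpos f -> ge0pos f ->
  ipos f = \int[mu]_(x in `]0%R, t[) f x + \int[mu]_(x in `]t, +oo[) f x.
Proof.
move=> t0 mf f0.
have mt : measurable ([set t] : set line) by exact: borel_measurable_line.
have f0' (x : line) : `]0%R, +oo[%classic x -> 0 <= f x by move=> /posP/f0.
have tE : `]0%R, +oo[%classic `\` [set t] = `]0%R, t[ `|` `]t, +oo[ :> set R.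
  apply/seteqP; split => x /=; rewrite !in_itv/= !andbT.
    by move=> [x0 xt]; have [? | ? | ?] := ltgtP x t; [left; rewrite x0|by right|].
  by move=> [/andP[-> xt]|tx]; split; rewrite ?(lt_trans t0 tx)//;
    move=> xE; [rewrite xE ltxx in xt|rewrite xE ltxx in tx].
have mu0 : mu [set t] = 0 by rewrite mu_borelE lebesgue_measure_set1.
have := ge0_negligible_integral mt (@measurable_pos R) mf f0' mu0.
rewrite tE /ipos => ->; clear mu0.
have sub : (`]0%R, t[ `|` `]t, +oo[ : set R) `<=` `]0%R, +oo[.
  by rewrite -tE; exact: subDsetl.
apply: ge0_integral_setU.
- exact: measurable_itv_line.
- exact: measurable_itv_line.
- by apply: measurable_funS mf; [exact: measurable_pos|].
- by move=> x /sub/f0'.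
- rewrite disj_set2E; apply/eqP/seteqP; split => // x [] /=; rewrite !in_itv/= andbT.
  by move=> /andP[_ xt]; rewrite ltNge (ltW xt).
Qed.

Variables (m p : R) (v : R -> R).
Hypotheses (m0 : (0 < m)%R) (p0 : (0 < p)%R).
Hypothesis Wv : W_class m p v.

Let th0 : (0 < m / p)%R. Proof. exact: divr_gt0. Qed.
Let v0 (x : R) : (0 < x)%R -> (0 <= v x)%R. Proof. by have [[_ h _] _ _ _] := Wv; exact: h. Qed.
Let mv : mpos (EFin \o v). Proof. by have [/mpos_weight h _ _ _] := Wv. Qed.

Lemma mpos_min (t : R) : mpos (fun x => (Num.min x t `^ (m / p) * v x)%:E).
Proof.
under eq_fun do rewrite EFinM; apply: mposM => //.
apply: mpos_powR; apply: mpos_nondecreasing => x z x0 xz /=.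
by rewrite lee_fin le_min !ge_min xz lexx/= orbT.
Qed.

Lemma ge0_min (t : R) : ge0pos (fun x => (Num.min x t `^ (m / p) * v x)%:E).
Proof. by move=> x x0; rewrite lee_fin mulr_ge0 ?powR_ge0 ?v0. Qed.

(** The inner integral of the GGamma norm of the indicator of [(0, t)] is
    [min x t], so that [v1] is the [m]-th power of the norm of this indicator. *)
Lemma v1_min (t : R) : (0 < t)%R ->
  v1 m p v t = ipos (fun x => (Num.min x t `^ (m / p) * v x)%:E).
Proof.
move=> t0; rewrite (ipos_split t0 (mpos_min t) (ge0_min t)) /v1; congr (_ + _).
  apply: eq_integral => x; rewrite inE/= in_itv/= => /andP[_ xt].
  by rewrite mulrC min_l// ltW.
transitivity (\int[mu]_(x in `]t, +oo[) ((t `^ (m / p))%:E * (v x)%:E)); last first.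
  apply: eq_integral => x; rewrite inE/= in_itv/= andbT => tx.
  by rewrite -EFinM min_r// ltW.
have mvt : measurable_fun (`]t, +oo[%classic : set line) (EFin \o v).
  apply: measurable_funS mv; first exact: measurable_pos.
  by move=> x /=; rewrite !in_itv/= !andbT; exact: lt_trans.
have v0t (x : line) : `]t, +oo[%classic x -> 0 <= (EFin \o v) x.
  by rewrite /= in_itv/= andbT lee_fin => tx; rewrite v0// (lt_trans t0).
exact/esym/(ge0_integralZl_EFin mu (measurable_itv_line _) v0t mvt (powR_ge0 _ _)).
Qed.

Lemma v1_fin (t : R) : (0 < t)%R -> v1 m p v t \is a fin_num.
Proof.
move=> t0; have [_ /(_ _ t0) h _ _] := Wv.
have a0 : 0 <= \int[mu]_(s in `]0%R, t[) (v s * s `^ (m / p))%:E.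
  apply: integral_ge0 => x /=; rewrite in_itv/= => /andP[x0 _].
  by rewrite lee_fin mulr_ge0 ?powR_ge0 ?v0.
have c0 : 0 <= \int[mu]_(s in `]t, +oo[) (v s)%:E.
  apply: integral_ge0 => x /=; rewrite in_itv/= andbT => tx.
  by rewrite lee_fin v0// (lt_trans t0).
have afin : \int[mu]_(s in `]0%R, t[) (v s * s `^ (m / p))%:E \is a fin_num.
  by rewrite ge0_fin_numE//; apply: le_lt_trans h; exact: leeDl.
have cfin : \int[mu]_(s in `]t, +oo[) (v s)%:E \is a fin_num.
  by rewrite ge0_fin_numE//; apply: le_lt_trans h; exact: leeDr.
by rewrite /v1 fin_numD afin fin_numM.
Qed.

Definition Vr (t : R) : R := fine (v1 m p v t).

Lemma VrE (t : R) : (0 < t)%R -> v1 m p v t = (Vr t)%:E.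
Proof. by move=> t0; rewrite fineK// v1_fin. Qed.

(** If [v] vanished almost everywhere beyond [x], the integral of
    [v s * s `^ (m / p)] over [(1, oo)] would be finite. *)
Lemma tail_positive (x : R) : (0 < x)%R -> 0 < \int[mu]_(s in `]x, +oo[) (v s)%:E.
Proof.
move=> x0; have [_ fin _ inf] := Wv.
pose y := Num.max x 1%R.
have y0 : (0 < y)%R by rewrite lt_max x0.
have xy : (x <= y)%R by rewrite le_max lexx.
have y1 : (1 <= y)%R by rewrite le_max lexx orbT.
have tail_ge0 (z : R) : (0 < z)%R -> 0 <= \int[mu]_(s in `]z, +oo[) (v s)%:E.
  move=> z0; apply: integral_ge0 => s /=; rewrite in_itv/= andbT => zs.
  by rewrite lee_fin v0// (lt_trans z0).
rewrite lt_neqAle tail_ge0// andbT eq_sym; apply/negP => /eqP tail0.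
have tail0y : \int[mu]_(s in `]y, +oo[) (v s)%:E = 0.
  apply/eqP; rewrite eq_le tail_ge0// andbT -tail0; apply: ge0_le_lower_integral => s /=;
    rewrite !in_itv/= !andbT => h.
  - by rewrite lee_fin v0// (lt_trans x0).
  - exact: le_lt_trans h.
  - by rewrite lee_fin v0 ?(lt_trans y0)/=.
clear tail0.
pose f (s : R) := (v s * s `^ (m / p))%:E.
have f0 : ge0pos f by move=> s s0; rewrite lee_fin mulr_ge0 ?powR_ge0 ?v0.
have mf : mpos f.
  rewrite (_ : f = fun s => (v s)%:E * (s `^ (m / p))%:E); last first.
    by apply/funext => s; rewrite /f EFinM.
  apply: mposM => //; apply: mpos_nondecreasing => s t s0 st.
  by rewrite lee_fin ge0_ler_powR ?nnegrE ?(ltW th0) ?(ltW s0) ?(le_trans (ltW s0)).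
pose above k : R -> \bar R := fun s => if (y < s)%R then below k%:R f s else 0.
have mabove k : mpos (above k).
  rewrite (_ : above k = fun s => below k%:R f s * (if (y < s)%R then 1 else 0)); last first.
    by apply/funext => s; rewrite /above; case: ifP; rewrite ?mule1 ?mule0.
  apply: mposM; first exact: mpos_below mf.
  apply: mpos_nondecreasing => s t s0 st; case: ifPn => ys; last by case: ifP.
  by rewrite (lt_le_trans ys st).
have above0 k : ge0pos (above k).
  by move=> s s0; rewrite /above; case: ifP => // _; exact: (below_ge0 _ f0).
have tailf : \int[mu]_(s in `]y, +oo[) f s <= 0.
  apply: (@le_trans _ _ (ipos (fun s => if (y < s)%R then f s else 0))).
    rewrite /ipos; apply: ge0_le_lower_integral => s /=; rewrite !in_itv/= ?andbT => h.
    - by case: ifP => // _; exact: f0.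
    - exact: lt_trans h.
    - by rewrite h f0 ?(lt_trans y0)/=.
  apply: (ipos_le_of_sup (f := above)).
  - exact: mabove.
  - exact: above0.
  - move=> k s s0; rewrite /above; case: ifP => // _; rewrite /below.
    case: ifPn => sk; last by case: ifP => // _; exact: f0.
    by rewrite (lt_le_trans sk)// ler_nat.
  - by move=> s s0; case: ifP => // _; exact: f0.
  - move=> s s0; have /andP[_ sk] := truncn_itv (ltW s0).
    apply: ereal_sup_ubound; exists (Num.truncn s).+1 => //.
    by rewrite /above /below sk.
  - move=> k; have k0 : (0 <= k%:R `^ (m / p) :> R)%R by exact: powR_ge0.
    apply: (@le_trans _ _ ((k%:R `^ (m / p))%:E * \int[mu]_(s in `]y, +oo[) (v s)%:E)).
      have mvt : measurable_fun (`]y, +oo[%classic : set line) (EFin \o v).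
        apply: measurable_funS mv; first exact: measurable_pos.
        by move=> s /=; rewrite !in_itv/= !andbT; exact: lt_trans.
      have v0t (s : line) : `]y, +oo[%classic s -> 0 <= (EFin \o v) s.
        by rewrite /= in_itv/= andbT lee_fin => ys; rewrite v0// (lt_trans y0).
      rewrite -(ge0_integralZl_EFin mu (measurable_itv_line _) v0t mvt k0).
      rewrite /ipos [leLHS]integral_mkcond [leRHS]integral_mkcond.
      apply: ge0_le_lower_integral => // s _.
        rewrite patchE; case: ifPn => [sy|_]; last exact: lexx.
        have h : 0 <= (EFin \o v) s by apply: v0t; exact: set_mem sy.
        by rewrite mule_ge0 ?lee_fin.
      have inE1 (z : R) : (s \in `]z, +oo[%classic) = (z < s)%R.
        by apply/idP/idP; rewrite inE/= in_itv/= andbT.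
      rewrite !patchE !inE1; case: (ltP 0%R s) => [s0|s0]; last first.
        by rewrite lexx/= ltNge (le_trans s0 (ltW y0)).
      rewrite above0//=.
      rewrite /above; case: ifP => // _; rewrite /below; case: ifP => [sk|_].
        rewrite /f mulrC EFinM /= -!EFinM lee_fin ler_wpM2r ?v0//.
        by rewrite ge0_ler_powR ?nnegrE ?(ltW th0) ?(ltW s0) ?ler0n ?(ltW sk).
      by rewrite mule_ge0 ?lee_fin ?v0.
    by rewrite tail0y mule0.
clear tail0y.
have : \int[mu]_(s in `]1%R, +oo[) f s <= ipos (below y f) + \int[mu]_(s in `]y, +oo[) f s.
  rewrite ipos_below -(ipos_split y0 mf f0); apply: ge0_le_lower_integral => s /=;
    rewrite !in_itv/= !andbT => h.
  - exact: f0.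
  - exact: lt_trans h.
  - by rewrite f0 ?lexx ?(lt_trans _ h).
rewrite inf => /le_trans /(_ (leeD (lexx _) tailf)); rewrite adde0 leye_eq ipos_below => /eqP h.
have := fin _ y0; rewrite h addye ?ltxx//.
rewrite gt_eqF//; apply: lt_le_trans (tail_ge0 _ y0); exact: ltNy0.
Qed.

Lemma Vr_gt0 (t : R) : (0 < t)%R -> (0 < Vr t)%R.
Proof.
move=> t0; rewrite -lte_fin -VrE// /v1.
apply: (@lt_le_trans _ _ ((t `^ (m / p))%:E * \int[mu]_(s in `]t, +oo[) (v s)%:E)).
  by rewrite mule_gt0 ?tail_positive// lte_fin powR_gt0.
apply: leeDr; apply: integral_ge0 => x /=; rewrite in_itv/= => /andP[x0 _].
by rewrite lee_fin mulr_ge0 ?powR_ge0 ?v0.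
Qed.

(** A non-zero non-increasing [g] exceeds some [c > 0] on an initial interval
    [(0, x)], and then the integral is at least a multiple of the tail of [v]
    beyond [x]. *)
Lemma GGamma_integral_eq0 (g : R -> \bar R) : ge0pos g ->
  (forall x y : R, (0 < x)%R -> (x <= y)%R -> g y <= g x) ->
  ipos (fun x => (\int[mu]_(s in `]0%R, x[) (g s `^ p)) `^ (m / p) * (v x)%:E) = 0 ->
  forall x : R, (0 < x)%R -> g x = 0.
Proof.
move=> g0 gni GG0 x x0; apply/eqP; rewrite eq_le g0// andbT leNgt; apply/negP => gx.
have [c c0 cg] : exists2 c : R, (0 < c)%R & c%:E <= g x.
  case E : (g x) gx => [y| |//]; last by exists 1%R; rewrite ?leey.
  by rewrite lte_fin => y0; exists y.
pose k := ((c `^ p * x) `^ (m / p))%R.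
have k0 : (0 < k)%R by rewrite powR_gt0// mulr_gt0// powR_gt0.
have Ik0 : 0 < k%:E * \int[mu]_(s in `]x, +oo[) (v s)%:E.
  by rewrite mule_gt0 ?lte_fin ?tail_positive.
have mvt : measurable_fun (`]x, +oo[%classic : set line) (EFin \o v).
  apply: measurable_funS mv; first exact: measurable_pos.
  by move=> s /=; rewrite !in_itv/= !andbT; exact: lt_trans.
have v0t (s : line) : `]x, +oo[%classic s -> 0 <= (EFin \o v) s.
  by rewrite /= in_itv/= andbT lee_fin => ys; rewrite v0// (lt_trans x0).
have : k%:E * \int[mu]_(s in `]x, +oo[) (v s)%:E <= 0.
  rewrite -GG0 -(ge0_integralZl_EFin mu (measurable_itv_line _) v0t mvt (ltW k0)).
  rewrite /ipos; apply: ge0_le_lower_integral => s /=; rewrite !in_itv/= !andbT => xs.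
  - by rewrite mule_ge0 ?poweR_ge0 ?lee_fin ?v0.
  - exact: lt_trans xs.
  have s0 := lt_trans x0 xs.
  rewrite mule_ge0 ?lee_fin ?(ltW k0) ?v0//=; apply: lee_wpmul2r; first by rewrite lee_fin v0.
  rewrite /k -poweR_EFin; apply: le_poweR; first exact: ltW.
    by rewrite lee_fin mulr_ge0 ?powR_ge0// ltW.
  rewrite EFinM -(ipos_below1 (ltW x0)) -iposZl ?powR_ge0//; last 2 first.
  - by apply: mpos_below; exact: mpos_cst.
  - exact: below_ge0.
  rewrite -ipos_below; apply: le_ipos.
    by move=> z z0; rewrite mule_ge0 ?lee_fin ?powR_ge0//; exact: below_ge0.
  move=> z z0; rewrite -below_cst1 /below; case: ifPn => zx; last first.
    by case: ifP => // _; exact: poweR_ge0.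
  rewrite (lt_trans zx xs) -poweR_EFin; apply: le_poweR; first exact: ltW.
    by rewrite lee_fin ltW.
  by apply: (le_trans cg); apply: gni => //; exact: ltW.
by rewrite leNgt Ik0.
Qed.

End fundamental_function.

(** * Indicators of cubes as test functions *)
Section test_functions.
Context {R : realType} (n : nat).
Local Notation Rn := (lebesgue_space R n).
Local Notation leb := (@lebesgue_n R n).
Local Notation mu := (@completed_lebesgue_measure R).
Local Notation box := (n.-tuple R * R)%type.

Definition ind (A : set Rn) (x : Rn) : \bar R := (\1_A x)%:E.

Lemma measurable_ind A : measurable A -> measurable_fun setT (ind A).
Proof. by move=> mA; apply/measurable_EFinP; exact: measurable_indic. Qed.

Lemma ind_restrict A P : ind A \_ P = ind (A `&` P).
Proof.
apply/funext => x; rewrite patchE /ind !indicE in_setI.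
by case: (x \in P); rewrite ?andbT ?andbF.
Qed.

Lemma rearrangement_ind A (t s : R) : leb A = t%:E -> (0 <= s)%R ->
  rearrangement (ind A) s = (if (s < t)%R then 1 else 0).
Proof.
move=> At s0.
have dE l : distr (ind A) l = leb [set x | (l < \1_A x)%R].
  congr leb; apply/funext => x; rewrite /mkset.
  have -> : `|ind A x| = (\1_A x)%:E by rewrite gee0_abs// /ind lee_fin.
  by rewrite lte_fin.
case: ifPn => st.
  apply/eqP; rewrite eq_le; apply/andP; split.
    apply: rearrangement_le => //; rewrite dE.
    rewrite (_ : [set x | _] = set0) ?measure0 ?lee_fin//.
    by apply/seteqP; split => // x /=; rewrite indicE; case: (x \in A); rewrite ?ltxx// ltr10.
  apply: rearrangement_ge => l l0 l1; rewrite dE (_ : [set x | _] = A) ?At//.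
  apply/seteqP; split => x /=; rewrite indicE.
    by case: (boolP (x \in A)) => [/set_mem//|_]; rewrite ltNge l0.
  by move=> Ax; rewrite mem_set//= -lte_fin.
apply/eqP; rewrite eq_le rearrangement_ge0 andbT; apply: rearrangement_le => //.
apply: (@le_trans _ _ (leb A)); last by rewrite At lee_fin leNgt.
rewrite dE; apply: le_lebesgue_n => x /=; rewrite indicE.
by case: (boolP (x \in A)) => [/set_mem//|_]; rewrite ltxx.
Qed.

Variables (m p alpha : R) (b B phi : R -> R).
Hypotheses (p0 : (0 < p)%R) (alpha0 : (0 < alpha)%R).
Hypothesis BE : forall t : R, (0 < t)%R -> \int[mu]_(s in `]0%R, t[) (b s)%:E = (B t)%:E.
Hypothesis phi0 : forall t : R, (0 < t)%R -> (0 < phi t)%R.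

Lemma Lambda_norm_ind A (t : R) : (0 < t)%R -> leb A = t%:E ->
  Lambda_norm alpha b (ind A) = (B t `^ alpha^-1)%:E.
Proof.
move=> t0 At; rewrite Lambda_normE -poweR_EFin -BE//; congr (_ `^ _).
rewrite -ipos_below; apply: eq_ipos => s s0; rewrite (rearrangement_ind At) ?(ltW s0)//.
by rewrite /below; case: ifP => _; rewrite ?poweR1r ?mul1e// poweR0r ?mul0e// gt_eqF.
Qed.

Lemma GGamma_norm_ind (v : R -> R) A (t : R) : W_class m p v ->
  (0 < t)%R -> leb A = t%:E -> GGamma_norm p m v (ind A) = (Vr m p v t `^ m^-1)%:E.
Proof.
move=> Wv t0 At; rewrite /GGamma_norm -poweR_EFin -VrE// v1_min//; congr (_ `^ _).
apply: eq_ipos => x x0; rewrite EFinM; congr (_ * _).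
rewrite -poweR_EFin; congr (_ `^ _).
have min0 : (0 <= Num.min x t)%R by rewrite le_min !ltW.
rewrite -(ipos_below1 min0) -ipos_below; apply: eq_ipos => s s0.
rewrite /below lt_min (rearrangement_ind At) ?(ltW s0)//.
by case: ifP => //= _; case: ifP => _; rewrite ?poweR1r// poweR0r// gt_eqF.
Qed.

Hypothesis n0 : (0 < n)%N.

(** Let [t] be the measure of [Q].  If [tau <= t], every point of [Q] lies in a
    subcube of measure [tau], whose ratio is [B tau `^ alpha^-1 / phi tau].  If
    [t < tau], a cube of measure [tau] contains [Q] and gives the ratio
    [B t `^ alpha^-1 / phi tau] at all its points. *)
Lemma rearrangement_maximal_ind_ge (Q : box) (tau x : R) : (0 < Q.2)%R ->
  (0 < tau)%R -> (x < Num.max tau (Q.2 ^+ n))%R ->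
  head_norm_ind alpha B (Q.2 ^+ n) tau * ((phi tau)^-1)%:E <=
  rearrangement (maximal phi alpha b (ind (box_cube Q))) x.
Proof.
move=> Q0 tau0; set t := (Q.2 ^+ n)%R => xt.
have t0 : (0 < t)%R by exact: exprn_gt0.
have [k k0 kn] := side_length n0 tau0.
have Qt : leb (box_cube Q) = t%:E by rewrite /box_cube lebesgue_n_cube.
have kle (k1 k2 : R) : (0 < k1)%R -> (0 < k2)%R -> (k1 ^+ n <= k2 ^+ n)%R -> (k1 <= k2)%R.
  by move=> /ltW h1 /ltW h2; rewrite ler_pXn2r ?nnegrE.
have sub (P : box) (A : set Rn) (l : R) : P.2 = k -> A `<=` box_cube P -> l%:E < cube_ratio phi alpha b (ind (box_cube Q)) P ->
    A `<=` [set y | l%:E < `|maximal phi alpha b (ind (box_cube Q)) y|].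
  move=> P2 AP lP y Ay /=; rewrite gee0_abs ?maximal_ge0//.
  by apply: (lt_le_trans lP); apply: maximal_ge; rewrite ?P2//; exact: AP.
apply: rearrangement_ge => l l0 lX.
have [tt|tt] := leP tau t.
  have {}xt : (x < t)%R by move: xt; rewrite max_r.
  apply: (@lt_le_trans _ _ t%:E); first by rewrite lte_fin.
  rewrite -Qt; apply: le_lebesgue_n => y Qy.
  have kQ : (k <= Q.2)%R by apply: kle; rewrite ?kn.
  have [d dy dQ] := subcube k0 kQ Qy.
  apply: (sub (d, k) [set y] l) => //; first by move=> _ ->.
  rewrite /cube_ratio ind_restrict /= kn setIidr//.
  rewrite (@Lambda_norm_ind _ tau)// ?/box_cube/= ?lebesgue_n_cube ?kn//.
  by move: lX; rewrite /head_norm_ind min_l.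
have {}xt : (x < tau)%R by move: xt; rewrite max_l// ltW.
have Qk : (Q.2 <= k)%R by apply: kle; rewrite ?kn// ltW.
have QP : box_cube Q `<=` box_cube (Q.1, k).
  by apply: le_cube => i //=; rewrite lerD2l.
apply: (@lt_le_trans _ _ tau%:E); first by rewrite lte_fin.
rewrite -kn -(lebesgue_n_cube Q.1 k0); apply: le_lebesgue_n.
apply: (sub (Q.1, k)) => //.
rewrite /cube_ratio ind_restrict /= kn setIidl// (@Lambda_norm_ind _ t)//.
by move: lX; rewrite /head_norm_ind min_r// ltW.
Qed.

End test_functions.

(** * Comparison of the norm with the three suprema *)
Section characterisation.
Context {R : realType} (n : nat).
Local Notation Rn := (lebesgue_space R n).
Local Notation leb := (@lebesgue_n R n).
Local Notation mu := (@completed_lebesgue_measure R).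
Local Notation line := (lebesgue_line R).
Variables (m alpha r p q K2 K3 K4 : R).
Hypothesis n0 : (0 < n)%N.
Hypotheses (m0 : (0 < m)%R) (ma : (m <= alpha)%R) (ar : (alpha <= r)%R)
  (p0 : (0 < p)%R) (pa : (p <= alpha)%R) (aq : (alpha < q)%R).
Hypotheses (K20 : (0 < K2)%R) (K30 : (0 < K3)%R) (K40 : (0 < K4)%R).
Variables (b B phi v w : R -> R).
Hypothesis Wb : weight b.
Hypothesis bni : forall x y : R, (0 < x)%R -> (x <= y)%R -> (b y <= b x)%R.
Hypothesis BE : forall t : R, (0 < t)%R -> \int[mu]_(s in `]0%R, t[) (b s)%:E = (B t)%:E.
Hypothesis B0 : forall t : R, (0 < t)%R -> (0 < B t)%R.
Hypothesis Bq : quasi_increasing K2 (fun t => B t / t `^ (alpha / r))%R.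
Hypothesis phi0 : forall t : R, (0 < t)%R -> (0 < phi t)%R.
Hypothesis phiK : quasi_increasing K3 phi.
Hypothesis Qphi : Q_class r K4 phi.
Hypothesis Wv : W_class m p v.
Hypothesis Ww : weight w.

Let alpha0 : (0 < alpha)%R. Proof. exact: lt_le_trans ma. Qed.
Let q0 : (0 < q)%R. Proof. exact: lt_trans aq. Qed.
Let r0 : (0 < r)%R. Proof. exact: lt_le_trans ar. Qed.
Let qn0 : q != 0%R. Proof. exact: lt0r_neq0. Qed.
Let b0 (x : R) : (0 < x)%R -> (0 <= b x)%R. Proof. by case: Wb => _ h _; exact: h. Qed.
Let w0 (x : R) : (0 < x)%R -> (0 <= w x)%R. Proof. by case: Ww => _ h _; exact: h. Qed.
Let v0 (x : R) : (0 < x)%R -> (0 <= v x)%R. Proof. by have [[_ h _] _ _ _] := Wv; exact: h. Qed.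
Let mb : mpos (EFin \o b). Proof. exact: mpos_weight. Qed.
Let mw : mpos (EFin \o w). Proof. exact: mpos_weight. Qed.
Let mv : mpos (EFin \o v). Proof. by have [/mpos_weight h _ _ _] := Wv. Qed.

Definition supI (x t : R) : \bar R :=
  ereal_sup [set (B tau `^ alpha^-1 / phi tau)%:E | tau in `[x, t]].

Definition supV (x : R) : \bar R :=
  ereal_sup [set (phi tau)^-1%:E | tau in `[x, +oo[].

Definition term1 (t : R) : \bar R :=
  (v1 m p v t `^ m^-1)^-1 *
  (\int[mu]_(x in `]0%R, t[) (supI x t `^ q * (w x)%:E)) `^ q^-1.

Definition term2 (t : R) : \bar R :=
  (B t `^ alpha^-1)%:E / v1 m p v t `^ m^-1 * supV t *
  (\int[mu]_(x in `]0%R, t[) (w x)%:E) `^ q^-1.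

Definition term3 (t : R) : \bar R :=
  (B t `^ alpha^-1)%:E / v1 m p v t `^ m^-1 *
  (\int[mu]_(x in `]t, +oo[) (supV x `^ q * (w x)%:E)) `^ q^-1.

Definition three_suprema : \bar R :=
  ereal_sup [set term1 t | t in `]0%R, +oo[] +
  ereal_sup [set term2 t | t in `]0%R, +oo[] +
  ereal_sup [set term3 t | t in `]0%R, +oo[].

Lemma supV_ge (x tau : R) : (x <= tau)%R -> (phi tau)^-1%:E <= supV x.
Proof.
by move=> xtau; apply: ereal_sup_ubound; exists tau => //=; rewrite in_itv/= andbT.
Qed.

Lemma supV_ge0 (x : R) : (0 < x)%R -> 0 <= supV x.
Proof.
by move=> x0; apply: le_trans (supV_ge (lexx x)); rewrite lee_fin invr_ge0 ltW// phi0.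
Qed.

Lemma supV_mul_le (x : R) (c : R) (d : \bar R) : (0 < c)%R ->
  (forall tau : R, (x <= tau)%R -> c%:E * (phi tau)^-1%:E <= d) -> c%:E * supV x <= d.
Proof.
move=> c0 H; have ci0 : (0 <= c^-1)%R by rewrite invr_ge0 ltW.
suff h : supV x <= c^-1%:E * d.
  apply: le_trans (lee_wpmul2l _ h) _; first by rewrite lee_fin ltW.
  by rewrite muleA -EFinM divff ?mul1e// gt_eqF.
apply: ge_ereal_sup => _ [tau /= + <-]; rewrite in_itv/= andbT => xtau.
have := lee_wpmul2l (ci0 : 0 <= c^-1%:E) (H tau xtau).
by rewrite muleA -[X in X * _ <= _]EFinM mulVf ?gt_eqF// mul1e.
Qed.

Lemma supV_nonincreasing (x y : R) : (x <= y)%R -> supV y <= supV x.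
Proof.
move=> xy; apply: ge_ereal_sup => _ [tau /= + <-]; rewrite in_itv/= andbT => ytau.
by apply: supV_ge; exact: le_trans ytau.
Qed.

Lemma supI_ge (x t tau : R) : (x <= tau)%R -> (tau <= t)%R ->
  (B tau `^ alpha^-1 / phi tau)%:E <= supI x t.
Proof. by move=> xt tt; apply: ereal_sup_ubound; exists tau => //=; rewrite in_itv/= xt. Qed.

Lemma supI_le (x t : R) (d : \bar R) :
  (forall tau : R, (x <= tau)%R -> (tau <= t)%R -> (B tau `^ alpha^-1 / phi tau)%:E <= d) ->
  supI x t <= d.
Proof. by move=> H; apply: ge_ereal_sup => _ [tau /= + <-]; rewrite in_itv/= => /andP[/H]; apply. Qed.

Lemma supI_ge0 (x t : R) : (0 < x)%R -> (x <= t)%R -> 0 <= supI x t.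
Proof.
move=> x0 xt; apply: le_trans (supI_ge (lexx x) xt).
by rewrite lee_fin divr_ge0 ?powR_ge0// ltW// phi0.
Qed.

Lemma supI_nonincreasing (x y t : R) : (x <= y)%R -> supI y t <= supI x t.
Proof.
by move=> xy; apply: supI_le => tau ytau taut; apply: supI_ge => //; exact: le_trans ytau.
Qed.

Let beta (t : R) : R := (B t `^ alpha^-1)%R.
Let beta_gt0 t : (0 < t)%R -> (0 < beta t)%R.
Proof. by move=> t0; rewrite powR_gt0 ?B0. Qed.
Let U (t : R) : R := (Vr m p v t `^ m^-1)%R.
Let U_gt0 t : (0 < t)%R -> (0 < U t)%R.
Proof. by move=> t0; rewrite powR_gt0// Vr_gt0. Qed.

(** The integrals of the three terms, with the factor [B t `^ alpha^-1] and the
    supremum of the second term moved inside, so that all three have the form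
    [(U t)^-1 * moment `^ q^-1]. *)
Definition moment1 (t : R) := ipos (below t (fun x => supI x t `^ q * (w x)%:E)).
Definition moment2 (t : R) := ipos (below t (fun x => (((B t `^ alpha^-1)%R)%:E * supV t) `^ q * (w x)%:E)).
Definition moment3 (t : R) := \int[mu]_(x in `]t, +oo[)
   ((((B t `^ alpha^-1)%R)%:E * supV x) `^ q * (w x)%:E).

Let v1U (t : R) : (0 < t)%R -> (v1 m p v t `^ m^-1)^-1 = ((U t)^-1)%:E.
Proof.
by move=> t0; rewrite VrE// poweR_EFin inver gt_eqF// -/(U t) U_gt0.
Qed.

Let w0y (t : R) (x : line) : (0 < t)%R -> `]t, +oo[%classic x -> 0 <= (w x)%:E.
Proof. by move=> t0; rewrite /= in_itv/= andbT lee_fin => tx; rewrite w0// (lt_trans t0). Qed.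

Lemma term1E (t : R) : (0 < t)%R -> term1 t = ((U t)^-1)%:E * moment1 t `^ q^-1.
Proof. by move=> t0; rewrite /term1 v1U// /moment1 ipos_below. Qed.

Lemma term2E (t : R) : (0 < t)%R -> term2 t = ((U t)^-1)%:E * moment2 t `^ q^-1.
Proof.
move=> t0; rewrite /term2 v1U// -/(beta t).
rewrite [(beta t)%:E * _]muleC -!muleA; congr (_ * _).
rewrite /moment2 -/(beta t).
have bs0 : 0 <= (beta t)%:E * supV t by rewrite mule_ge0 ?supV_ge0// lee_fin ltW// beta_gt0.
rewrite (eq_ipos (g := fun x => ((beta t)%:E * supV t) `^ q * below t (EFin \o w) x)); last first.
  by move=> x _; rewrite /below; case: ifP => _; rewrite ?mule0.
have -> : ipos (fun x => ((beta t)%:E * supV t) `^ q * below t (EFin \o w) x) =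
   ((beta t)%:E * supV t) `^ q * ipos (below t (EFin \o w)).
  have p1 (x : line) : `]0%R, +oo[%classic x -> 0 <= below t (EFin \o w) x.
    by move=> /posP x0; apply: (below_ge0 t _ x0) => y y0; rewrite lee_fin w0.
  exact: (ge0_integralZl mu (@measurable_pos R) (mpos_below t mw) p1 (poweR_ge0 _ _)).
rewrite ipos_below poweRM ?poweR_ge0 ?poweRK ?muleA//.
apply: integral_ge0 => x /=; rewrite in_itv/= => /andP[x0 _].
by rewrite lee_fin w0.
Qed.

Lemma term3E (t : R) : (0 < t)%R -> term3 t = ((U t)^-1)%:E * moment3 t `^ q^-1.
Proof.
move=> t0; rewrite /term3 v1U// -/(beta t).
rewrite [(beta t)%:E * _]muleC -!muleA; congr (_ * _).
rewrite /moment3 -/(beta t).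
have p1 (x : line) : `]t, +oo[%classic x -> 0 <= supV x `^ q * (w x)%:E.
  by move=> tx; rewrite mule_ge0 ?poweR_ge0 ?(w0y t0 tx).
have m1 : measurable_fun (`]t, +oo[%classic : set line) (fun x => supV x `^ q * (w x)%:E).
  apply: (@measurable_funS _ _ line (\bar R) (`]0%R, +oo[%classic : set line)).
  - exact: measurable_pos.
  - by move=> x /=; rewrite !in_itv/= !andbT; exact: lt_trans.
  apply: mposM => //; apply: mpos_nonincreasing => x y x0 xy.
  apply: le_poweR; rewrite ?(ltW q0) ?supV_nonincreasing//.
  by apply: supV_ge0; exact: lt_le_trans xy.
have bq0 : 0 <= (beta t)%:E by rewrite lee_fin ltW// beta_gt0.
have -> : \int[mu]_(x in `]t, +oo[) (((beta t)%:E * supV x) `^ q * (w x)%:E) =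
  (beta t)%:E `^ q * \int[mu]_(x in `]t, +oo[) (supV x `^ q * (w x)%:E).
  rewrite -(ge0_integralZl mu (measurable_itv_line _) m1 p1 (poweR_ge0 _ _)).
  apply: eq_integral => x; rewrite inE/= in_itv/= andbT => tx.
  by rewrite poweRM ?muleA// supV_ge0// (lt_trans t0).
by rewrite poweRM ?poweR_ge0 ?poweRK//; exact: integral_ge0.
Qed.

Lemma moment1_ge0 t : 0 <= moment1 t.
Proof. by apply: ipos_ge0; apply: below_ge0 => x x0; rewrite mule_ge0 ?poweR_ge0 ?lee_fin ?w0. Qed.
Lemma moment2_ge0 t : 0 <= moment2 t.
Proof. by apply: ipos_ge0; apply: below_ge0 => x x0; rewrite mule_ge0 ?poweR_ge0 ?lee_fin ?w0. Qed.
Lemma moment3_ge0 t : (0 < t)%R -> 0 <= moment3 t.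
Proof. by move=> t0; apply: integral_ge0 => x tx; rewrite mule_ge0 ?poweR_ge0 ?(w0y t0 tx). Qed.

Let bound_of_term (t rho : R) (I : \bar R) : (0 < t)%R -> (0 <= rho)%R -> 0 <= I ->
  ((U t)^-1)%:E * I `^ q^-1 <= rho%:E -> I <= ((rho * U t) `^ q)%:E.
Proof.
move=> t0 rho0 I0 h; have u0 := U_gt0 t0.
have h1 : I `^ q^-1 <= (rho * U t)%:E.
  have u0' : 0 <= (U t)%:E by rewrite lee_fin ltW.
  have := lee_wpmul2r u0' h.
  by rewrite -EFinM muleAC -EFinM mulVf ?gt_eqF// mul1e.
rewrite -(poweRVK qn0 I0) -poweR_EFin; apply: le_poweR => //; first exact: ltW.
exact: poweR_ge0.
Qed.

Let term_of_bound (t kappa : R) (I L C : \bar R) : (0 < t)%R -> (0 <= kappa)%R ->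
  0 <= I -> 0 <= L -> I <= (kappa%:E * L) `^ q -> L <= C * (U t)%:E ->
  ((U t)^-1)%:E * I `^ q^-1 <= kappa%:E * C.
Proof.
move=> t0 k0 I0 L0 IL LC; have u0 := U_gt0 t0.
have ui : 0 <= ((U t)^-1)%:E by rewrite lee_fin invr_ge0 ltW.
have h : I `^ q^-1 <= kappa%:E * L.
  rewrite -(poweRK qn0 (_ : 0 <= kappa%:E * L)) ?mule_ge0//.
  by apply: le_poweR; rewrite // invr_ge0 ltW.
apply: le_trans (lee_wpmul2l ui (le_trans h (lee_wpmul2l _ LC))) _; first by rewrite lee_fin.
by rewrite (muleC C) !muleA -EFinM mulrAC mulVf ?gt_eqF// mul1r.
Qed.

(** For [x < t] the values [tau <= t] contribute to the first term and the values
    [tau > t] to the second; for [x > t] only the third term occurs. *)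
Lemma head_ind_bound (t rho : R) : (0 < t)%R -> (0 <= rho)%R ->
  term1 t <= rho%:E -> term2 t <= rho%:E -> term3 t <= rho%:E ->
  ipos (fun x => tail_sup phi (head_norm_ind alpha B t) x `^ q * (w x)%:E) <=
  ((3 `^ q^-1 * rho) `^ q * Vr m p v t `^ (q / m))%:E.
Proof.
move=> t0 rho0; rewrite term1E// term2E// term3E//.
move=> /(bound_of_term t0 rho0 (moment1_ge0 t)) I1.
move=> /(bound_of_term t0 rho0 (moment2_ge0 t)) I2.
move=> /(bound_of_term t0 rho0 (moment3_ge0 t0)) I3.
have X0 (x : R) : (0 < x)%R -> 0 <= tail_sup phi (head_norm_ind alpha B t) x.
  by move=> x0; apply: tail_sup_ge0 => // tau _; rewrite lee_fin powR_ge0.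
have mX : mpos (fun x => tail_sup phi (head_norm_ind alpha B t) x `^ q * (w x)%:E).
  apply: mposM => //; apply: mpos_nonincreasing => x y x0 xy.
  by apply: le_poweR; rewrite ?(ltW q0) ?tail_sup_nonincreasing ?X0// (lt_le_trans x0).
have pX : ge0pos (fun x => tail_sup phi (head_norm_ind alpha B t) x `^ q * (w x)%:E).
  by move=> x x0; rewrite mule_ge0 ?poweR_ge0 ?lee_fin ?w0.
have first_part : \int[mu]_(x in `]0%R, t[)
    (tail_sup phi (head_norm_ind alpha B t) x `^ q * (w x)%:E) <= moment1 t + moment2 t.
  rewrite -ipos_below /moment1 /moment2 -iposD.
  - apply: le_ipos; first exact: below_ge0.
    move=> x x0; rewrite /below; case: ltP => xt; last by rewrite adde0.
    rewrite -ge0_muleDl ?poweR_ge0//; apply: lee_wpmul2r; first by rewrite lee_fin w0.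
    have S0 := supI_ge0 x0 (ltW xt).
    have V0 : 0 <= (B t `^ alpha^-1)%:E * supV t.
      by rewrite mule_ge0 ?supV_ge0// lee_fin powR_ge0.
    have : tail_sup phi (head_norm_ind alpha B t) x <=
        maxe (supI x t) ((B t `^ alpha^-1)%:E * supV t).
      apply: tail_sup_le => tau xtau; rewrite le_max /head_norm_ind -EFinM; apply/orP.
      have [taut|ttau] := leP tau t; first by left; exact: supI_ge.
      right; rewrite EFinM; apply: lee_wpmul2l; first by rewrite lee_fin powR_ge0.
      by apply: supV_ge; exact: ltW.
    rewrite /maxe; case: ifP => _ h.
      apply: le_trans (le_poweR (ltW q0) (X0 _ x0) h) _.
      by rewrite leeDr// poweR_ge0.
    apply: le_trans (le_poweR (ltW q0) (X0 _ x0) h) _.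
    by rewrite leeDl// poweR_ge0.
  - rewrite (_ : below _ _ = fun x => (w x)%:E * below t (fun x => supI x t `^ q) x); last first.
      by apply/funext => x; rewrite /below; case: ifP => _; rewrite ?mule0// muleC.
    apply: mposM => //; apply: mpos_nonincreasing => x y x0 xy; rewrite /below.
    case: (ltP y t) => yt; last by case: ifP => // _; exact: poweR_ge0.
    rewrite (le_lt_trans xy)//; apply: le_poweR; rewrite ?(ltW q0) ?supI_nonincreasing//.
    by apply: supI_ge0; [exact: lt_le_trans xy|exact: ltW].
  - by apply: mpos_below; apply: mposM => //; exact: mpos_cst.
  - by apply: below_ge0 => x x0; rewrite mule_ge0 ?poweR_ge0 ?lee_fin ?w0.
  - by apply: below_ge0 => x x0; rewrite mule_ge0 ?poweR_ge0 ?lee_fin ?w0.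
have second_part : \int[mu]_(x in `]t, +oo[)
    (tail_sup phi (head_norm_ind alpha B t) x `^ q * (w x)%:E) <= moment3 t.
  apply: ge0_le_lower_integral => // x tx.
    by rewrite mule_ge0 ?poweR_ge0 ?(w0y t0 tx).
  have wx0 := w0y t0 tx; move: tx; rewrite /= in_itv/= andbT => tx.
  have x0 := lt_trans t0 tx.
  rewrite mule_ge0 ?poweR_ge0//=; apply: lee_wpmul2r => //.
  apply: le_poweR; rewrite ?(ltW q0) ?X0//; apply: tail_sup_le => tau xtau.
  rewrite /head_norm_ind min_r; last by rewrite ltW// (lt_le_trans tx).
  by apply: lee_wpmul2l; [rewrite lee_fin powR_ge0|exact: supV_ge].
rewrite (ipos_split t0 mX pX); apply: le_trans (leeD first_part second_part) _.
apply: le_trans (leeD (leeD I1 I2) I3) _; rewrite -!EFinD lee_fin.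
rewrite (powRM q rho0 (ltW (U_gt0 t0))) (powRM q (powR_ge0 _ _) rho0).
rewrite -powRrM mulVf// powRr1// /U -powRrM (mulrC m^-1%R).
by rewrite le_eqVlt; apply/orP; left; apply/eqP; ring.
Qed.

Definition upper_constant : R :=
  (maximal_constant n alpha r K2 K3 K4 * (3 * (4 `^ (q / p) * level_constant m p `^ (q / m))) `^ q^-1)%R.

Lemma maximal_constant_gt0 : (0 < maximal_constant n alpha r K2 K3 K4)%R.
Proof.
by rewrite /maximal_constant !mulr_gt0 ?powR_gt0// addr_gt0// !mulr_gt0// powR_gt0//.
Qed.

Lemma upper_bound (rho : R) (f : Rn -> \bar R) : (0 <= rho)%R ->
  (forall t : R, (0 < t)%R -> [/\ term1 t <= rho%:E, term2 t <= rho%:E & term3 t <= rho%:E]) ->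
  measurable_fun setT f ->
  Lambda_norm q w (maximal phi alpha b f) <= (upper_constant * rho)%:E * GGamma_norm p m v f.
Proof.
move=> rho0 hrho mf; set g := rearrangement f.
have g0 : ge0pos g by move=> x _; exact: rearrangement_ge0.
have gni (x y : R) : (0 < x)%R -> (x <= y)%R -> g y <= g x.
  by move=> _; exact: rearrangement_nonincreasing.
have HA t : (0 < t)%R -> ipos (fun x => tail_sup phi (head_norm_ind alpha B t) x `^ q * (w x)%:E) <=
    ((3 `^ q^-1 * rho) `^ q * Vr m p v t `^ (q / m))%:E.
  by move=> t0; have [h1 h2 h3] := hrho t t0; exact: head_ind_bound.
have VE t : (0 < t)%R -> ipos (fun x => (Num.min x t `^ (m / p) * v x)%:E) = (Vr m p v t)%:E.
  by move=> t0; rewrite -(v1_min Wv t0) VrE.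
have main := weighted_inequality_general m0 ma p0 pa aq b0 bni BE B0 phi0 phiK
  mv v0 mw w0 VE (Vr_gt0 m0 p0 Wv) g0 gni HA.
clear VE HA.
set I := ipos _ in main; set G := ipos _ in main.
have G0 : 0 <= G by apply: ipos_ge0 => x x0; rewrite mule_ge0 ?poweR_ge0 ?lee_fin ?v0.
have I0 : 0 <= I by apply: ipos_ge0 => x x0; rewrite mule_ge0 ?poweR_ge0 ?lee_fin ?w0.
have C0 := maximal_constant_gt0.
have F0 (x : R) : (0 < x)%R -> 0 <= tail_sup phi (head_norm alpha b g) x.
  by move=> x0; apply: tail_sup_ge0 => // tau _; exact: poweR_ge0.
have H1 : ipos (fun x => rearrangement (maximal phi alpha b f) x `^ q * (w x)%:E) <=
    (maximal_constant n alpha r K2 K3 K4 `^ q)%:E * I.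
  rewrite /I -iposZl ?powR_ge0//; last 2 first.
  - apply: mposM => //; apply: mpos_nonincreasing => x y x0 xy.
    by apply: le_poweR; rewrite ?(ltW q0) ?tail_sup_nonincreasing ?F0// (lt_le_trans x0).
  - by move=> x x0; rewrite mule_ge0 ?poweR_ge0 ?lee_fin ?w0.
  apply: le_ipos => x x0; first by rewrite mule_ge0 ?poweR_ge0 ?lee_fin ?w0.
  rewrite muleA; apply: lee_wpmul2r; first by rewrite lee_fin w0.
  rewrite -poweR_EFin -poweRM ?lee_fin ?(ltW C0) ?F0//; apply: le_poweR.
  - exact: ltW.
  - exact: rearrangement_ge0.
  exact: (rearrangement_maximal_le phi0 alpha0 ar K20 K30 K40 mb b0 BE Bq phiK Qphi mf x0).
have Cq0 : 0 <= (maximal_constant n alpha r K2 K3 K4 `^ q)%:E by rewrite lee_fin powR_ge0.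
have H2 := le_trans H1 (lee_wpmul2l Cq0 main).
rewrite Lambda_normE; apply: le_trans (le_poweR _ _ H2) _.
- by rewrite invr_ge0 ltW.
- by apply: ipos_ge0 => x x0; rewrite mule_ge0 ?poweR_ge0 ?lee_fin ?w0.
have Ct0 := level_constant_gt0 m0 p0.
have e1 : (GGamma_norm p m v f = G `^ m^-1) by [].
rewrite e1 muleA -EFinM poweRM ?poweR_ge0 ?lee_fin ?mulr_ge0 ?powR_ge0//.
rewrite -poweRrM (_ : q / m / q = m^-1)%R; last by field; rewrite !gt_eqF.
rewrite poweR_EFin; apply: lee_wpmul2r; first exact: poweR_ge0.
rewrite lee_fin le_eqVlt; apply/orP; left; apply/eqP.
have k1 (a : R) : (0 <= a)%R -> ((a `^ q) `^ q^-1 = a)%R.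
  by move=> a0; rewrite -powRrM divff// powRr1.
rewrite /upper_constant; set D := (4 `^ (q / p) * _)%R.
have D0 : (0 <= D)%R by rewrite mulr_ge0 ?powR_ge0.
rewrite (powRM q^-1 (powR_ge0 _ _) (mulr_ge0 D0 (powR_ge0 _ _))).
rewrite (powRM q^-1 D0 (powR_ge0 _ _)) (k1 _ (ltW C0)).
rewrite (k1 _ (mulr_ge0 (powR_ge0 _ _) rho0)) (powRM q^-1 _ D0)//; ring.
Qed.

Definition lower_constant : R := (2 + K4 * 2 `^ r^-1)%R.

(** Test the inequality on the indicator of one cube of measure [t].  In the
    third term [tau = x] is not allowed in [rearrangement_maximal_ind_ge]; there
    [tau] is doubled, at the cost of [phi (2 * tau) <= K4 * 2 `^ r^-1 * phi tau]. *)
Lemma lower_bound (C : \bar R) : 0 <= C ->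
  (forall f : Rn -> \bar R, measurable_fun setT f ->
      Lambda_norm q w (maximal phi alpha b f) <= C * GGamma_norm p m v f) ->
  three_suprema <= lower_constant%:E * C.
Proof.
move=> C0 HC.
have kap0 : (0 <= K4 * 2 `^ r^-1)%R by rewrite mulr_ge0 ?powR_ge0// ltW.
have key (t : R) : (0 < t)%R ->
    [/\ term1 t <= C, term2 t <= C & term3 t <= (K4 * 2 `^ r^-1)%:E * C].
  move=> t0; have [l l0 lt] := side_length n0 t0.
  pose Q : n.-tuple R * R := ([tuple (0 : R)%R | i < n], l).
  have Qt : leb (box_cube Q) = t%:E by rewrite /box_cube lebesgue_n_cube// lt.
  have mI := measurable_ind (measurable_box_cube Q).
  have := HC _ mI; rewrite (GGamma_norm_ind p0 Wv t0 Qt) -/(U t).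
  set M := maximal phi alpha b (ind (box_cube Q)); set L := Lambda_norm q w M => LC.
  have L0 : 0 <= L by exact: Lambda_norm_ge0.
  have Mge (tau x : R) : (0 < tau)%R -> (x < Num.max tau t)%R ->
      head_norm_ind alpha B t tau * ((phi tau)^-1)%:E <= rearrangement M x.
    move=> tau0 xt; have := @rearrangement_maximal_ind_ge R n alpha b B phi alpha0 BE
      phi0 n0 Q tau x l0 tau0; rewrite lt; exact.
  have R0 x : 0 <= rearrangement M x by exact: rearrangement_ge0.
  have Lq : L `^ q = ipos (fun x => rearrangement M x `^ q * (w x)%:E).
    rewrite /L Lambda_normE poweRVK//; apply: ipos_ge0 => x x0.
    by rewrite mule_ge0 ?poweR_ge0 ?lee_fin ?w0.
  rewrite term1E// term2E// term3E//.
  have below_le (h : R -> \bar R) : (forall x : R, (0 < x)%R -> (x < t)%R -> 0 <= h x <= rearrangement M x) ->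
      ipos (below t (fun x => h x `^ q * (w x)%:E)) <= L `^ q.
    move=> hM; rewrite Lq; apply: le_ipos.
      by apply: below_ge0 => x x0; rewrite mule_ge0 ?poweR_ge0 ?lee_fin ?w0.
    move=> x x0; rewrite /below; case: ifP => xt; last by rewrite mule_ge0 ?poweR_ge0 ?lee_fin ?w0.
    apply: lee_wpmul2r; first by rewrite lee_fin w0.
    by have /andP[h0 h1] := hM x x0 xt; apply: le_poweR => //; exact: ltW.
  split.
  - rewrite -[leRHS]mul1e; apply: (term_of_bound t0 _ (moment1_ge0 t) L0 _ LC) => //.
    rewrite mul1e; apply: below_le => x x0 xt; rewrite supI_ge0 ?(ltW xt)//=.
    apply: supI_le => tau xtau taut; have tau0 := lt_le_trans x0 xtau.
    have := Mge tau x tau0; rewrite lt_max xt orbT => /(_ isT).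
    by rewrite /head_norm_ind min_l.
  - rewrite -[leRHS]mul1e; apply: (term_of_bound t0 _ (moment2_ge0 t) L0 _ LC) => //.
    rewrite mul1e; apply: below_le => x x0 xt.
    rewrite mule_ge0 ?supV_ge0 ?lee_fin ?powR_ge0//=.
    apply: supV_mul_le; first exact: beta_gt0.
    move=> tau ttau; have tau0 := lt_le_trans t0 ttau.
    have := Mge tau x tau0; rewrite lt_max xt orbT => /(_ isT).
    by rewrite /head_norm_ind min_r.
  - apply: (term_of_bound t0 kap0 (moment3_ge0 t0) L0 _ LC).
    rewrite poweRM ?lee_fin// Lq -iposZl ?poweR_EFin ?powR_ge0//; last 2 first.
    + apply: mposM => //; apply: mpos_nonincreasing => x y x0 xy.
      by apply: le_poweR; rewrite ?(ltW q0)// rearrangement_nonincreasing.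
    + by move=> x x0; rewrite mule_ge0 ?poweR_ge0 ?lee_fin ?w0.
    rewrite /moment3 /ipos; apply: ge0_le_lower_integral => x.
    + by move=> /posP x0; rewrite mule_ge0 ?lee_fin ?powR_ge0// mule_ge0 ?poweR_ge0 ?lee_fin ?w0.
    + by rewrite /= !in_itv/= !andbT; exact: lt_trans.
    move=> tx; have wx0 := w0y t0 tx; move: tx; rewrite /= in_itv/= andbT => tx.
    have x0 := lt_trans t0 tx.
    rewrite mule_ge0 ?poweR_ge0//= muleA; apply: lee_wpmul2r => //.
    rewrite -(poweR_EFin (K4 * _)%R) -poweRM ?lee_fin//; apply: le_poweR.
    + exact: ltW.
    + by rewrite mule_ge0 ?supV_ge0 ?lee_fin ?powR_ge0.
    apply: supV_mul_le; first exact: beta_gt0.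
    move=> tau xtau; have tau0 := lt_le_trans x0 xtau.
    have tau20 : (0 < 2 * tau)%R by rewrite mulr_gt0.
    have x2 : (x < 2 * tau)%R by apply: (le_lt_trans xtau); rewrite ltr_pMl ?ltr1n.
    have := Mge (2 * tau)%R x tau20; rewrite lt_max x2 => /(_ isT).
    rewrite /head_norm_ind min_r; last by rewrite ltW// (lt_trans tx).
    have kE : 0 <= (K4 * 2 `^ r^-1)%:E by rewrite lee_fin.
    move=> /(lee_wpmul2l kE); apply: le_trans.
    rewrite -!EFinM lee_fin mulrCA ler_wpM2l ?powR_ge0//.
    rewrite ler_pdivlMr ?phi0// mulrC ler_pdivrMr ?phi0//.
    have := Q_class_mul 1 r0 phi0 Qphi tau0.
    by rewrite mulrA.
have le1 (T : R -> \bar R) (c : \bar R) : (forall t : R, (0 < t)%R -> T t <= c) ->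
    ereal_sup [set T t | t in `]0%R, +oo[] <= c.
  by move=> H; apply: ge_ereal_sup => _ [t /= + <-]; rewrite in_itv/= andbT; exact: H.
rewrite /three_suprema /lower_constant EFinD ge0_muleDl// (_ : 2%:E = 1 + 1)//.
rewrite ge0_muleDl// !mul1e; apply: leeD; first apply: leeD.
- by apply: le1 => t /key[].
- by apply: le1 => t /key[].
- by apply: le1 => t /key[].
Qed.

Lemma three_suprema_ge0 : 0 <= three_suprema.
Proof.
have T0 (T I : R -> \bar R) : (forall t : R, (0 < t)%R -> T t = ((U t)^-1)%:E * I t `^ q^-1) ->
    0 <= ereal_sup [set T t | t in `]0%R, +oo[].
  move=> TE; apply: (@le_trans _ _ (T 1%R)).
    by rewrite TE// mule_ge0 ?poweR_ge0// lee_fin invr_ge0 ltW// U_gt0.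
  by apply: ereal_sup_ubound; exists 1%R => //=; rewrite in_itv/= ltr01.
exact: adde_ge0 (adde_ge0 (T0 _ _ term1E) (T0 _ _ term2E)) (T0 _ _ term3E).
Qed.

Lemma upper_norm : maximal_norm n phi alpha b p m v q w <= upper_constant%:E * three_suprema.
Proof.
have l10 : (0 < upper_constant)%R.
  by rewrite /upper_constant mulr_gt0 ?maximal_constant_gt0// powR_gt0// !mulr_gt0// powR_gt0// level_constant_gt0.
have ge1 (T : R -> \bar R) (t : R) : (0 < t)%R ->
    T t <= ereal_sup [set T t | t in `]0%R, +oo[].
  by move=> t0; apply: ereal_sup_ubound; exists t => //=; rewrite in_itv/= t0.
have T10 t : (0 < t)%R -> 0 <= term1 t.
  by move=> t0; rewrite term1E// mule_ge0 ?poweR_ge0// lee_fin invr_ge0 ltW// U_gt0.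
have T20 t : (0 < t)%R -> 0 <= term2 t.
  by move=> t0; rewrite term2E// mule_ge0 ?poweR_ge0// lee_fin invr_ge0 ltW// U_gt0.
have T30 t : (0 < t)%R -> 0 <= term3 t.
  by move=> t0; rewrite term3E// mule_ge0 ?poweR_ge0// lee_fin invr_ge0 ltW// U_gt0.
have s1 := le_trans (T10 1%R ltr01) (ge1 term1 1%R ltr01).
have s2 := le_trans (T20 1%R ltr01) (ge1 term2 1%R ltr01).
have s3 := le_trans (T30 1%R ltr01) (ge1 term3 1%R ltr01).
have rhs0 := three_suprema_ge0.
apply: ereal_inf_lbound; split; first by rewrite mule_ge0// lee_fin ltW.
move=> f mf; case E : three_suprema rhs0 => [rho| |//] rho0.
  rewrite -EFinM; apply: upper_bound => // t t0; rewrite -E /three_suprema; split.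
  - exact: le_trans (ge1 term1 t t0) (le_trans (leeDl _ s2) (leeDl _ s3)).
  - exact: le_trans (ge1 term2 t t0) (le_trans (leeDr _ s1) (leeDl _ s3)).
  - exact: le_trans (ge1 term3 t t0) (leeDr _ (adde_ge0 s1 s2)).
(* The constant is infinite: only functions of norm zero are constrained. *)
clear E; rewrite gt0_muley ?lte_fin//.
have GG0 : 0 <= GGamma_norm p m v f by exact: poweR_ge0.
have [GGE|GGn0] := eqVneq (GGamma_norm p m v f) 0; last first.
  by rewrite gt0_mulye ?leey// lt_neqAle eq_sym GGn0.
have g0 : ge0pos (rearrangement f) by move=> x _; exact: rearrangement_ge0.
have gz := GGamma_integral_eq0 m0 p0 Wv g0 (fun x y _ => rearrangement_nonincreasing f (s := x) (t := y))
  (poweR_eq0_eq0 (ipos_ge0 (fun x x0 => mule_ge0 (poweR_ge0 _ _) (v0 x0 : 0 <= (v x)%:E))) GGE).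
clear GGE; rewrite (_ : Lambda_norm _ _ _ = 0) ?mule_ge0//.
rewrite Lambda_normE (_ : ipos _ = 0) ?poweR0r ?invr_eq0//.
rewrite /ipos; apply: integral0_eq => x /posP x0.
rewrite (_ : rearrangement _ _ = 0) ?poweR0r ?mul0e//.
apply/eqP; rewrite eq_le rearrangement_ge0 andbT.
apply: le_trans (rearrangement_maximal_le phi0 alpha0 ar K20 K30 K40 mb b0 BE Bq phiK Qphi mf x0) _.
rewrite (_ : tail_sup _ _ _ = 0) ?mule0//; apply/eqP; rewrite eq_le tail_sup_ge0 ?andbT//; last first.
  by move=> tau _; exact: poweR_ge0.
apply: tail_sup_le => tau _; rewrite /head_norm integral0_eq ?poweR0r ?invr_eq0 ?gt_eqF ?mul0e// => s /=.
by rewrite in_itv/= => /andP[s0 _]; rewrite gz// poweR0r ?mul0e// gt_eqF.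
Qed.

Lemma lower_norm : three_suprema <= lower_constant%:E * maximal_norm n phi alpha b p m v q w.
Proof.
have l20 : (0 < lower_constant)%R by rewrite /lower_constant addr_gt0// mulr_gt0// powR_gt0.
have li : 0 <= (lower_constant^-1)%:E by rewrite lee_fin invr_ge0 ltW.
have h : (lower_constant^-1)%:E * three_suprema <= maximal_norm n phi alpha b p m v q w.
  apply: le_ereal_inf_tmp => C [C0 HC].
  apply: le_trans (lee_wpmul2l li (lower_bound C0 HC)) _.
  by rewrite muleA -[X in X * _ <= _]EFinM mulVf ?gt_eqF// mul1e.
have := lee_wpmul2l (ltW l20 : 0 <= lower_constant%:E) h.
by rewrite muleA -EFinM divff ?gt_eqF// mul1e.
Qed.

Lemma maximal_norm_ge0 : 0 <= maximal_norm n phi alpha b p m v q w.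
Proof. by apply: le_ereal_inf_tmp => C []. Qed.

End characterisation.

Theorem theorem4p2 (R : realType) (n : nat) (m alpha r p q : R)
    (K1 K2 K3 K4 : R) :
  (0 < n)%N ->
  (0 < m)%R -> (m <= alpha)%R -> (alpha <= r)%R ->
  (0 < p)%R -> (p <= alpha)%R -> (alpha < q)%R ->
  (0 < K1)%R -> (0 < K2)%R -> (0 < K3)%R -> (0 < K4)%R ->
  exists2 lambda : R, (0 < lambda)%R &
  forall b phi v w : R -> R,
  weight b ->
  {in `]0%R, +oo[ &, forall s t, (s <= t)%R -> (b t <= b s)%R} ->
  (forall t, (0 < t)%R ->
    0 < \int[completed_lebesgue_measure]_(s in `]0%R, t[) (b s)%:E < +oo) ->
  let B := primitive b in
  Delta2 K1 B ->
  B t @[t --> +oo%R] --> +oo%R ->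
  quasi_increasing K2 (fun t => B t / t `^ (alpha / r))%R ->
  weight phi ->
  (forall t, (0 < t)%R -> (0 < phi t)%R) ->
  {within `]0%R, +oo[, continuous phi} ->
  quasi_increasing K3 phi ->
  Q_class r K4 phi ->
  W_class m p v ->
  weight w ->
  let lhs := maximal_norm n phi alpha b p m v q w in
  let rhs :=
    ereal_sup [set
      (v1 m p v t `^ m^-1)^-1 *
      (\int[completed_lebesgue_measure]_(x in `]0%R, t[)
         (ereal_sup [set (B tau `^ alpha^-1 / phi tau)%:E | tau in `[x, t]]
            `^ q * (w x)%:E)) `^ q^-1
      | t in `]0%R, +oo[] +
    ereal_sup [set
      (B t `^ alpha^-1)%:E / v1 m p v t `^ m^-1 *
      ereal_sup [set (phi tau)^-1%:E | tau in `[t, +oo[] *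
      (\int[completed_lebesgue_measure]_(x in `]0%R, t[) (w x)%:E) `^ q^-1
      | t in `]0%R, +oo[] +
    ereal_sup [set
      (B t `^ alpha^-1)%:E / v1 m p v t `^ m^-1 *
      (\int[completed_lebesgue_measure]_(x in `]t, +oo[)
         (ereal_sup [set (phi tau)^-1%:E | tau in `[x, +oo[]
            `^ q * (w x)%:E)) `^ q^-1
      | t in `]0%R, +oo[] in
  lhs <= lambda%:E * rhs /\ rhs <= lambda%:E * lhs.
Proof.
move=> n0 m0 ma ar p0 pa aq K10 K20 K30 K40.
have alpha0 := lt_le_trans m0 ma.
have l10 : (0 < upper_constant n m alpha r p q K2 K3 K4)%R.
  rewrite /upper_constant mulr_gt0 ?maximal_constant_gt0// powR_gt0// !mulr_gt0// powR_gt0//.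
  exact: level_constant_gt0.
have l20 : (0 < lower_constant r K4)%R by rewrite /lower_constant addr_gt0// mulr_gt0// powR_gt0.
exists (upper_constant n m alpha r p q K2 K3 K4 + lower_constant r K4)%R; first exact: addr_gt0.
move=> b phi v w Wb bni bfin B _ _ Bq _ phi0 _ phiK Qphi Wv Ww lhs rhs.
have bni' (x y : R) : (0 < x)%R -> (x <= y)%R -> (b y <= b x)%R.
  by move=> x0 xy; apply: bni => //; rewrite in_itv/= ?x0// (lt_le_trans x0 xy).
have BE t : (0 < t)%R -> \int[completed_lebesgue_measure]_(s in `]0%R, t[) (b s)%:E = (B t)%:E.
  move=> t0; have /andP[i0 iy] := bfin t t0.
  by rewrite /B /primitive /Rintegral fineK// ge0_fin_numE// ltW.
have B0 t : (0 < t)%R -> (0 < B t)%R.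
  by move=> t0; have /andP[+ _] := bfin t t0; rewrite BE// lte_fin.
split.
  apply: le_trans (upper_norm n m0 ma ar p0 pa aq K20 K30 K40 Wb bni' BE B0 Bq phi0
    phiK Qphi Wv Ww) _.
  apply: lee_wpmul2r; last by rewrite lee_fin lerDl ltW.
  exact: three_suprema_ge0.
apply: le_trans (lower_norm n0 m0 ma ar p0 aq K40 BE B0 phi0 Qphi Wv Ww) _.
apply: lee_wpmul2r; last by rewrite lee_fin lerDr ltW.
exact: maximal_norm_ge0.
Qed.
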